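(* Let $E_0\subset E$ be a fixed Borel subset. For $n\in\mathbb N$ let $H^{(n)}=L^{(n)}+V^{(n)}$, where $L^{(n)}$ is the range of an orthogonal projection operator $\Pi^{(n)}\in\mathscr I_{1,\mathrm{loc}}(E,\mu)$ and $V^{(n)}\subset L_{2,\mathrm{loc}}(E,\mu)$ is finite-dimensional, and let $H=L+V$, where $L$ is the range of an orthogonal projection operator $\Pi\in\mathscr I_{1,\mathrm{loc}}(E,\mu)$ and $V\subset L_{2,\mathrm{loc}}(E,\mu)$ is finite-dimensional. Assume that the triples $(L^{(n)},V^{(n)},E_0)$, $n\in\mathbb N$, and $(L,V,E_0)$ satisfy Assumption A (see context). Assume (1) $\Pi^{(n)}\to\Pi$ in $\mathscr I_{1,\mathrm{loc}}(E,\mu)$ as $n\to\infty$; (2) $V^{(n)}$ admits a basis $v_1^{(n)},\dots,v_m^{(n)}$ and $V$ admits a basis $v_1,\dots,v_m$ such that $v_i^{(n)}\to v_i$ in $L_{2,\mathrm{loc}}(E,\mu)$ as $n\to\infty$ for all $i=1,\dots,m$. Let $g:E\to[0,1]$ be a positive measurable function such that (a) $\sqrt{1-g}\,\Pi^{(n)}\sqrt{1-g}\in\mathscr I_1(E,\mu)$ for all $n$ and $\sqrt{1-g}\,\Pi\sqrt{1-g}\in\mathscr I_1(E,\mu)$; (b) $\lim_{n\to\infty}\operatorname{tr}\sqrt{1-g}\,\Pi^{(n)}\sqrt{1-g}=\operatorname{tr}\sqrt{1-g}\,\Pi\sqrt{1-g}$; (c) $\sqrt gV^{(n)}\subset L_2(E,\mu)$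 for all $n$ and $\sqrt gV\subset L_2(E,\mu)$; (d) $\sqrt gv_i^{(n)}\to\sqrt gv_i$ in $L_2(E,\mu)$ as $n\to\infty$ for all $i=1,\dots,m$. Then (i) the subspaces $\sqrt gH^{(n)}$ and $\sqrt gH$ are closed; (ii) the operators $\Pi^{(g,n)}$ of orthogonal projection onto $\sqrt gH^{(n)}$ and the operator $\Pi^g$ of orthogonal projection onto $\sqrt gH$ satisfy $\Pi^{(g,n)}\to\Pi^g$ in $\mathscr I_{1,\mathrm{loc}}(E,\mu)$ as $n\to\infty$.
   Context: $E$ is a locally compact complete separable metric space in which bounded sets have compact closure, and $\mu$ is a sigma-finite Borel measure on $E$. $\mathscr I_1(E,\mu)$ is the space of trace-class operators on $L_2(E,\mu)$ with the trace norm. $\mathscr I_{1,\mathrm{loc}}(E,\mu)$ is the space of bounded operators $K$ on $L_2(E,\mu)$ such that $\chi_BK\chi_B\in\mathscr I_1(E,\mu)$ for every bounded Borel set $B\subset E$; convergence $K_n\to K$ in $\mathscr I_{1,\mathrm{loc}}(E,\mu)$ means $\|\chi_B(K_n-K)\chi_B\|_{\mathscr I_1}\to0$ for every bounded Borel $B$. $L_{2,\mathrm{loc}}(E,\mu)$ is the space of measurable functions (mod $\mu$) square integrable on every bounded Borel set, with convergence in $L_2(B,\mu)$ for every bounded Borel $B$. Functions are identified with multiplication operators. Assumption A for $(L,V,E_0)$, where $L\subset L_2(E,\mu)$ is a closed subspace whose orthogonal projection $Q$ lies in $\mathscr I_{1,\mathrm{loc}}(E,\mu)$, $V\subset L_{2,\mathrm{loc}}(E,\mu)$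 is finite-dimensional and $E_0\subset E$ is Borel: (A1) $\chi_{E\setminus E_0}Q\chi_{E\setminus E_0}\in\mathscr I_1(E,\mu)$; (A2) $\chi_{E_0}V\subset L_2(E,\mu)$; (A3) if $\varphi\in V$ satisfies $\chi_{E_0}\varphi\in\chi_{E_0}L$, then $\varphi=0$; (A4) if $\varphi\in L$ satisfies $\chi_{E_0}\varphi=0$, then $\varphi=0$. *)

(* Defs.v *)
From HB Require Import structures.
From mathcomp Require Import all_boot all_order all_algebra.
From mathcomp Require Import all_classical all_reals all_analysis.
From mathcomp Require Import complex.

Set Implicit Arguments.
Unset Strict Implicit.
Unset Printing Implicit Defensive.

Import Order.TTheory GRing.Theory Num.Theory.
Import numFieldNormedType.Exports.

Local Open Scope classical_set_scope.
Local Open Scope ring_scope.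

(* The library's [Complete] structure carries a point, so these metric spaces
   are nonempty; [measurableType] imposes the same restriction. *)
#[short(type="completeMetricType")]
HB.structure Definition CompleteMetric (K : realType) :=
  {T of Complete T & Metric K T}.

Notation Borel E := (g_sigma_algebraType (@open E)).

Definition separable (T : topologicalType) :=
  exists2 S : set T, countable S & dense S.

Definition metric_bounded (R : realType) (E : completeMetricType R)
    (B : set E) := exists x r, B `<=` ball x r.

Definition fmul (T : Type) (R : realType) (u : T -> R) (f : T -> R[i]) :
    T -> R[i] :=
  fun x => real_complex R (u x) * f x.

Definition sandwich (T : Type) (R : realType) (u : T -> R)
    (K : (T -> R[i]) -> (T -> R[i])) :=
  fun f => fmul u (K (fmul u f)).

(* Elements of L_2 and L_2,loc are represented by measurable functions
   T -> R[i]; equality modulo mu is [f = g %[ae mu]].  A set of such functions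
   that stands for a set of classes contains every measurable representative
   of its members, so that set equality is equality of sets of classes.  An
   operator on L_2 is a map on functions of which only the action on
   [L2 mu] modulo mu is relevant. *)
Section L2_space.
Context d (T : measurableType d) (R : realType).
Variable mu : {measure set T -> \bar R}.

Implicit Types (f g h : T -> R[i]) (u : T -> R) (W V : set (T -> R[i])).

Definition cmeasurable f :=
  measurable_fun setT (fun x => complex.Re (f x)) /\
  measurable_fun setT (fun x => complex.Im (f x)).

Definition L2norm f : \bar R :=
  Lnorm mu 2%:E (fun x => (Normc.normc (f x))%:E).

Definition L2 : set (T -> R[i]) :=
  [set f | cmeasurable f /\ (L2norm f < +oo)%E].

Definition inner f g : R[i] :=
  Complex (Rintegral mu setT (fun x => complex.Re (f x * conjc (g x))))
          (Rintegral mu setT (fun x => complex.Im (f x * conjc (g x)))).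

Definition L2_cvg (f_ : nat -> T -> R[i]) f :=
  L2norm (f_ n - f) @[n --> \oo] --> 0%E.

Definition L2_closed W :=
  W `<=` L2 /\
  forall f, L2 f ->
    (forall e : R, 0 < e -> exists2 w, W w & (L2norm (f - w)%R < e%:E)%E) ->
    W f.

Definition set_sum W V : set (T -> R[i]) :=
  [set f | cmeasurable f /\
    exists w v, [/\ W w, V v & f = w + v %[ae mu]]].

Definition fmul_set u W : set (T -> R[i]) :=
  [set f | cmeasurable f /\ exists2 w, W w & f = fmul u w %[ae mu]].

Definition is_basis m V (v : 'I_m -> T -> R[i]) :=
  [/\ forall i, V (v i),
      V = [set f | cmeasurable f /\ exists c : 'I_m -> R[i],
             f = (fun x => \sum_(i < m) c i * v i x) %[ae mu]] &
      forall c : 'I_m -> R[i],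
        (fun x => \sum_(i < m) c i * v i x) = (fun=> 0) %[ae mu] ->
        forall i, c i = 0].

Definition finite_dim V := exists m (v : 'I_m -> T -> R[i]), is_basis V v.

Section operators.
Implicit Types K A P : (T -> R[i]) -> (T -> R[i]).

(* Linearity and the norm bound force K to respect equality modulo mu. *)
Definition bounded_op K :=
  [/\ forall f, L2 f -> L2 (K f),
      forall (a : R[i]) f g, L2 f -> L2 g ->
        K (fun x => a * f x + g x) = (fun x => a * K f x + K g x) %[ae mu] &
      exists M : R, forall f, L2 f -> (L2norm (K f) <= M%:E * L2norm f)%E].

(* The order of R[i] is such that 0 <= z means that z is real and
   nonnegative. *)
Definition positive_op A := forall f, L2 f -> 0 <= inner (A f) f.

(* A = |K| is the positive square root of K^* K; the last clause is
   A^2 = K^* K, tested against all pairs of vectors. *)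
Definition is_absval K A :=
  [/\ bounded_op A, positive_op A &
      forall f g, L2 f -> L2 g -> inner (A (A f)) g = inner (K f) (K g)].

Definition absval K := xget (fun _ : T -> R[i] => fun=> 0) (is_absval K).

(* B contains one representative of each of its classes: two distinct
   members are orthogonal, hence not equal modulo mu. *)
Definition orthonormal_basis (B : set (T -> R[i])) :=
  [/\ B `<=` L2,
      forall e, B e -> inner e e = 1,
      forall e f, B e -> B f -> e <> f -> inner e f = 0 &
      forall h, L2 h -> (forall e, B e -> inner h e = 0) ->
        h = (fun=> 0) %[ae mu]].

(* For a positive operator: the sum, in [0, +oo], of the diagonal entries in
   an orthonormal basis, the value being independent of the basis. *)
Definition trace A : \bar R :=
  \esum_(e in xget set0 orthonormal_basis) (complex.Re (inner (A e) e))%:E.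

Definition trace_norm K := trace (absval K).

Definition trace_class K := bounded_op K /\ (trace_norm K < +oo)%E.

Definition op_range K : set (T -> R[i]) :=
  [set f | L2 f /\ exists2 h, L2 h & f = K h %[ae mu]].

Definition orth_proj P :=
  [/\ bounded_op P,
      forall f, L2 f -> P (P f) = P f %[ae mu] &
      forall f g, L2 f -> L2 g -> inner (P f) g = inner f (P g)].

Definition orth_proj_onto P W := orth_proj P /\ op_range P = W.

End operators.
End L2_space.

Section local_spaces.
Context (R : realType) (E : completeMetricType R).
Variable mu : {measure set (Borel E) -> \bar R}.

Implicit Types (f : E -> R[i]) (L V : set (E -> R[i])).
Implicit Types K Q : (E -> R[i]) -> (E -> R[i]).

Definition L2loc : set (E -> R[i]) :=
  [set f | cmeasurable (T := Borel E) f /\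
    forall B : set (Borel E), measurable B -> metric_bounded B ->
      L2 mu (fmul \1_B f)].

Definition L2loc_cvg (f_ : nat -> E -> R[i]) f :=
  forall B : set (Borel E), measurable B -> metric_bounded B ->
    L2_cvg mu (fun n => fmul \1_B (f_ n)) (fmul \1_B f).

Definition I1loc K :=
  bounded_op mu K /\
  forall B : set (Borel E), measurable B -> metric_bounded B ->
    trace_class mu (sandwich \1_B K).

Definition I1loc_cvg (K_ : nat -> (E -> R[i]) -> (E -> R[i])) K :=
  [/\ forall n, I1loc (K_ n), I1loc K &
      forall B : set (Borel E), measurable B -> metric_bounded B ->
        trace_norm mu (sandwich \1_B (fun f => K_ n f - K f))
          @[n --> \oo] --> 0%E].

Record assumption_A L Q V (E0 : set (Borel E)) : Prop := AssumptionA {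
  A_proj : orth_proj_onto mu Q L ;
  A_closed : L2_closed mu L ;
  A_loc : I1loc Q ;
  A_findim : finite_dim mu V ;
  A_L2loc : V `<=` L2loc ;
  A_measurable : measurable E0 ;
  A1 : trace_class mu (sandwich \1_(~` E0) Q) ;
  A2 : forall phi, V phi -> L2 mu (fmul \1_E0 phi) ;
  A3 : forall phi, V phi ->
         (exists2 psi, L psi & fmul \1_E0 phi = fmul \1_E0 psi %[ae mu]) ->
         phi = (fun=> 0) %[ae mu] ;
  A4 : forall phi, L phi -> fmul \1_E0 phi = (fun=> 0) %[ae mu] ->
         phi = (fun=> 0) %[ae mu] }.

End local_spaces.

(* Main.v *)
(* Regard L_2(E, mu) as a real Hilbert space and put G = sqrt g and
   D = sqrt (1 - g), so that |G f|^2 + |D f|^2 = |f|^2 and G is injective.  For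
   a projection P and a cutoff C, the operator C P C is trace class iff P C is
   Hilbert-Schmidt, and C P_n C -> C P C in trace norm for all C = chi_B iff
   P_n -> P strongly and P_n C -> P C in Hilbert-Schmidt norm.  Convergence of
   the traces of D P_n D upgrades strong convergence to P_n D -> P D in
   Hilbert-Schmidt norm.  As D is compact on the range of P, G is bounded below
   there, and on the range of P_n uniformly in large n; hence G L is closed, the
   projections Q_n onto G L_n converge strongly, and
   k |Q_n C e|^2 <= |P_n C G e|^2 dominates the Hilbert-Schmidt sums.  The
   vectors sqrt g v_i are then added one at a time; by (A3) each is outside the
   closed subspace reached so far, so the projection changes by a convergent
   rank-one term. *)

Require Import Defs.
From HB Require Import structures.
From mathcomp Require Import all_boot all_order all_algebra finmap.
From mathcomp Require Import all_classical all_reals all_analysis.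
From mathcomp Require Import measurable_realfun complex.
From mathcomp Require Import ring lra.

Set Implicit Arguments.
Unset Strict Implicit.
Unset Printing Implicit Defensive.

Import Order.TTheory GRing.Theory Num.Theory.
Import numFieldNormedType.Exports.

Local Open Scope classical_set_scope.
Local Open Scope ring_scope.

(** * Real Hilbert spaces *)

(** The trace norm is defined through an absolute value, and [C (P_n - P) C] has no sign, so [|K|]
    has to be constructed and compared with [K]. No spectral theorem enters: the square root is the
    limit of an iteration, [K <= |K|] follows from approximate eigenvectors, and the polar
    decomposition is replaced by the contractions [K (|K| + e)^-1]. Passing to real scalars loses
    nothing because the complex structure survives as one operator [Jq], multiplication by i.
    Complex-linear means real-linear and commuting with [Jq], a positive complex form is
    automatically symmetric, and every trace is doubled. In exchange, each [v_i] contributes two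
    real vectors, [sqrt g v_i] and its multiple by i. Orthonormal bases come from Zorn's lemma
    without an enumeration. Infinite sums therefore appear only as bounds on finite partial sums
    ([bsum_le]), and dominated convergence takes the form of tails that are small uniformly in large
    n ([utail]). *)

Record hilbert (R : realType) := Hilbert {
  hcar :> lmodType R ;
  ip : hcar -> hcar -> R ;
  ipC : forall x y, ip x y = ip y x ;
  ip_linear : forall a x y z, ip (a *: x + y) z = a * ip x z + ip y z ;
  ip_ge0 : forall x, 0 <= ip x x ;
  ip_eq0 : forall x, ip x x = 0 -> x = 0 ;
  ip_complete : forall u : nat -> hcar,
    (forall e, 0 < e -> exists N, forall m n, (N <= m)%N -> (N <= n)%N ->
       ip (u m - u n) (u m - u n) <= e) ->
    exists l, forall e, 0 < e -> exists N, forall n, (N <= n)%N ->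
       ip (u n - l) (u n - l) <= e }.
Arguments ip {R h} _ _ : simpl never.

Lemma cvg_sqr (R : realType) (u : nat -> R) (l : R) :
  u @ \oo --> l -> (fun n => u n ^+ 2) @ \oo --> l ^+ 2.
Proof. by move=> ul; apply: cvgM. Qed.

Section inner_product.
Context {R : realType} {H : hilbert R}.
Implicit Types (x y z : H) (a b : R).

Lemma ipDl x y z : ip (x + y) z = ip x z + ip y z.
Proof. by have := ip_linear 1 x y z; rewrite scale1r mul1r. Qed.
Lemma ip0l z : ip 0 z = 0.
Proof. by have := ipDl 0 0 z; rewrite addr0; lra. Qed.
Lemma ipZl a x z : ip (a *: x) z = a * ip x z.
Proof. by have := ip_linear a x 0 z; rewrite addr0 ip0l addr0. Qed.
Lemma ipNl x z : ip (- x) z = - ip x z.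
Proof. by rewrite -scaleN1r ipZl mulN1r. Qed.
Lemma ipBl x y z : ip (x - y) z = ip x z - ip y z.
Proof. by rewrite ipDl ipNl. Qed.
Lemma ipDr x y z : ip z (x + y) = ip z x + ip z y.
Proof. by rewrite !(ipC z) ipDl. Qed.
Lemma ip0r z : ip z 0 = 0.
Proof. by rewrite ipC ip0l. Qed.
Lemma ipZr a x z : ip z (a *: x) = a * ip z x.
Proof. by rewrite !(ipC z) ipZl. Qed.
Lemma ipNr x z : ip z (- x) = - ip z x.
Proof. by rewrite !(ipC z) ipNl. Qed.
Lemma ipBr x y z : ip z (x - y) = ip z x - ip z y.
Proof. by rewrite !(ipC z) ipBl. Qed.

Lemma ip_suml (I : Type) (s : seq I) (f : I -> H) z :
  ip (\sum_(i <- s) f i) z = \sum_(i <- s) ip (f i) z.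
Proof.
elim: s => [|i s IH]; first by rewrite !big_nil ip0l.
by rewrite !big_cons ipDl IH.
Qed.

Lemma ip_sumr (I : Type) (s : seq I) (f : I -> H) z :
  ip z (\sum_(i <- s) f i) = \sum_(i <- s) ip z (f i).
Proof. by rewrite ipC ip_suml; apply: eq_bigr => i _; rewrite ipC. Qed.

Lemma ip_ext x y : (forall z, ip x z = ip y z) -> x = y.
Proof.
move=> xy; apply/eqP; rewrite -subr_eq0; apply/eqP/ip_eq0.
by rewrite ipBl xy subrr.
Qed.

Lemma ip_CS2 x y : ip x y ^+ 2 <= ip x x * ip y y.
Proof.
have [y0|y0] := eqVneq (ip y y) 0.
  by rewrite (ip_eq0 y0) !ip0r expr0n mulr0.
have yp : 0 < ip y y by rewrite lt_neqAle eq_sym y0 ip_ge0.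
have := ip_ge0 (ip y y *: x - ip x y *: y).
rewrite !(ipBl, ipBr, ipZl, ipZr) (ipC y x) => h.
have {}h : 0 <= ip y y * (ip x x * ip y y - ip x y ^+ 2) by lra.
by move: h; rewrite pmulr_rge0// subr_ge0.
Qed.

Definition nrm x := Num.sqrt (ip x x).

Lemma nrm_ge0 x : 0 <= nrm x. Proof. exact: sqrtr_ge0. Qed.
Hint Resolve nrm_ge0 : core.
Lemma sqr_nrm x : nrm x ^+ 2 = ip x x.
Proof. by rewrite /nrm sqr_sqrtr// ip_ge0. Qed.
Lemma nrm_le a x : 0 <= a -> ip x x <= a ^+ 2 -> nrm x <= a.
Proof. by move=> a0; rewrite -sqr_nrm ler_sqr ?nnegrE. Qed.
Lemma nrm_eq0 x : nrm x = 0 -> x = 0.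
Proof. by move=> x0; apply: ip_eq0; rewrite -sqr_nrm x0 expr0n. Qed.
Lemma nrm0 : nrm (0 : H) = 0. Proof. by rewrite /nrm ip0l sqrtr0. Qed.
Lemma nrmN x : nrm (- x) = nrm x. Proof. by rewrite /nrm ipNl ipNr opprK. Qed.
Lemma nrmBC x y : nrm (x - y) = nrm (y - x). Proof. by rewrite -opprB nrmN. Qed.
Lemma nrmZ a x : nrm (a *: x) = `|a| * nrm x.
Proof. by rewrite /nrm ipZl ipZr mulrA -expr2 sqrtrM ?sqr_ge0// sqrtr_sqr. Qed.
Lemma ip_CS x y : `|ip x y| <= nrm x * nrm y.
Proof.
rewrite -ler_sqr ?nnegrE ?mulr_ge0//.
by rewrite exprMn !sqr_nrm real_normK ?num_real ?ip_CS2.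
Qed.
Lemma ip_le x y : ip x y <= nrm x * nrm y.
Proof. exact: le_trans (ler_norm _) (ip_CS x y). Qed.
Lemma nrmD x y : nrm (x + y) <= nrm x + nrm y.
Proof.
apply: nrm_le; first exact: addr_ge0.
rewrite !(ipDl, ipDr) (ipC y x) sqrrD !sqr_nrm.
by have := ip_le x y; lra.
Qed.
Lemma nrmB x y : nrm (x - y) <= nrm x + nrm y.
Proof. by rewrite -(nrmN y) nrmD. Qed.
Lemma nrm_dist x y z : nrm (x - z) <= nrm (x - y) + nrm (y - z).
Proof. by apply: le_trans (nrmD _ _); rewrite addrA subrK. Qed.
Lemma nrmD2 x y : ip (x + y) (x + y) <= 2 * ip x x + 2 * ip y y.
Proof.
by have := ip_ge0 (x - y); rewrite !(ipDl, ipDr, ipNl, ipNr); lra.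
Qed.
Lemma nrmB2 x y : ip (x - y) (x - y) <= 2 * ip x x + 2 * ip y y.
Proof.
by have := ip_ge0 (x + y); rewrite !(ipDl, ipDr, ipNl, ipNr); lra.
Qed.

(** Sealed in a constructor: only a real sequence of norms converges, and [H] carries no
    topology. *)
Variant cvgH (u : nat -> H) x : Prop :=
  CvgH of (fun n => nrm (u n - x)) @ \oo --> (0 : R).

Lemma cvgH_nrmB (u : nat -> H) x :
  cvgH u x -> (fun n => nrm (u n - x)) @ \oo --> (0 : R).
Proof. by case. Qed.

Lemma cvgH_le (u : nat -> H) x (a : nat -> R) :
  a @ \oo --> (0 : R) -> (forall n, nrm (u n - x) <= a n) -> cvgH u x.
Proof.
move=> a0 ua; split; apply: (@squeeze_cvgr _ _ _ _ (cst 0) a) => //; last exact: cvg_cst.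
by apply: nearW => n; rewrite nrm_ge0/=.
Qed.

Lemma cvgH_sqr (u : nat -> H) x :
  (fun n => nrm (u n - x) ^+ 2) @ \oo --> (0 : R) -> cvgH u x.
Proof.
move=> h; split.
have e : (fun n => nrm (u n - x)) = (fun n => Num.sqrt (nrm (u n - x) ^+ 2)).
  by apply/funext => n; rewrite sqrtr_sqr ger0_norm.
rewrite e -(@sqrtr0 R).
exact: (@continuous_cvg _ R R _ _ _ _ _ (@sqrt_continuous R 0) h).
Qed.

Lemma cvgH_cst x : cvgH (fun=> x) x.
Proof.
by apply: (cvgH_le (@cvg_cst R 0 _ _ _)) => n; rewrite subrr nrm0.
Qed.

Lemma cvgHD (u v : nat -> H) x y :
  cvgH u x -> cvgH v y -> cvgH (fun n => u n + v n) (x + y).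
Proof.
move=> [ux] [vy]; have h : (fun n => nrm (u n - x) + nrm (v n - y)) @ \oo --> (0 : R).
  by rewrite -[X in _ --> X](addr0 0); exact: cvgD.
by apply: (cvgH_le h) => n /=; rewrite opprD addrACA nrmD.
Qed.

Lemma cvgHZ (u : nat -> H) x (a : nat -> R) (b : R) :
  cvgH u x -> a @ \oo --> b -> cvgH (fun n => a n *: u n) (b *: x).
Proof.
move=> [ux] ab.
have ab0 : (fun n => `|a n - b|) @ \oo --> (0 : R).
  rewrite -[X in _ --> X](@normr0 _ R) -(subrr b).
  by apply: cvg_norm; apply: cvgB => //; exact: cvg_cst.
have abn : (fun n => `|a n|) @ \oo --> `|b| by exact: cvg_norm.
have h : (fun n => `|a n| * nrm (u n - x) + `|a n - b| * nrm x) @ \oo --> (0 : R).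
  rewrite [X in _ --> X](_ : 0 = `|b| * 0 + 0 * nrm x); last by rewrite mulr0 mul0r addr0.
  exact: cvgD (cvgM abn ux) (cvgM ab0 (cvg_cst _)).
apply: (cvgH_le h) => n /=.
rewrite -!nrmZ; apply: le_trans (nrmD _ _).
by rewrite scalerBr scalerBl addrA subrK.
Qed.

Lemma cvgHN (u : nat -> H) x : cvgH u x -> cvgH (fun n => - u n) (- x).
Proof.
move=> [ux]; split; apply: cvg_trans ux; apply: near_eq_cvg.
by apply: nearW => n; rewrite -opprD nrmN.
Qed.

Lemma cvgHB (u v : nat -> H) x y :
  cvgH u x -> cvgH v y -> cvgH (fun n => u n - v n) (x - y).
Proof. by move=> ux /cvgHN; exact: cvgHD. Qed.

Lemma cvgH_ip (u v : nat -> H) x y :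
  cvgH u x -> cvgH v y -> (fun n => ip (u n) (v n)) @ \oo --> ip x y.
Proof.
move=> [ux] [vy].
have h1 : (fun n => ip (u n - x) (v n - y)) @ \oo --> (0 : R).
  have h : (fun n => nrm (u n - x) * nrm (v n - y)) @ \oo --> (0 : R).
    by rewrite -(mulr0 0); exact: cvgM.
  apply/norm_cvg0P; apply: (@squeeze_cvgr _ _ _ _ (cst 0) _ _ _ _ _ h); last exact: cvg_cst.
  by apply: nearW => n /=; rewrite normr_ge0 ip_CS.
have h2 z (w : nat -> H) l : (fun n => nrm (w n - l)) @ \oo --> (0 : R) ->
    (fun n => ip (w n - l) z) @ \oo --> (0 : R).
  move=> wl; have h : (fun n => nrm (w n - l) * nrm z) @ \oo --> (0 : R).
    by rewrite -(mul0r (nrm z)); exact: cvgM wl (cvg_cst _).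
  apply/norm_cvg0P; apply: (@squeeze_cvgr _ _ _ _ (cst 0) _ _ _ _ _ h); last exact: cvg_cst.
  by apply: nearW => n /=; rewrite normr_ge0 ip_CS.
rewrite [X in _ --> X](_ : _ = 0 + 0 + 0 + ip x y); last by rewrite !add0r.
rewrite [X in X @ _](_ : _ =
  fun n => ip (u n - x) (v n - y) + ip (u n - x) y + ip (v n - y) x + ip x y).
  exact: cvgD (cvgD (cvgD h1 (h2 y _ _ ux)) (h2 x _ _ vy)) (cvg_cst _).
apply/funext => n; rewrite !(ipBl, ipBr) (ipC (v n) x) (ipC y x); lra.
Qed.

Lemma cvgH_nrm (u : nat -> H) x : cvgH u x -> (fun n => nrm (u n)) @ \oo --> nrm x.
Proof.
move=> ux; apply: (@continuous_cvg _ R R _ _ (fun n => ip (u n) (u n))).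
  exact: sqrt_continuous.
exact: cvgH_ip.
Qed.

Lemma cvgH_cst_eq x y : cvgH (fun=> x) y -> x = y.
Proof.
move=> [h]; apply/eqP; rewrite -subr_eq0; apply/eqP/nrm_eq0.
exact: (cvg_unique _ (cvg_cst _) h).
Qed.

Lemma cvgH_unique (u : nat -> H) x y : cvgH u x -> cvgH u y -> x = y.
Proof.
move=> ux uy; apply/eqP; rewrite -subr_eq0; apply/eqP; symmetry.
apply: cvgH_cst_eq; have := cvgHB ux uy.
by under [X in cvgH X _ -> _]eq_fun do rewrite subrr.
Qed.

Definition cauchyH (u : nat -> H) := forall e : R, 0 < e ->
  exists N, forall m n, (N <= m)%N -> (N <= n)%N -> nrm (u m - u n) <= e.

Lemma cvgHP (u : nat -> H) x : cvgH u x <->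
  forall e : R, 0 < e -> exists N, forall n, (N <= n)%N -> nrm (u n - x) <= e.
Proof.
split=> [[ux] e e0|h].
  have /cvgr0Pnorm_le /(_ _ e0) [N _ hN] := ux.
  by exists N => n Nn; have := hN n Nn; rewrite /= ger0_norm.
split; apply/cvgr0Pnorm_le => e e0; have [N hN] := h e e0.
by exists N => // n Nn; rewrite /= ger0_norm// hN.
Qed.

Lemma cauchyH_cvg (u : nat -> H) : cauchyH u -> exists x, cvgH u x.
Proof.
move=> uC; have [e e0|x hx] := @ip_complete _ _ u.
  have se0 : 0 < Num.sqrt e by rewrite sqrtr_gt0.
  have [N hN] := uC _ se0; exists N => m n Nm Nn.
  by rewrite -sqr_nrm -[leRHS]sqr_sqrtr ?(ltW e0)// ler_sqr ?nnegrE ?sqrtr_ge0// hN.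
exists x; apply/cvgHP => e e0.
have [N hN] := hx (e ^+ 2) (exprn_gt0 _ e0).
by exists N => n Nn; apply: nrm_le; [exact: ltW|exact: hN].
Qed.

End inner_product.
#[export] Hint Extern 0 (is_true (@Order.le _ _ _ (nrm _))) => apply: nrm_ge0 : core.

(** * Bounded operators and absolute values *)

Section bounded_operators.
Context {R : realType} {H : hilbert R}.
Implicit Types (x y z : H) (a b M : R) (T K A J : H -> H).

Definition lin T := forall a x y, T (a *: x + y) = a *: T x + T y.
Definition symop T := forall x y, ip (T x) y = ip x (T y).
Definition bnd T M := forall x, nrm (T x) <= M * nrm x.
Definition posop T := forall x, 0 <= ip (T x) x.

(** An operator with an adjoint is determined by its pairings, which are linear. Symmetry is
    therefore the only algebraic hypothesis that later statements need to carry. *)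
Lemma symop_lin T : symop T -> lin T.
Proof.
move=> Ts a x y; apply: ip_ext => z.
by rewrite Ts ip_linear ip_linear !Ts.
Qed.

Section lin.
Variables (T : H -> H) (Tl : lin T).
Lemma linD x y : T (x + y) = T x + T y.
Proof. by have := Tl 1 x y; rewrite !scale1r. Qed.
Lemma lin0 : T 0 = 0.
Proof. by apply: (addrI (T 0)); rewrite -linD !addr0. Qed.
Lemma linZ a x : T (a *: x) = a *: T x.
Proof. by have := Tl a x 0; rewrite lin0 !addr0. Qed.
Lemma linN x : T (- x) = - T x.
Proof. by rewrite -scaleN1r linZ scaleN1r. Qed.
Lemma linB x y : T (x - y) = T x - T y.
Proof. by rewrite linD linN. Qed.
End lin.

Lemma bndW T M M' : M <= M' -> bnd T M -> bnd T M'.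
Proof. by move=> MM TM x; apply: le_trans (TM x) _; rewrite ler_wpM2r. Qed.

Lemma bnd1 T x : bnd T 1 -> nrm (T x) <= nrm x.
Proof. by move=> T1; have := T1 x; rewrite mul1r. Qed.

Lemma bnd_ip T M x : bnd T M -> ip (T x) x <= M * ip x x.
Proof.
move=> TM; apply: le_trans (ip_le _ _) _.
by rewrite -(sqr_nrm x) expr2 mulrA ler_wpM2r.
Qed.

Lemma bnd_cvg T M (u : nat -> H) x : lin T -> bnd T M -> cvgH u x ->
  cvgH (fun n => T (u n)) (T x).
Proof.
move=> Tl TM [ux].
have h : (fun n => M * nrm (u n - x)) @ \oo --> (0 : R).
  by rewrite -(mulr0 M); exact: cvgM (cvg_cst _) ux.
by apply: (cvgH_le h) => n; rewrite -linB//; exact: TM.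
Qed.

Lemma le_cvg (u v : nat -> R) a b :
  u @ \oo --> a -> v @ \oo --> b -> (forall n, u n <= v n) -> a <= b.
Proof.
move=> ua vb uv.
rewrite -(cvg_lim (@Rhausdorff R) ua) -(cvg_lim (@Rhausdorff R) vb).
apply: ler_lim; [by apply: cvgP ua|by apply: cvgP vb|exact: nearW].
Qed.

(** The bounded scalar sequence [s] is nondecreasing, hence convergent, and its increments control
    those of [u]. This serves both the contraction iteration and the square root iteration. *)
Lemma majorant_cauchy (u : nat -> H) (s : nat -> R) M :
  (forall n, nrm (u n.+1 - u n) <= s n.+1 - s n) -> (forall n, s n <= M) ->
  cauchyH u.
Proof.
move=> us sM.
have sD m k : nrm (u (m + k)%N - u m) <= s (m + k)%N - s m.
  elim: k => [|k IH]; first by rewrite addn0 !subrr nrm0.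
  apply: le_trans (nrm_dist _ (u (m + k)%N) _) _.
  by rewrite addnS; have := us (m + k)%N; lra.
have snd : nondecreasing_seq s.
  apply/nondecreasing_seqP => n.
  by rewrite -subr_ge0 (le_trans _ (us n)).
have scvg : cvgn s.
  by apply: nondecreasing_is_cvgn => //; exists M => _ [n _ <-].
move=> e e0.
have [N _ hN] : \forall n \near \oo, `|limn s - s n| <= e.
  by move: scvg => /cvgrPdist_le /(_ e e0).
have sl n : s n <= limn s by exact: nondecreasing_cvgn_le.
have le1 m n : (N <= m)%N -> (m <= n)%N -> nrm (u n - u m) <= e.
  move=> Nm mn; rewrite -(subnKC mn); apply: le_trans (sD _ _) _.
  by have := hN m Nm; rewrite /= ger0_norm ?subr_ge0//; have := sl (m + (n - m))%N; lra.
exists N => m n Nm Nn; have [mn|/ltnW nm] := leqP m n; last exact: le1.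
by rewrite nrmBC; exact: le1.
Qed.

Lemma lax_milgram T M (k : R) : lin T -> bnd T M -> 0 < k ->
  (forall x, k * ip x x <= ip (T x) x) -> forall b : H, exists x, T x = b.
Proof.
move=> Tl TM k0 Tk b.
pose M1 : R := `|M| + k + 1.
have kM1 : k < M1 by rewrite /M1; have := normr_ge0 M; lra.
have M10 : 0 < M1 by lra.
have TM1 : bnd T M1 by apply: bndW TM; rewrite /M1; have := ler_norm M; lra.
(* This [t] minimises [1 - 2 t k + t^2 M1^2], the bound on the squared Lipschitz constant of [F];
   the minimum is [q2], positive because [k < M1]. *)
pose t : R := k / M1 ^+ 2; pose q2 : R := 1 - k ^+ 2 / M1 ^+ 2.
have M12 : 0 < M1 ^+ 2 by rewrite exprn_gt0.
have kM2 : k ^+ 2 < M1 ^+ 2 by rewrite ltr_sqr ?nnegrE ?ltW.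
have t0 : 0 < t by rewrite divr_gt0.
have q20 : 0 < q2 by rewrite subr_gt0 ltr_pdivrMr// mul1r.
have q21 : q2 < 1.
  by rewrite /q2 ltrBlDr ltrDl divr_gt0// exprn_gt0.
pose q := Num.sqrt q2.
have q0 : 0 <= q by rewrite sqrtr_ge0.
have q1 : q < 1 by rewrite -(ltr_sqr q0) ?nnegrE// expr1n sqr_sqrtr// ltW.
pose F y := y - t *: (T y - b).
have Fq x y : nrm (F x - F y) <= q * nrm (x - y).
  have -> : F x - F y = (x - y) - t *: T (x - y).
    by apply: ip_ext => z; rewrite linB// !(ipBl, ipZl); ring.
  move: (x - y) => d; apply: nrm_le; first by rewrite mulr_ge0.
  rewrite exprMn sqr_nrm sqr_sqrtr ?(ltW q20)//.
  rewrite !(ipBl, ipBr, ipZl, ipZr) (ipC d (T d)).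
  have Td2 : ip (T d) (T d) <= M1 ^+ 2 * ip d d.
    by rewrite -!sqr_nrm -exprMn ler_sqr ?nnegrE ?mulr_ge0// ltW.
  have e1 : q2 * ip d d = ip d d - 2 * t * (k * ip d d) + t ^+ 2 * (M1 ^+ 2 * ip d d).
    by rewrite /q2 /t; field; lra.
  have h1 : t * (k * ip d d) <= t * ip (T d) d by rewrite ler_wpM2l// ltW.
  have h2 : t ^+ 2 * ip (T d) (T d) <= t ^+ 2 * (M1 ^+ 2 * ip d d).
    by rewrite ler_wpM2l// sqr_ge0.
  rewrite e1; lra.
pose u n := iter n F 0.
pose c := nrm (u 1%N - u 0%N).
have uq n : nrm (u n.+1 - u n) <= c * q ^+ n.
  elim: n => [|n IH]; first by rewrite expr0 mulr1.
  apply: le_trans (Fq _ _) _; rewrite exprS mulrCA ler_wpM2l//.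
have q1' : 0 < 1 - q by rewrite subr_gt0.
have uC : cauchyH u.
  (* Minus the tail of the geometric series: its increments are exactly [c q^n] and it stays below
     0. *)
  apply: (@majorant_cauchy _ (fun n => - (c * q ^+ n / (1 - q))) 0).
    move=> n; apply: le_trans (uq n) _.
    by rewrite exprS le_eqVlt; apply/orP; left; apply/eqP; field; lra.
  by move=> n; rewrite oppr_le0 divr_ge0 ?(ltW q1')//; apply: mulr_ge0; [exact: nrm_ge0|exact: exprn_ge0].
have [x ux] := cauchyH_cvg uC.
have Fx : cvgH (fun n => F (u n)) (F x).
  case: ux => ux.
  have h : (fun n => q * nrm (u n - x)) @ \oo --> (0 : R).
    by rewrite -(mulr0 q); exact: cvgM (cvg_cst _) ux.
  exact: (cvgH_le h).
have ux' : cvgH (fun n => F (u n)) x.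
  case: ux => ux; split; have := ux.
  by rewrite -(cvg_shiftS (fun n => nrm (u n - x))).
exists x; have := cvgH_unique Fx ux'.
rewrite /F => /eqP; rewrite -subr_eq0 addrAC subrr add0r oppr_eq0 scaler_eq0.
by rewrite gt_eqF//= subr_eq0 => /eqP.
Qed.

(** Cauchy-Schwarz for the possibly degenerate form of [T], from nonnegativity of the quadratic
    polynomial [t -> <T (x + t y), x + t y>]. *)
Lemma posop_CS T x y : symop T -> posop T ->
  ip (T x) y ^+ 2 <= ip (T x) x * ip (T y) y.
Proof.
move=> Ts Tp; have Tl := symop_lin Ts.
have Txy : ip (T y) x = ip (T x) y by rewrite Ts ipC.
have q (t : R) : 0 <= ip (T x) x + 2 * t * ip (T x) y + t ^+ 2 * ip (T y) y.
  have := Tp (x + t *: y); rewrite linD// linZ// !(ipDl, ipDr, ipZl, ipZr) Txy.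
  lra.
have [y0|y0] := eqVneq (ip (T y) y) 0.
  rewrite y0 mulr0; have [->|xy0] := eqVneq (ip (T x) y) 0; first by rewrite expr0n.
  (* In the degenerate case the polynomial is affine in t; at this t it would equal -1. *)
  pose t : R := - (ip (T x) x + 1) / (2 * ip (T x) y).
  have e : 2 * t * ip (T x) y = - (ip (T x) x + 1) by rewrite /t; field.
  by have := q t; rewrite y0 mulr0 addr0 e; lra.
have yp : 0 < ip (T y) y by rewrite lt_neqAle eq_sym y0 Tp.
(* The minimiser of the polynomial. *)
have := q (- ip (T x) y / ip (T y) y).
have -> : ip (T x) x + 2 * (- ip (T x) y / ip (T y) y) * ip (T x) y
   + (- ip (T x) y / ip (T y) y) ^+ 2 * ip (T y) y
  = (ip (T x) x * ip (T y) y - ip (T x) y ^+ 2) / ip (T y) y by field.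
by rewrite pmulr_lge0 ?invr_gt0// subr_ge0.
Qed.

(** Cauchy-Schwarz for the form of [T], at [x] and [T x], gives [|T x|^4 <= <T x, x> <T T x, T x>],
    and the last factor is at most [M |T x|^2]. *)
Lemma posop_sqr T M x : symop T -> posop T -> bnd T M ->
  ip (T x) (T x) <= M * ip (T x) x.
Proof.
move=> Ts Tp TM.
have h := posop_CS x (T x) Ts Tp.
have h2 := bnd_ip (T x) TM.
have [x0|x0] := eqVneq (ip (T x) (T x)) 0.
  rewrite x0 (ip_eq0 x0); by rewrite ip0l mulr0.
have xp : 0 < ip (T x) (T x) by rewrite lt_neqAle eq_sym x0 ip_ge0.
have h3 : ip (T x) x * ip (T (T x)) (T x) <= ip (T x) x * (M * ip (T x) (T x)).
  by rewrite ler_wpM2l.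
have := le_trans h h3.
by rewrite expr2 mulrA ler_pM2r// mulrC.
Qed.

(** Otherwise the infimum [m] of the form of [D = A - K] on unit vectors is negative, and a
    near-minimiser [x] satisfies [D x ~ m x]. Since [|A x| = |K x|], one has
    [|D x|^2 = 2 <A x, D x>], that is [m^2 ~ 2 m <A x, x> <= 0], which is absurd. The operators [A]
    and [K] are not assumed to commute. *)
Lemma abs_op_ge K A M : symop K -> bnd K M -> symop A -> bnd A M -> posop A ->
  (forall x, A (A x) = K (K x)) -> forall x, ip (K x) x <= ip (A x) x.
Proof.
move=> Ks KM As AM Ap AK x0; have Kl := symop_lin Ks; have Al := symop_lin As.
pose D x := A x - K x.
have Ds : symop D by move=> x y; rewrite ipBl ipBr As Ks.
have Dl := symop_lin Ds.
rewrite leNgt; apply/negP => lt0.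
have Dx0 : ip (D x0) x0 < 0 by rewrite ipBl subr_lt0.
pose M1 : R := `|M| + 1.
have M10 : 0 < M1 by rewrite /M1; have := normr_ge0 M; lra.
have MM1 : M <= M1 by rewrite /M1; have := ler_norm M; lra.
have AM1 := bndW MM1 AM; have KM1 := bndW MM1 KM.
have DM : bnd D (2 * M1).
  move=> x; apply: le_trans (nrmB _ _) _.
  by rewrite (mulrDl 1 1) !mul1r mulrDl lerD.
pose S := [set ip (D x) x | x in [set x | ip x x = 1]].
have Dlow x : - (2 * M1 * ip x x) <= ip (D x) x.
  rewrite lerNl -ipNl; apply: le_trans (ip_le _ _) _.
  by rewrite nrmN -(sqr_nrm x) expr2 mulrA ler_wpM2r.
have Slb : has_lbound S.
  by exists (- (2 * M1)) => _ [x /= x1 <-]; have := Dlow x; rewrite x1 mulr1.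
pose m := inf S.
have unit x : x != 0 -> S (ip (D x) x / ip x x).
  move=> xn0; have xp : 0 < ip x x.
    rewrite lt_neqAle ip_ge0 andbT eq_sym; apply/eqP => /ip_eq0 h.
    by rewrite h eqxx in xn0.
  have nx : nrm x != 0 by rewrite gt_eqF// -(ltr_sqr)// ?nnegrE// expr0n sqr_nrm.
  exists ((nrm x)^-1 *: x) => /=; rewrite ?linZ// ipZl ipZr -sqr_nrm; first by field.
  by rewrite mulrA mulrC -invfM expr2.
have x0n : x0 != 0.
  by apply/eqP => x00; move: Dx0; rewrite x00 (lin0 Dl) ip0l ltxx.
have x0p : 0 < ip x0 x0.
  rewrite lt_neqAle ip_ge0 andbT eq_sym; apply/eqP => /ip_eq0 h.
  by rewrite h eqxx in x0n.
have Sinf : has_inf S by split=> //; exists (ip (D x0) x0 / ip x0 x0); exact: unit.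
have m0 : m < 0.
  apply: le_lt_trans (ge_inf Slb (unit _ x0n)) _.
  by rewrite pmulr_llt0// invr_gt0.
have mle x : m * ip x x <= ip (D x) x.
  have [->|xn0] := eqVneq x 0; first by rewrite ip0l mulr0 ip0r.
  have xp : 0 < ip x x.
    rewrite lt_neqAle ip_ge0 andbT eq_sym; apply/eqP => /ip_eq0 h.
    by rewrite h eqxx in xn0.
  by rewrite -ler_pdivlMr//; exact: ge_inf (unit _ xn0).
pose E x := D x - m *: x.
have Es : symop E by move=> x y; rewrite ipBl ipBr ipZl ipZr Ds.
have Ep : posop E by move=> x; rewrite ipBl ipZl subr_ge0.
pose M2 := 2 * M1 - m.
have M20 : 0 < M2 by rewrite /M2; lra.
have EM : bnd E M2.
  move=> x; apply: le_trans (nrmB _ _) _.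
  by rewrite nrmZ ltr0_norm// /M2 mulrBl mulNr lerD2r.
(* The errors of the approximate eigenvector add up to at most [2 (M1 - m) eta = m^2 / 4]. *)
pose eta := m ^+ 2 / (8 * (M1 - m)).
have m20 : 0 < m ^+ 2 by rewrite exprn_even_gt0//= lt_eqF.
have eta0 : 0 < eta by rewrite divr_gt0// mulr_gt0// subr_gt0 (lt_trans m0).
(* As [E = D - m] is positive with bound [M2], [|E x|^2 <= M2 <E x, x>]; a defect of [eta^2 / M2]
   therefore gives [|E x| <= eta]. *)
have [_ [x x1 <-] xlt] := inf_adherent (divr_gt0 (exprn_gt0 2 eta0) M20) Sinf.
have Eeta : nrm (E x) <= eta.
  apply: nrm_le; first exact: ltW.
  apply: le_trans (posop_sqr x Es Ep EM) _.
  have -> : ip (E x) x = ip (D x) x - m by rewrite ipBl ipZl x1 mulr1.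
  by rewrite -ler_pdivlMl// mulrC; move: xlt; rewrite -/m; lra.
have DE : D x = m *: x + E x by rewrite /E addrC subrK.
have n1 : nrm x = 1 by rewrite /nrm x1 sqrtr1.
have D2 : ip (D x) (D x) = 2 * ip (A x) (D x).
  have e : ip (A x) (A x) = ip (K x) (K x) by rewrite As AK -Ks.
  rewrite [in RHS]/D ipBr e {2}/D ipBr [X in X - _]ipC [X in _ - X]ipC.
  by rewrite !ipBr (ipC (K x) (A x)) e; lra.
have hA := Ap x.
have hAE : ip (A x) (E x) <= M1 * eta.
  apply: le_trans (ip_le _ _) _; apply: ler_pM => //.
  by have := AM1 x; rewrite n1 mulr1.
have hD : ip (D x) (D x) = m ^+ 2 + 2 * m * ip x (E x) + ip (E x) (E x).
  by rewrite DE; move: (E x) => w; rewrite !(ipDl, ipDr, ipZl, ipZr) x1 (ipC w x); ring.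
have hxE : `|ip x (E x)| <= eta.
  by apply: le_trans (ip_CS _ _) _; rewrite n1 mul1r.
have hE := ip_ge0 (E x).
have hAD : ip (A x) (D x) = m * ip (A x) x + ip (A x) (E x).
  by rewrite DE ipDr ipZr.
have k1 : m * ip (A x) x <= 0 by rewrite mulr_le0_ge0// ltW.
have k2 : - (- m * eta) <= m * ip x (E x).
  rewrite lerNl -mulNr; apply: ler_wpM2l; first by lra.
  by apply: le_trans (ler_norm _) hxE.
have k3 : 8 * (M1 - m) * eta = m ^+ 2 by rewrite /eta; field; lra.
have k4 : 0 < - m * eta by rewrite mulr_gt0// oppr_gt0.
have k5 : 0 < M1 * eta by rewrite mulr_gt0.
by move: D2; rewrite hAD hD; lra.
Qed.

End bounded_operators.

(** * Square roots of positive operators by iteration *)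

Section operator_sqrt.
Context {R : realType} {H : hilbert R}.
Implicit Types (x y z : H) (J : H -> H).

Section contraction.
Variable K : H -> H.
Hypotheses (Ks : symop K) (K1 : bnd K 1).

(* [1 - K^2] is a contraction [B], and [1 - lim Y_n] is a root of [K^2] when
   [Y_(n+1) = (B + Y_n^2) / 2]. *)
Fixpoint sqrt_iter (n : nat) : H -> H :=
  if n is n'.+1 then
    fun x => 2^-1 *: (x - K (K x) + sqrt_iter n' (sqrt_iter n' x))
  else fun=> 0.

(** The operator recursion with the contraction [1 - K^2] replaced by the number 1; it majorises the
    iterates and their increments. *)
Fixpoint sqrt_scalar (n : nat) : R :=
  if n is n'.+1 then 2^-1 * (1 + sqrt_scalar n' ^+ 2) else 0.

Lemma sqrt_scalar_itv n : 0 <= sqrt_scalar n <= 1.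
Proof.
elim: n => [|n /andP[h0 h1]] /=; first by rewrite lexx ler01.
have : sqrt_scalar n ^+ 2 <= 1 by rewrite exprn_ile1.
by have := sqr_ge0 (sqrt_scalar n); move=> *; apply/andP; split; lra.
Qed.

Lemma sqrt_iter_sym n : symop (sqrt_iter n).
Proof.
elim: n => [|n IH] x y /=; first by rewrite ip0l ip0r.
by rewrite !(ipZl, ipZr, ipDl, ipDr, ipNl, ipNr) !Ks !IH.
Qed.

Lemma sqrt_iter_lin n : lin (sqrt_iter n).
Proof. exact/symop_lin/sqrt_iter_sym. Qed.

Lemma bnd_1BKK x : nrm (x - K (K x)) <= nrm x.
Proof.
have h : ip (K (K x)) (K (K x)) <= ip (K x) (K x).
  by rewrite -!sqr_nrm ler_sqr ?nnegrE//; exact: bnd1.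
apply: nrm_le => //; rewrite sqr_nrm !(ipBl, ipBr) -(Ks x) (Ks _ x).
by have := ip_ge0 (K x); lra.
Qed.

Lemma sqrt_iter_bnd n : bnd (sqrt_iter n) (sqrt_scalar n).
Proof.
elim: n => [|n IH] x /=; first by rewrite nrm0 mul0r.
have /andP[h0 h1] := sqrt_scalar_itv n.
rewrite nrmZ ger0_norm ?invr_ge0// -mulrA ler_wpM2l ?invr_ge0//.
apply: le_trans (nrmD _ _) _; rewrite mulrDl mul1r lerD ?bnd_1BKK//.
by apply: le_trans (IH _) _; rewrite expr2 -mulrA ler_wpM2l.
Qed.

Lemma sqrt_iter_bnd1 n : bnd (sqrt_iter n) 1.
Proof.
by apply: bndW (sqrt_iter_bnd n); have /andP[] := sqrt_scalar_itv n.
Qed.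

Lemma sqrt_iter_diff n x : nrm (sqrt_iter n.+1 x - sqrt_iter n x) <=
  (sqrt_scalar n.+1 - sqrt_scalar n) * nrm x.
Proof.
elim: n x => [|n IH] x.
  rewrite /= !subr0 addr0 expr0n/= addr0 mulr1.
  by rewrite nrmZ ger0_norm ?invr_ge0// ler_wpM2l ?invr_ge0// bnd_1BKK.
have /andP[h0 h1] := sqrt_scalar_itv n; have /andP[k0 k1] := sqrt_scalar_itv n.+1.
set Y' := sqrt_iter n.+1; set Y := sqrt_iter n.
have Y'l : lin Y' by exact: sqrt_iter_lin.
(* The splitting [Y'^2 - Y^2 = Y' (Y' - Y) + (Y' - Y) Y] holds without commutation and matches the
   scalar factorisation of a difference of squares. *)
have -> : sqrt_iter n.+2 x - Y' x = 2^-1 *: (Y' (Y' x - Y x) + (Y' (Y x) - Y (Y x))).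
  rewrite (linB Y'l) addrA subrK.
  have -> : sqrt_iter n.+2 x = 2^-1 *: (x - K (K x) + Y' (Y' x)) by [].
  have -> : Y' x = 2^-1 *: (x - K (K x) + Y (Y x)) by [].
  by rewrite -scalerBr opprD addrACA subrr add0r.
have -> : (sqrt_scalar n.+2 - sqrt_scalar n.+1) * nrm x =
  2^-1 * (sqrt_scalar n.+1 * ((sqrt_scalar n.+1 - sqrt_scalar n) * nrm x) +
          (sqrt_scalar n.+1 - sqrt_scalar n) * (sqrt_scalar n * nrm x)).
  have -> : sqrt_scalar n.+2 = 2^-1 * (1 + sqrt_scalar n.+1 ^+ 2) by [].
  by have -> : sqrt_scalar n.+1 = 2^-1 * (1 + sqrt_scalar n ^+ 2) by []; field.
rewrite nrmZ ger0_norm ?invr_ge0// ler_wpM2l ?invr_ge0//.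
apply: le_trans (nrmD _ _) _; apply: lerD.
  by apply: le_trans (sqrt_iter_bnd _ _) _; rewrite ler_wpM2l// IH.
apply: le_trans (IH _) _; apply: ler_wpM2l; last exact: sqrt_iter_bnd.
have [x0|x0] := eqVneq (nrm x) 0; last first.
  have := le_trans (nrm_ge0 _) (IH x).
  by rewrite pmulr_lge0// lt_neqAle eq_sym x0 nrm_ge0.
(* The scalar increment is [(s_n - 1)^2 / 2]. *)
rewrite subr_ge0 /=; have := sqr_ge0 (sqrt_scalar n - 1); rewrite sqrrB1; lra.
Qed.

Lemma sqrt_iter_cvg : exists Y : H -> H, forall x, cvgH (sqrt_iter ^~ x) (Y x).
Proof.
suff /choice[Y hY] : forall x, exists y, cvgH (sqrt_iter ^~ x) y by exists Y.
move=> x; apply: cauchyH_cvg.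
apply: (@majorant_cauchy _ _ _ (fun n => sqrt_scalar n * nrm x) (nrm x)).
  by move=> n; rewrite -mulrBl sqrt_iter_diff.
by move=> n; have /andP[_ h] := sqrt_scalar_itv n; rewrite ler_piMl.
Qed.

Lemma sqrt_contraction : exists A : H -> H,
  [/\ symop A, bnd A 2, posop A, forall x, A (A x) = K (K x) &
   forall J, lin J -> bnd J 1 -> (forall x, K (J x) = J (K x)) ->
     forall x, A (J x) = J (A x)].
Proof.
have [Y hY] := sqrt_iter_cvg.
have Ys : symop Y.
  move=> x y; have h1 := cvgH_ip (hY x) (cvgH_cst y).
  have h2 := cvgH_ip (cvgH_cst x) (hY y).
  have E : (fun n => ip (sqrt_iter n x) y) = (fun n => ip x (sqrt_iter n y)).
    by apply/funext => n; rewrite sqrt_iter_sym.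
  by rewrite E in h1; exact: (cvg_unique _ h1 h2).
have Yl := symop_lin Ys.
have Y1 : bnd Y 1.
  move=> x; apply: (le_cvg (cvgH_nrm (hY x)) (cvg_cst (1 * nrm x))) => n.
  exact: sqrt_iter_bnd1.
have YE x : Y x = 2^-1 *: (x - K (K x) + Y (Y x)).
  have hS : cvgH (fun n => sqrt_iter n.+1 x) (Y x).
    case: (hY x) => h; split; move: h.
    by rewrite -(cvg_shiftS (fun n => nrm (sqrt_iter n x - Y x))).
  apply: (cvgH_unique hS).
  apply: cvgHZ (cvg_cst _); apply: cvgHD (cvgH_cst _) _.
  have h0 : (fun n => nrm (sqrt_iter n x - Y x) + nrm (sqrt_iter n (Y x) - Y (Y x)))
      @ \oo --> (0 : R).
    rewrite [X in _ --> X](_ : 0 = 0 + 0); last by rewrite addr0.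
    exact: cvgD (cvgH_nrmB (hY _)) (cvgH_nrmB (hY _)).
  apply: (cvgH_le h0) => n; apply: le_trans (nrm_dist _ (sqrt_iter n (Y x)) _) _.
  by rewrite lerD2r -(linB (sqrt_iter_lin n)) (le_trans (sqrt_iter_bnd1 n _))// mul1r.
exists (fun x => x - Y x); split.
- by move=> x y; rewrite ipBl ipBr Ys.
- by move=> x; apply: le_trans (nrmB _ _) _; have := Y1 x; lra.
- by move=> x; rewrite ipBl subr_ge0; have := bnd_ip x Y1; rewrite mul1r.
(* The fixed point equation [2 Y = 1 - K^2 + Y^2] rearranges to [(1 - Y)^2 = K^2]. *)
- move=> x; rewrite (linB Yl); apply: ip_ext => z.
  have := congr1 (fun y => ip y z) (YE x); rewrite !(ipZl, ipDl, ipNl).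
  lra.
- move=> J Jl J1 KJ.
  (* Every iterate is a polynomial in [K^2], so it inherits the commutation, which then passes to
     the limit. *)
  have YJn n x : sqrt_iter n (J x) = J (sqrt_iter n x).
    elim: n x => [|n IH] x /=; first by rewrite (lin0 Jl).
    by rewrite (linZ Jl) (linD Jl) (linB Jl) !KJ !IH.
  move=> x; rewrite (linB Jl); congr (_ - _).
  apply: (cvgH_unique (hY (J x))).
  rewrite [X in cvgH X _](_ : _ = fun n => J (sqrt_iter n x)); last first.
    by apply/funext => n; rewrite YJn.
  exact: bnd_cvg.
Qed.
End contraction.

(** Reduction to a contraction by scaling. The commutation clause will be applied to multiplication
    by i, which makes [A] complex-linear. *)
Lemma abs_op_exists K M : symop K -> bnd K M -> exists A : H -> H,
  [/\ symop A, exists M', bnd A M', posop A, forall x, A (A x) = K (K x) &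
   forall J, lin J -> bnd J 1 -> (forall x, K (J x) = J (K x)) ->
     forall x, A (J x) = J (A x)].
Proof.
move=> Ks KM; have Kl := symop_lin Ks.
pose m : R := `|M| + 1.
have m0 : 0 < m by rewrite /m; have := normr_ge0 M; lra.
have Km : bnd K m by apply: bndW KM; rewrite /m; have := ler_norm M; lra.
have mn0 : m != 0 by rewrite gt_eqF.
have [||A [As A2 Ap AK AJ]] := @sqrt_contraction (fun x => m^-1 *: K x).
- by move=> x y; rewrite ipZl ipZr Ks.
- by move=> x; rewrite nrmZ ger0_norm ?invr_ge0 ?(ltW m0)// mul1r ler_pdivrMl.
have Al := symop_lin As.
exists (fun x => m *: A x); split.
- by move=> x y; rewrite ipZl ipZr As.
- exists (m * 2) => x; rewrite nrmZ ger0_norm ?(ltW m0)// -mulrA ler_wpM2l ?(ltW m0)//.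
- by move=> x; rewrite ipZl mulr_ge0 ?(ltW m0).
- move=> x; rewrite (linZ Al) AK (linZ Kl) !scalerA.
  by rewrite -[RHS]scale1r; congr (_ *: _); field.
- move=> J Jl J1 KJ x; rewrite AJ// ?(linZ Jl)//.
  by move=> y; rewrite KJ (linZ Jl).
Qed.

End operator_sqrt.

(** * Orthonormal bases and Hilbert-Schmidt operators *)

Section finite_sums.
Context {R : realType} {I : choiceType}.
Implicit Types (a b : I -> R) (s t : R) (F G : seq I) (r : nat -> I -> R).

(** For nonnegative [a] this says that the unordered sum over [I] is at most [s]; [I] may be
    uncountable. *)
Definition bsum_le a s := forall F, uniq F -> \sum_(i <- F) a i <= s.

Lemma bsum_leW a s t : s <= t -> bsum_le a s -> bsum_le a t.
Proof. by move=> st h F /h /le_trans; apply. Qed.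

Lemma bsum_le_le a b s : (forall i, a i <= b i) -> bsum_le b s -> bsum_le a s.
Proof. by move=> ab h F uF; apply: le_trans (h _ uF); exact: ler_sum. Qed.

Lemma bsum_leD a b s t : bsum_le a s -> bsum_le b t ->
  bsum_le (fun i => a i + b i) (s + t).
Proof. by move=> ha hb F uF; rewrite big_split lerD ?ha ?hb. Qed.

Lemma bsum_leZ a s c : 0 <= c -> bsum_le a s -> bsum_le (fun i => c * a i) (c * s).
Proof. by move=> c0 h F uF; rewrite -big_distrr/= ler_wpM2l// h. Qed.

Lemma sum_subset a F G : (forall i, 0 <= a i) -> uniq F -> uniq G ->
  {subset F <= G} -> \sum_(i <- F) a i <= \sum_(i <- G) a i.
Proof.
move=> a0 uF uG FG.
rewrite [leRHS](bigID (mem F))/= -[leLHS]addr0 lerD//; last exact: sumr_ge0.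
rewrite -[leRHS]big_filter le_eqVlt; apply/orP; left; apply/eqP; apply: perm_big.
apply: uniq_perm => //; first exact: filter_uniq.
move=> i; rewrite mem_filter; apply/idP/andP => [iF|[]//]; split=> //.
exact: FG.
Qed.

Definition bsum0 r := forall e : R, 0 < e -> \forall n \near \oo, bsum_le (r n) e.

(** Tightness: no mass escapes to infinity. The finite set [F0] is fixed before n, and only large n
    matter. *)
Definition utail r := forall e : R, 0 < e -> exists F0 : seq I,
  \forall n \near \oo, forall F, uniq F -> (forall i, i \in F -> i \notin F0) ->
    \sum_(i <- F) r n i <= e.

Lemma utail_le r (r' : nat -> I -> R) :
  (\forall n \near \oo, forall i, r n i <= r' n i) -> utail r' -> utail r.
Proof.
move=> rr h e e0; have [F0 hF0] := h e e0; exists F0.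
near=> n => F uF FF0; apply: (@le_trans _ _ (\sum_(i <- F) r' n i)).
  by apply: ler_sum => i _; move: i; near: n.
by move: F uF FF0; near: n.
Unshelve. all: by end_near. Qed.

Lemma utailD r (r' : nat -> I -> R) :
  utail r -> utail r' -> utail (fun n i => r n i + r' n i).
Proof.
move=> h h' e e0; have e20 : 0 < e / 2 by rewrite divr_gt0.
have [F0 hF0] := h _ e20; have [F1 hF1] := h' _ e20; exists (F0 ++ F1).
near=> n => F uF FF; rewrite big_split/= (splitr e) lerD//.
  have {}FF i : i \in F -> i \notin F0.
    by move=> /FF; rewrite mem_cat negb_or => /andP[].
  by move: F uF FF; near: n.
have {}FF i : i \in F -> i \notin F1.
  by move=> /FF; rewrite mem_cat negb_or => /andP[].
by move: F uF FF; near: n.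
Unshelve. all: by end_near. Qed.

Lemma utailZ r c : 0 <= c -> utail r -> utail (fun n i => c * r n i).
Proof.
move=> c0 h e e0; have c1 : 0 < c + 1 by lra.
have [F0 hF0] := h _ (divr_gt0 e0 c1); exists F0.
near=> n => F uF FF0; rewrite -big_distrr/=.
have hs : \sum_(i <- F) r n i <= e / (c + 1) by move: F uF FF0; near: n.
apply: le_trans (ler_wpM2l c0 hs) _.
rewrite mulrCA ler_piMr ?(ltW e0)// ler_pdivrMr// mul1r; lra.
Unshelve. all: by end_near. Qed.

Lemma bsum0_utail r : bsum0 r -> utail r.
Proof.
move=> h e e0; exists [::]; near=> n => F uF _.
by move: F uF; near: n; exact: h.
Unshelve. all: by end_near. Qed.

Lemma bsum0_bnd r (s : nat -> R) : (forall n, bsum_le (r n) (s n)) ->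
  s @ \oo --> (0 : R) -> bsum0 r.
Proof.
move=> rs s0 e e0; near=> n; apply: bsum_leW (rs n).
apply: le_trans (ler_norm _) _; near: n.
by move: s0 => /cvgr0Pnorm_le/(_ _ e0).
Unshelve. all: by end_near. Qed.

(** Scheffe's argument: a finite set carries nearly all of [s], hence nearly all of [t n] for large
    n, which leaves little outside it. *)
Lemma utail_tight (r : nat -> I -> R) (a : I -> R) (t : nat -> R) s :
  (forall i, (r ^~ i) @ \oo --> a i) -> (forall n i, 0 <= r n i) ->
  (forall n, bsum_le (r n) (t n)) -> t @ \oo --> s ->
  (forall e, 0 < e -> exists2 F, uniq F & s - e <= \sum_(i <- F) a i) ->
  utail r.
Proof.
move=> ra r0 rt ts sF e e0; have e30 : 0 < e / 3 by rewrite divr_gt0.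
have [F0 uF0 hF0] := sF _ e30; exists F0.
have h : (fun n => \sum_(i <- F0) r n i) @ \oo --> \sum_(i <- F0) a i.
  elim: (F0) => [|i G IH].
    by rewrite big_nil; under eq_fun do rewrite big_nil; exact: cvg_cst.
  rewrite big_cons; under eq_fun do rewrite big_cons; exact: cvgD (ra i) IH.
near=> n => F uF FF0.
have : \sum_(i <- F ++ F0) r n i <= t n.
  apply: rt; rewrite cat_uniq uF uF0 andbT/=.
  by apply/hasPn => i iF0; apply/negP => /FF0; rewrite iF0.
rewrite big_cat/=.
have h1 : `|\sum_(i <- F0) a i - \sum_(i <- F0) r n i| <= e / 3.
  by near: n; move/cvgrPdist_le : h => /(_ _ e30).
have h2 : `|s - t n| <= e / 3.
  by near: n; move/cvgrPdist_le : ts => /(_ _ e30).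
by move: h1 h2; rewrite !ler_norml => /andP[h1 h1'] /andP[h2 h2']; lra.
Unshelve. all: by end_near. Qed.

(** Replaces a mere bound by the value of the sum, the supremum of the finite sums, which finite
    subfamilies nearly attain. *)
Lemma bsum_tight a s : (forall i, 0 <= a i) -> bsum_le a s ->
  exists2 s', bsum_le a s' &
    forall e, 0 < e -> exists2 F, uniq F & s' - e <= \sum_(i <- F) a i.
Proof.
move=> a0 as_.
pose S := [set \sum_(i <- F) a i | F in [set F : seq I | uniq F]].
have Ssup : has_sup S.
  split; first by exists (\sum_(i <- [::]) a i); exists [::].
  by exists s => _ [F /= uF <-]; exact: as_.
exists (sup S).
  by move=> F uF; apply: ub_le_sup; [exact: Ssup.2|exists F].
move=> e e0; have [_ [F /= uF <-] h] := sup_adherent e0 Ssup.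
by exists F => //; exact: ltW.
Qed.

Lemma utail_cst a s : (forall i, 0 <= a i) -> bsum_le a s -> utail (fun=> a).
Proof.
move=> a0 /(bsum_tight a0)[s' h1 h2].
by apply: (@utail_tight _ a (fun=> s') s') => // [i|]; exact: cvg_cst.
Qed.

(** Dominated convergence for sums: termwise limits settle the finite set given by [utail], uniform
    tails the rest. *)
Lemma dominated_bsum0 r : (forall n i, 0 <= r n i) ->
  (forall i, (r ^~ i) @ \oo --> (0 : R)) -> utail r -> bsum0 r.
Proof.
move=> r0 ri rt e e0; have e20 : 0 < e / 2 by rewrite divr_gt0.
have [F0 hF0] := rt _ e20.
have h : (fun n => \sum_(i <- undup F0) r n i) @ \oo --> (0 : R).
  elim: (undup F0) => [|i G IH].
    by under eq_fun do rewrite big_nil; exact: cvg_cst.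
  rewrite [X in _ --> X](_ : 0 = 0 + 0); last by rewrite addr0.
  under eq_fun do rewrite big_cons; exact: cvgD (ri i) IH.
near=> n => F uF.
rewrite (bigID (mem F0))/= (splitr e); apply: lerD.
  rewrite -big_filter.
  apply: (@le_trans _ _ (\sum_(i <- undup F0) r n i)).
    apply: sum_subset => //; [exact: filter_uniq|exact: undup_uniq|].
    by move=> i; rewrite mem_filter mem_undup => /andP[].
  apply: le_trans (ler_norm _) _; near: n.
  by move/cvgr0Pnorm_le : h => /(_ _ e20).
rewrite -big_filter.
have FF i : i \in [seq i <- F | i \notin F0] -> i \notin F0.
  by rewrite mem_filter => /andP[].
have uF' : uniq [seq i <- F | i \notin F0] by exact: filter_uniq.
by move: uF' FF; move: [seq _ <- _ | _]; near: n.
Unshelve. all: by end_near. Qed.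

End finite_sums.

(** * Bessel, Parseval and the Hilbert-Schmidt norm *)

Section orthonormal_family.
Context {R : realType} {H : hilbert R} {I : choiceType}.
Implicit Types (x y z : H) (F G : seq I).

Definition orthonormal_total (b : I -> H) :=
  (forall i j, ip (b i) (b j) = (i == j)%:R) /\
  (forall x, (forall i, ip x (b i) = 0) -> x = 0).

Variable b : I -> H.
Hypothesis bP : orthonormal_total b.

Let fproj x F := \sum_(i <- F) ip x (b i) *: b i.
Let fsum x F := \sum_(i <- F) ip x (b i) ^+ 2.

Lemma ip_fproj x F i : uniq F -> ip (fproj x F) (b i) = (i \in F)%:R * ip x (b i).
Proof.
move=> uF; rewrite /fproj ip_suml.
under eq_bigr => j _ do rewrite ipZl bP.1.
have [iF|iF] := boolP (i \in F).
  rewrite (bigD1_seq i)//= eqxx mulr1 mul1r big1 ?addr0// => j ji.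
  by rewrite (negbTE ji) mulr0.
rewrite mul0r big1_seq// => j /andP[_ jF].
by rewrite (_ : j == i = false) ?mulr0//; apply/eqP => ji; rewrite -ji jF in iF.
Qed.

Lemma fproj_sub x F G : uniq F -> uniq G -> {subset G <= F} ->
  ip (fproj x F) (fproj x G) = fsum x G.
Proof.
move=> uF uG GF; rewrite {2}/fproj ip_sumr; apply: eq_big_seq => i /GF iF.
by rewrite ipZr ip_fproj// iF mul1r -expr2.
Qed.

Lemma fproj_dist x F G : uniq F -> uniq G -> {subset G <= F} ->
  ip (fproj x F - fproj x G) (fproj x F - fproj x G) = fsum x F - fsum x G.
Proof.
move=> uF uG GF; rewrite !(ipBl, ipBr) (ipC (fproj x G) (fproj x F)).
by rewrite !fproj_sub//; lra.
Qed.

Lemma bessel x : bsum_le (fun i => ip x (b i) ^+ 2) (ip x x).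
Proof.
move=> F uF; have := ip_ge0 (x - fproj x F).
rewrite !(ipBl, ipBr) (ipC _ x) fproj_sub//.
have -> : ip x (fproj x F) = fsum x F.
  by rewrite ip_sumr; apply: eq_bigr => i _; rewrite ipZr -expr2.
by rewrite /fsum; lra.
Qed.

(** Partial expansions over finite sets nearly attaining the supremum [s] form a Cauchy sequence.
    Its limit has the same coefficients as [x], so it is [x] by totality, and hence [|x|^2 <= s]. *)
Lemma parseval x e : 0 < e ->
  exists2 F, uniq F & ip x x - e <= \sum_(i <- F) ip x (b i) ^+ 2.
Proof.
have [s hs htight] := bsum_tight (fun i => sqr_ge0 (ip x (b i))) (bessel x).
suff xs : ip x x <= s.
  by move=> /htight[F uF h]; exists F => //; lra.
have /choice[F hF] : forall n : nat, exists F, uniq F /\ s - n.+1%:R^-1 <= fsum x F.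
  by move=> n; have [|F uF h] := htight n.+1%:R^-1; [rewrite invr_gt0|exists F].
pose y n := fproj x (F n).
have fle G : uniq G -> fsum x G <= s by exact: hs.
(* Both expansions are compared with the one over the union [G], whose sum of squares is still at
   most [s]. *)
have ymn m n : nrm (y m - y n) ^+ 2 <= 2 * m.+1%:R^-1 + 2 * n.+1%:R^-1.
  pose G := undup (F m ++ F n).
  have uG : uniq G by exact: undup_uniq.
  have -> : y m - y n = (fproj x G - y n) - (fproj x G - y m).
    by apply: ip_ext => z; rewrite !ipBl; ring.
  rewrite sqr_nrm; apply: le_trans (nrmB2 _ _) _.
  have [um hm] := hF m; have [un hn] := hF n.
  rewrite !fproj_dist//.
  - have := fle G uG; move: hm hn.
    by move: (m.+1%:R^-1) (n.+1%:R^-1) => p q; lra.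
  - by move=> i iF; rewrite mem_undup mem_cat iF.
  - by move=> i iF; rewrite mem_undup mem_cat iF orbT.
have inv0 : (fun n : nat => n.+1%:R^-1 : R) @ \oo --> (0 : R) by exact: cvg_harmonic.
have yC : cauchyH y.
  move=> d d0; have d40 : 0 < d ^+ 2 / 4 by rewrite divr_gt0// exprn_gt0.
  have /cvgr0Pnorm_le/(_ _ d40)[N _ hN] := inv0; exists N => m n Nm Nn.
  rewrite -ler_sqr ?nnegrE ?(ltW d0)//; apply: le_trans (ymn m n) _.
  have := hN m Nm; have := hN n Nn; rewrite /= !ger0_norm//.
  by move: (m.+1%:R^-1) (n.+1%:R^-1) => p q; lra.
have [z yz] := cauchyH_cvg yC.
have zx : z = x.
  apply/eqP; rewrite -subr_eq0; apply/eqP/bP.2 => i.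
  have h1 : (fun n => ip (y n - x) (b i) ^+ 2) @ \oo --> ip (z - x) (b i) ^+ 2.
    have h : (fun n => ip (y n - x) (b i)) @ \oo --> ip (z - x) (b i).
      exact: cvgH_ip (cvgHB yz (cvgH_cst _)) (cvgH_cst _).
    exact: cvg_sqr h.
  have : ip (z - x) (b i) ^+ 2 <= 0.
    apply: (le_cvg h1 inv0) => n; have [uF hn] := hF n.
    rewrite ipBl ip_fproj//; have [iF|iF] := boolP (i \in F n).
      by rewrite mul1r subrr expr0n /= invr_ge0.
    (* Adjoining [i] to [F n] cannot exceed [s], so a missing coefficient has square at most
       [1 / (n + 1)]. *)
    rewrite mul0r sub0r sqrrN.
    have := fle (i :: F n); rewrite /= iF uF => /(_ isT).
    move: hn; rewrite {2}/fsum big_cons -/(fsum x (F n)); move: (n.+1%:R^-1) => q; lra.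
  by move=> h; apply/eqP; rewrite -sqrf_eq0 eq_le h sqr_ge0.
have := cvgH_ip yz yz; rewrite zx => h.
apply: (le_cvg h (cvg_cst s)) => n; have [uF _] := hF n.
by rewrite fproj_sub//; exact: fle.
Qed.

Lemma parseval_seq (xs : seq H) e : 0 < e -> exists2 G, uniq G &
  \sum_(x <- xs) ip x x - e <= \sum_(x <- xs) \sum_(j <- G) ip x (b j) ^+ 2.
Proof.
elim: xs e => [|x xs IH] e e0; first by exists [::] => //; rewrite !big_nil; lra.
have e20 : 0 < e / 2 by rewrite divr_gt0.
have [G uG hG] := IH _ e20; have [F uF hF] := parseval x e20.
exists (undup (F ++ G)); first exact: undup_uniq.
rewrite !big_cons.
have h1 : \sum_(i <- F) ip x (b i) ^+ 2 <= \sum_(j <- undup (F ++ G)) ip x (b j) ^+ 2.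
  apply: sum_subset; rewrite ?undup_uniq// => i; first exact: sqr_ge0.
  by rewrite mem_undup mem_cat => ->.
have h2 : \sum_(x <- xs) \sum_(j <- G) ip x (b j) ^+ 2 <=
   \sum_(x <- xs) \sum_(j <- undup (F ++ G)) ip x (b j) ^+ 2.
  apply: ler_sum => y _; apply: sum_subset; rewrite ?undup_uniq// => i.
    exact: sqr_ge0.
  by rewrite mem_undup mem_cat orbC => ->.
lra.
Qed.

(** Exchange of the double sum of [<K b_i, b_j>^2]. With finite sums only, Parseval supplies one
    finite [G] for all [K b_i] at once, and Bessel closes the other side. *)
Lemma hs_adjoint (K K' : H -> H) s : (forall x y, ip (K x) y = ip x (K' y)) ->
  bsum_le (fun i => ip (K' (b i)) (K' (b i))) s ->
  bsum_le (fun i => ip (K (b i)) (K (b i))) s.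
Proof.
move=> KK hs F uF; apply/ler_addgt0Pr => e e0.
have [G uG hG] := parseval_seq [seq K (b i) | i <- F] e0.
rewrite !big_map in hG; rewrite -lerBlDr; apply: le_trans hG _.
rewrite exchange_big/=; apply: le_trans (hs G uG); apply: ler_sum => j _.
under eq_bigr => i _ do rewrite KK ipC.
exact: bessel.
Qed.

(** The Hilbert-Schmidt norm dominates the operator norm: the coefficients of [K x] are
    [<x, K' b_j>]. *)
Lemma hs_bnd (K K' : H -> H) s x : (forall x y, ip (K x) y = ip x (K' y)) ->
  bsum_le (fun i => ip (K' (b i)) (K' (b i))) s ->
  ip (K x) (K x) <= s * ip x x.
Proof.
move=> KK hs; apply/ler_addgt0Pr => e e0.
have [G uG hG] := parseval (K x) e0; rewrite -lerBlDr; apply: le_trans hG _.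
apply: (@le_trans _ _ (\sum_(i <- G) ip x x * ip (K' (b i)) (K' (b i)))).
  by apply: ler_sum => i _; rewrite KK ip_CS2.
by rewrite -big_distrr/= mulrC ler_wpM2r ?ip_ge0// hs.
Qed.

End orthonormal_family.

(** * Orthogonal projections *)

Section projections.
Context {R : realType} {H : hilbert R}.
Implicit Types (x y z f h u : H) (P Q : H -> H) (M : H -> Prop).

Definition is_proj P := symop P /\ forall x, P (P x) = P x.

(** Closed subspaces are handled through a projection: its existence makes [M] a linear subspace and
    closed, see [proj_onto_closed]. *)
Definition proj_onto Q M :=
  [/\ symop Q, forall x, M (Q x) & forall x, M x -> Q x = x].

Lemma proj_onto_is Q M : proj_onto Q M -> is_proj Q.
Proof. by case=> Qs QM MQ; split=> // x; apply: MQ. Qed.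

Lemma proj_ip P x : is_proj P -> ip (P x) x = ip (P x) (P x).
Proof. by case=> Ps PP; rewrite -Ps PP. Qed.

Lemma proj_bnd P : is_proj P -> bnd P 1.
Proof.
move=> PP x; rewrite mul1r.
have : nrm (P x) * nrm (P x) <= nrm (P x) * nrm x.
  by rewrite -expr2 sqr_nrm -proj_ip//; exact: ip_le.
have [->|n0] := eqVneq (nrm (P x)) 0; first by move=> _.
by rewrite ler_pM2l// lt_neqAle eq_sym n0 nrm_ge0.
Qed.

Lemma nrm_ip x y : (nrm x <= nrm y) = (ip x x <= ip y y).
Proof. by rewrite -!sqr_nrm ler_sqr ?nnegrE. Qed.

Lemma proj_onto_intro (M : H -> Prop) (Q : H -> H) :
  (forall x y, M x -> M y -> M (x - y)) ->
  (forall f, M (Q f)) -> (forall f k, M k -> ip (Q f - f) k = 0) ->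
  proj_onto Q M.
Proof.
move=> MB QM Qo; split=> //.
  move=> x y.
  have /eqP := Qo y (Q x) (QM x); rewrite ipBl subr_eq0 => /eqP h1.
  have /eqP := Qo x (Q y) (QM y); rewrite ipBl subr_eq0 => /eqP h2.
  by rewrite -h2 [LHS]ipC -h1 ipC.
move=> x Mx; apply/eqP; rewrite -subr_eq0; apply/eqP/ip_eq0.
by apply: Qo; exact: MB.
Qed.

Lemma proj_onto_orth Q M f k : proj_onto Q M -> M k -> ip (f - Q f) k = 0.
Proof. by case=> Qs QM MQ Mk; rewrite ipBl Qs MQ// subrr. Qed.

Lemma proj_onto_closed Q M f : proj_onto Q M ->
  (forall e : R, 0 < e -> exists2 w, M w & nrm (f - w) <= e) -> M f.
Proof.
move=> QM h; have [Qs QMM MQ] := QM; have Ql := symop_lin Qs.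
suff -> : f = Q f by [].
apply/eqP; rewrite -subr_eq0; apply/eqP/nrm_eq0/eqP.
rewrite eq_le nrm_ge0 andbT; apply/ler_addgt0Pr => e e0.
have [w Mw hw] := h _ (divr_gt0 e0 (ltr0Sn R 1)).
rewrite add0r (_ : f - Q f = (f - w) - Q (f - w)); last first.
  by rewrite (linB Ql) (MQ w Mw); apply: ip_ext => z; rewrite !ipBl; ring.
apply: le_trans (nrmB _ _) _.
have := bnd1 (f - w) (proj_bnd (proj_onto_is QM)); lra.
Qed.

(* Weak convergence of orthogonal projections implies strong convergence. *)
Lemma proj_weak_strong (P_ : nat -> H -> H) P :
  (forall n, is_proj (P_ n)) -> is_proj P ->
  (forall x y, (fun n => ip (P_ n x) y) @ \oo --> ip (P x) y) ->
  forall x, cvgH (P_ ^~ x) (P x).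
Proof.
move=> Pn PP w x; apply: cvgH_sqr.
have e : (fun n => nrm (P_ n x - P x) ^+ 2) =
    (fun n => ip (P_ n x) x - 2 * ip (P_ n x) (P x) + ip (P x) (P x)).
  apply/funext => n; rewrite sqr_nrm !(ipBl, ipBr) -(proj_ip x (Pn n)).
  by rewrite (ipC (P x) (P_ n x)); ring.
rewrite e [X in _ --> X](_ : 0 = ip (P x) x - 2 * ip (P x) (P x) + ip (P x) (P x)).
  exact: cvgD (cvgB (w x x) (cvgM (cvg_cst _) (w x (P x)))) (cvg_cst _).
by rewrite proj_ip//; ring.
Qed.

End projections.

(** * Traces of absolute values from Hilbert-Schmidt factors *)

Section hilbert_schmidt.
Context {R : realType} {H : hilbert R} {I : choiceType} (b : I -> H).
Hypothesis bP : orthonormal_total b.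

(** A contraction on the left is harmless termwise; on the right it is moved to the left by taking
    adjoints twice. *)
Lemma hs_mulr (X X' U U' : H -> H) s :
  (forall x y, ip (X x) y = ip x (X' y)) ->
  (forall x y, ip (U x) y = ip x (U' y)) -> bnd U' 1 ->
  bsum_le (fun i => ip (X (b i)) (X (b i))) s ->
  bsum_le (fun i => ip (X (U (b i))) (X (U (b i)))) s.
Proof.
move=> XX UU U1 hs; apply: (hs_adjoint (K := fun x => X (U x))
  (K' := fun x => U' (X' x)) bP).
  by move=> x y; rewrite XX UU.
have hX' : bsum_le (fun i => ip (X' (b i)) (X' (b i))) s.
  by apply: (hs_adjoint bP _ hs) => x y; rewrite ipC -XX ipC.
by apply: bsum_le_le hX' => i; rewrite -nrm_ip; exact: bnd1.
Qed.

(* With [B = (A + e)^-1], the contraction [U = K B] approximates the partial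
   isometry of the polar decomposition of [K]. *)
Lemma polar_approx (K A : H -> H) M e : symop K -> symop A -> bnd A M ->
  posop A -> (forall x, A (A x) = K (K x)) -> 0 < e ->
  exists U U' : H -> H, [/\ forall x y, ip (U x) y = ip x (U' y),
    bnd U 1, bnd U' 1 &
    forall x, ip (A x) x <= ip (K x) (U x) + e * ip x x].
Proof.
move=> Ks As AM Ap AK e0; have Al := symop_lin As.
have Tl : lin (fun x => A x + e *: x).
  by move=> a x y; rewrite Al scalerDr scalerDr !scalerA (mulrC e a) addrACA.
have TM : bnd (fun x => A x + e *: x) (M + e).
  move=> x; apply: le_trans (nrmD _ _) _.
  by rewrite nrmZ (gtr0_norm e0) mulrDl lerD2r.
have Te x : e * ip x x <= ip (A x + e *: x) x.
  by rewrite ipDl ipZl lerDr.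
have /choice[B BE] := lax_milgram Tl TM e0 Te.
have Bs : symop B.
  move=> x y; have -> : ip (B x) y = ip (B x) (A (B y) + e *: B y) by rewrite BE.
  have -> : ip x (B y) = ip (A (B x) + e *: B x) (B y) by rewrite BE.
  by rewrite ipDl ipDr ipZl ipZr As.
have AB x : ip (A (B x)) (A (B x)) <= ip x x.
  have -> : ip x x = ip (A (B x) + e *: B x) (A (B x) + e *: B x) by rewrite BE.
  rewrite !(ipDl, ipDr, ipZl, ipZr) (ipC (B x) (A (B x))).
  have h1 : 0 <= e * ip (A (B x)) (B x) by rewrite mulr_ge0// ltW.
  have h2 : 0 <= e * (e * ip (B x) (B x)) by rewrite !mulr_ge0 ?ip_ge0// ltW.
  lra.
have AK2 x y : ip (A x) (A y) = ip (K x) (K y) by rewrite -As AK Ks.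
have UU x y : ip (K (B x)) y = ip x (B (K y)) by rewrite Ks Bs.
have U1 : bnd (fun x => K (B x)) 1.
  by move=> x; rewrite mul1r nrm_ip -AK2.
exists (fun x => K (B x)), (fun y => B (K y)); split=> //.
- move=> y; rewrite mul1r.
  have h : nrm (B (K y)) * nrm (B (K y)) <= nrm (B (K y)) * nrm y.
    rewrite -expr2 sqr_nrm -UU; apply: le_trans (ip_le _ _) _.
    by rewrite ler_wpM2r//; exact: (bnd1 _ U1).
  have [->|n0] := eqVneq (nrm (B (K y))) 0; first by [].
  by move: h; rewrite ler_pM2l// lt_neqAle eq_sym n0 nrm_ge0.
(* Here [<A x, A B x> = <K x, K B x>], and [<A x, B x> = <x, A B x> <= |x|^2] because [A B] is a
   contraction. *)
- move=> x; have -> : ip (A x) x = ip (A x) (A (B x) + e *: B x) by rewrite BE.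
  rewrite ipDr ipZr AK2 lerD2l ler_wpM2l ?(ltW e0)//.
  rewrite As; apply: le_trans (ip_le _ _) _; rewrite -sqr_nrm expr2.
  by rewrite ler_wpM2l// nrm_ip.
Qed.

(** For [K = X' X - Y' Y]: the polar contraction turns [<A b, b>] into [<K b, U b>], which is a sum
    of two pairings each having one factor from [X - Y]. The weight [eta] in the
    arithmetic-geometric inequality trades the small [d] against the bounded [s + t]. *)
Lemma trace_abs_diff (X X' Y Y' K A : H -> H) (s t d eta M : R) :
  (forall x y, ip (X x) y = ip x (X' y)) ->
  (forall x y, ip (Y x) y = ip x (Y' y)) ->
  (forall x y, ip (K x) y = ip (X x) (X y) - ip (Y x) (Y y)) ->
  symop A -> bnd A M -> posop A -> (forall x, A (A x) = K (K x)) ->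
  bsum_le (fun i => ip (X (b i)) (X (b i))) s ->
  bsum_le (fun i => ip (Y (b i)) (Y (b i))) t ->
  bsum_le (fun i => ip (X (b i) - Y (b i)) (X (b i) - Y (b i))) d ->
  0 < eta ->
  bsum_le (fun i => ip (A (b i)) (b i)) (d / eta + eta / 2 * (s + t)).
Proof.
move=> XX YY KE As AM Ap AK hs ht hd eta0.
have Ks : symop K by move=> x y; rewrite KE [RHS]ipC KE (ipC (X y)) (ipC (Y y)).
have amgm x y : ip x y <= ip x x / (2 * eta) + eta / 2 * ip y y.
  have := ip_ge0 (x - eta *: y).
  rewrite !(ipBl, ipBr, ipZl, ipZr) (ipC y x) => h.
  have : 0 <= (ip x x - 2 * eta * ip x y + eta ^+ 2 * ip y y) / (2 * eta).
    by rewrite divr_ge0//; lra.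
  have -> : (ip x x - 2 * eta * ip x y + eta ^+ 2 * ip y y) / (2 * eta) =
    ip x x / (2 * eta) + eta / 2 * ip y y - ip x y by field; lra.
  by rewrite subr_ge0.
have X'Y' x y : ip (X x - Y x) y = ip x (X' y - Y' y).
  by rewrite ipBl ipBr XX YY.
move=> F uF; apply/ler_addgt0Pr => e e0.
(* The polar error is spread over [F]; the successor avoids dividing by zero when [F] is empty. *)
pose e' := e / (size F).+1%:R.
have e'0 : 0 < e' by rewrite divr_gt0.
have [U [U' [UU U1 U'1 hU]]] := polar_approx Ks As AM Ap AK e'0.
have hXU := hs_mulr XX UU U'1 hs.
have hDU := hs_mulr X'Y' UU U'1 hd.
have h1 i : ip (A (b i)) (b i) <=
    (ip (X (b i) - Y (b i)) (X (b i) - Y (b i)) / (2 * eta) +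
       eta / 2 * ip (X (U (b i))) (X (U (b i)))) +
    (ip (X (U (b i)) - Y (U (b i))) (X (U (b i)) - Y (U (b i))) / (2 * eta) +
       eta / 2 * ip (Y (b i)) (Y (b i))) + e'.
  apply: le_trans (hU (b i)) _; rewrite bP.1 eqxx mulr1 lerD2r KE.
  have -> : ip (X (b i)) (X (U (b i))) - ip (Y (b i)) (Y (U (b i))) =
    ip (X (b i) - Y (b i)) (X (U (b i))) + ip (X (U (b i)) - Y (U (b i))) (Y (b i)).
    by rewrite !ipBl (ipC (X (U _)) (Y _)) (ipC (Y (U _)) (Y _)); ring.
  by rewrite lerD.
apply: le_trans (ler_sum _ (fun i _ => h1 i)) _.
have he : \sum_(i <- F) e' <= e.
  rewrite big_const_seq count_predT iter_addr_0 -mulr_natl /e'.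
  by rewrite mulrCA ler_piMr ?(ltW e0)// ler_pdivrMr// mul1r ler_nat.
have i0 : 0 <= (2 * eta)^-1 by rewrite invr_ge0 mulr_ge0// ltW.
have i1 : 0 <= eta / 2 by rewrite divr_ge0// ltW.
have := ler_wpM2r i0 (hd F uF); have := ler_wpM2r i0 (hDU F uF).
have := ler_wpM2l i1 (hXU F uF); have := ler_wpM2l i1 (ht F uF).
have -> : d / eta = d / (2 * eta) + d / (2 * eta) by field; lra.
rewrite !big_split/=; move: he; move: (\sum_(i <- F) e') => Se he.
rewrite -!big_distrl/= -!big_distrr/=; lra.
Qed.

End hilbert_schmidt.

(** * Weighted ranges of projections *)

Section lower_bound.
Context {R : realType} {H : hilbert R}.
Implicit Types (x y z f h u : H) (N : H -> Prop).

Definition subspace N := forall (a : R) x y, N x -> N y -> N (x + a *: y).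
Definition seq_closed N := forall (u : nat -> H) x, (forall n, N (u n)) -> cvgH u x -> N x.

(** The vector [G u] has positive distance [d] from [G N]. Otherwise some [G (n_k + u)] tends to 0;
    the lower bound on [N] makes [n_k] Cauchy, and injectivity of [G] puts [u] in [N]. Then
    [|t| d <= |G (x + t u)|] controls the new coefficient. *)
Lemma bounded_below_add (G : H -> H) N u C :
  lin G -> bnd G 1 -> (forall x, G x = 0 -> x = 0) ->
  subspace N -> seq_closed N -> 0 <= C ->
  (forall x, N x -> nrm x <= C * nrm (G x)) -> ~ N u ->
  exists2 C' : R, 0 <= C' &
    forall x (t : R), N x -> nrm (x + t *: u) <= C' * nrm (G (x + t *: u)).
Proof.
move=> Gl G1 Ginj Nsub Ncl C0 NC Nu.
have NB x y : N x -> N y -> N (x - y).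
  by move=> Nx Ny; rewrite -scaleN1r; exact: Nsub.
have NZ (a : R) x : N x -> N (a *: x).
  move=> Nx; have N0 : N 0 by rewrite -(subrr x); exact: NB.
  by rewrite -[a *: x]add0r; exact: Nsub.
have [d d0 hd] : exists2 d : R, 0 < d & forall n, N n -> d <= nrm (G (n + u)).
  apply: contrapT => /forall2NP hno.
  have /choice[n hn] : forall k : nat, exists n, N n /\ nrm (G (n + u)) <= k.+1%:R^-1.
    move=> k; have [|] := hno (k.+1%:R^-1); first by rewrite invr_gt0 ltr0n.
    move=> /existsNP[n /not_implyP[Nn /negP]]; rewrite -ltNge => h.
    by exists n; split=> //; exact: ltW.
  have inv0 : (fun n : nat => n.+1%:R^-1 : R) @ \oo --> (0 : R) by exact: cvg_harmonic.
  have nC : cauchyH n.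
    move=> e e0; have e1 : 0 < e / (2 * (C + 1)) by rewrite divr_gt0// mulr_gt0//; lra.
    have /cvgr0Pnorm_le/(_ _ e1)[K _ hK] := inv0; exists K => i j Ki Kj.
    have := NC _ (NB _ _ (hn i).1 (hn j).1) => /le_trans; apply.
    have -> : G (n i - n j) = G (n i + u) - G (n j + u).
      by rewrite -(linB Gl) opprD addrACA subrr addr0.
    have h1 := nrmB (G (n i + u)) (G (n j + u)).
    have := hK i Ki; have := hK j Kj; rewrite /= !ger0_norm// => k1 k2.
    have h2 := le_trans h1 (lerD (le_trans (hn i).2 k2) (le_trans (hn j).2 k1)).
    apply: le_trans (ler_wpM2l C0 h2) _.
    have -> : C * (e / (2 * (C + 1)) + e / (2 * (C + 1))) = e * (C / (C + 1)).
      by field; lra.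
    rewrite ler_piMr ?(ltW e0)// ler_pdivrMr ?mul1r; lra.
  have [l nl] := cauchyH_cvg nC.
  have Nl : N l by apply: (Ncl n) => // k; exact: (hn k).1.
  have h : cvgH (fun k => G (n k + u)) (G (l + u)).
    by apply: (bnd_cvg Gl G1); exact: cvgHD nl (cvgH_cst _).
  have Gl0 : G (l + u) = 0.
    apply/nrm_eq0/eqP; rewrite eq_le nrm_ge0 andbT.
    by apply: (le_cvg (cvgH_nrm h) inv0) => k; exact: (hn k).2.
  apply: Nu; have /eqP := Ginj _ Gl0; rewrite addr_eq0 => /eqP lu.
  by rewrite -[u]opprK -lu -scaleN1r; exact: NZ.
(* From [|f| <= |x| + |t| |u|], [|x| <= C (|G f| + |t| |u|)] and [|t| <= |G f| / d]. *)
pose C' : R := C + (C + 1) * nrm u / d.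
have C'0 : 0 <= C'.
  by rewrite addr_ge0// divr_ge0 ?(ltW d0)// mulr_ge0//; lra.
exists C' => // x t Nx.
have [t0|t0] := eqVneq t 0.
  rewrite t0 scale0r addr0; apply: le_trans (NC _ Nx) _; rewrite ler_wpM2r//.
  by rewrite lerDl divr_ge0 ?(ltW d0)// mulr_ge0//; lra.
set f := x + t *: u.
have ht : `|t| * d <= nrm (G f).
  have -> : f = t *: (t^-1 *: x + u) by rewrite scalerDr scalerA divff// scale1r.
  by rewrite (linZ Gl) nrmZ ler_wpM2l//; apply: hd; exact: NZ.
have xf : x = f - t *: u by rewrite /f addrK.
have h1 : nrm f <= nrm x + `|t| * nrm u by rewrite -nrmZ; exact: nrmD.
have h2 : nrm (G x) <= nrm (G f) + `|t| * nrm u.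
  rewrite xf (linB Gl); apply: le_trans (nrmB _ _) _; rewrite lerD2l -nrmZ.
  exact: bnd1.
have h3 : nrm x <= C * (nrm (G f) + `|t| * nrm u).
  by apply: le_trans (NC _ Nx) _; rewrite ler_wpM2l.
have ht' : `|t| <= nrm (G f) / d by rewrite ler_pdivlMr.
have C10 : 0 <= (C + 1) * nrm u by rewrite mulr_ge0//; lra.
have h4 := ler_wpM2l C10 ht'.
have -> : C' * nrm (G f) = C * nrm (G f) + (C + 1) * nrm u * (nrm (G f) / d).
  by rewrite /C'; ring.
lra.
Qed.

Context {I : choiceType} (b : I -> H).
Hypothesis bP : orthonormal_total b.
Variables (G D : H -> H).
Hypotheses (Gs : symop G) (Ds : symop D).
Hypothesis GD : forall x, ip (G x) (G x) + ip (D x) (D x) = ip x x.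
Hypothesis Ginj : forall x, G x = 0 -> x = 0.

Lemma G_bnd : bnd G 1.
Proof.
by move=> x; rewrite mul1r nrm_ip; have := GD x; have := ip_ge0 (D x); lra.
Qed.

(** The form of compactness that is used: after projecting away the basis vectors of a finite set
    carrying all but [e] of the sum, the Hilbert-Schmidt square of [K], and hence its operator norm
    squared, is at most [e]. *)
Lemma hs_tail_small (K K' : H -> H) s e :
  (forall x y, ip (K x) y = ip x (K' y)) ->
  bsum_le (fun i => ip (K (b i)) (K (b i))) s -> 0 < e ->
  exists F : seq I, forall f, (forall i, i \in F -> ip f (b i) = 0) ->
    ip (K f) (K f) <= e * ip f f.
Proof.
move=> KK hs e0.
have K'l : forall x y, ip (K' x) y = ip x (K y) by move=> x y; rewrite ipC -KK ipC.
have Kl : lin K.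
  by move=> a x y; apply: ip_ext => z; rewrite KK !ip_linear !KK.
have [s' hs' tight] := bsum_tight (fun i => ip_ge0 (K (b i))) hs.
have [F uF hF] := tight _ e0; exists F => f hf.
pose Q x := x - \sum_(i <- F) ip x (b i) *: b i.
have Qs : symop Q.
  move=> x y; rewrite ipBl ipBr ip_suml ip_sumr; congr (_ - _).
  by apply: eq_bigr => i _; rewrite ipZl ipZr mulrC (ipC y) .
have Qb i : Q (b i) = if i \in F then 0 else b i.
  rewrite /Q; have [iF|iF] := boolP (i \in F).
    rewrite (bigD1_seq i)//= bP.1 eqxx scale1r big1 ?addr0 ?subrr// => j ji.
    by rewrite bP.1 eq_sym (negbTE ji) scale0r.
  rewrite big1_seq ?subr0// => j /andP[_ jF].
  rewrite bP.1 (_ : i == j = false) ?scale0r//.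
  by apply/eqP => ij; rewrite ij jF in iF.
have Qf : Q f = f.
  by rewrite /Q big1_seq ?subr0// => i /andP[_ iF]; rewrite hf// scale0r.
have hKQ : bsum_le (fun i => ip (K (Q (b i))) (K (Q (b i)))) e.
  move=> F' uF'.
  rewrite (eq_bigr (fun i => if i \notin F then ip (K (b i)) (K (b i)) else 0)); last first.
    by move=> i _; rewrite Qb; case: ifP => //= _; rewrite (lin0 Kl) ip0l.
  rewrite -big_mkcond -big_filter.
  have h := hs' ([seq i <- F' | i \notin F] ++ F).
  have {}h : \sum_(i <- [seq i <- F' | i \notin F]) ip (K (b i)) (K (b i)) +
    \sum_(i <- F) ip (K (b i)) (K (b i)) <= s'.
    rewrite -big_cat; apply: h; rewrite cat_uniq filter_uniq// uF andbT/=.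
    by apply/hasPn => i iF; rewrite mem_filter/= iF.
  lra.
have KQQK x y : ip (Q (K' x)) y = ip x (K (Q y)) by rewrite Qs K'l.
have KQ x y : ip (K (Q x)) y = ip x (Q (K' y)) by rewrite KK Qs.
by have := hs_bnd bP f KQ (hs_adjoint bP KQQK hKQ); rewrite Qf.
Qed.

(* [4 |D f|^2 <= |f|^2] for the [f] in the range of [P] orthogonal to finitely
   many [b i]; the missing directions are added by [bounded_below_add]. *)
Lemma hs_bounded_below P s : is_proj P ->
  bsum_le (fun i => ip (P (D (b i))) (P (D (b i)))) s ->
  exists2 k : R, 0 < k <= 1 &
    forall f, P f = f -> k * ip f f <= ip (G f) (G f).
Proof.
move=> PP hs; have Ps := PP.1; have Pl := symop_lin Ps; have Gl := symop_lin Gs.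
have PDs x y : ip (D (P x)) y = ip x (P (D y)) by rewrite Ds Ps.
have q0 : 0 < 4^-1 :> R by rewrite invr_gt0.
have [F0 hF0] := hs_tail_small PDs (hs_adjoint bP PDs hs) q0.
have suffC : (exists2 C : R, 0 <= C & forall f, P f = f -> nrm f <= C * nrm (G f)) ->
    exists2 k : R, 0 < k <= 1 & forall f, P f = f -> k * ip f f <= ip (G f) (G f).
  move=> [C C0 hC]; have C1 : 0 < 1 + C ^+ 2 by rewrite ltr_pwDl// sqr_ge0.
  (* The summand 1 keeps the constant at most 1 and also covers [C = 0]. *)
  exists (1 + C ^+ 2)^-1.
    by rewrite invr_gt0 C1/= invf_le1// lerDl sqr_ge0.
  move=> f Pf; rewrite ler_pdivrMl// -!sqr_nrm.
  apply: (@le_trans _ _ (C ^+ 2 * nrm (G f) ^+ 2)).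
    by rewrite -exprMn ler_sqr ?nnegrE ?mulr_ge0// hC.
  by rewrite ler_wpM2r ?sqr_ge0// lerDr.
apply: suffC.
pose N (F : seq I) f := P f = f /\ forall i, i \in F -> ip f (b i) = 0.
suff ind F : (exists2 C : R, 0 <= C & forall f, N F f -> nrm f <= C * nrm (G f)) ->
    exists2 C : R, 0 <= C & forall f, P f = f -> nrm f <= C * nrm (G f).
  apply: (ind F0); exists 2 => // f [Pf hf].
  have h := hF0 f hf; rewrite Pf in h; have hGD := GD f.
  apply: nrm_le; first by rewrite mulr_ge0.
  rewrite exprMn sqr_nrm -natrX; have := ip_ge0 f; lra.
elim: F => [|i F IH] [C C0 hC].
  by exists C => // f Pf; apply: hC; split.
apply: IH.
have [hall|] := pselect (forall f, N F f -> ip f (b i) = 0).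
  exists C => // f [Pf hf]; apply: hC; split=> // j.
  by rewrite inE => /orP[/eqP ->|]; [exact: hall|exact: hf].
(* Dropping the constraint [<f, b_i> = 0] enlarges the subspace by one dimension, spanned by any [u]
   that violates it. *)
move=> /existsNP[u /not_implyP[[Pu hu] /eqP ub]].
have Nsub : subspace (N (i :: F)).
  move=> a x y [Px hx] [Py hy]; split; first by rewrite (linD Pl) (linZ Pl) Px Py.
  by move=> j jF; rewrite ipDl ipZl hx// hy// mulr0 addr0.
have Ncl : seq_closed (N (i :: F)).
  move=> w x Nw wx; split.
    apply: (@cvgH_unique _ _ w) => //.
    have := bnd_cvg Pl (proj_bnd PP) wx.
    by rewrite (_ : (fun n => P (w n)) = w)//; apply/funext => n; exact: (Nw n).1.
  move=> j jF; have h := cvgH_ip wx (cvgH_cst (b j)).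
  have E : (fun n => ip (w n) (b j)) = fun=> 0 by apply/funext => n; exact: (Nw n).2.
  by rewrite E in h; exact: (cvg_unique _ h (cvg_cst _)).
have Nu : ~ N (i :: F) u.
  by move=> [_ /(_ i)]; rewrite mem_head => /(_ isT) h; rewrite h eqxx in ub.
have [C' C'0 hC'] := bounded_below_add Gl G_bnd Ginj Nsub Ncl C0 hC Nu.
exists C' => // f [Pf hf].
pose t : R := ip f (b i) / ip u (b i).
have -> : f = (f - t *: u) + t *: u by rewrite subrK.
apply: hC'; split; first by rewrite (linB Pl) (linZ Pl) Pf Pu.
move=> j; rewrite inE ipBl ipZl => /orP[/eqP ->|jF]; first by rewrite /t divfK ?subrr.
by rewrite hf// hu// mulr0 subrr.
Qed.

(** For [f] in the range of [P_n], [D f = D P f + D (P_n - P) f]. The bound for [P] keeps the first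
    term strictly below [|f|], and the second is small because the Hilbert-Schmidt norm dominates
    the operator norm. *)
Lemma hs_bounded_below_near (P_ : nat -> H -> H) P s :
  (forall n, is_proj (P_ n)) -> is_proj P ->
  bsum_le (fun i => ip (P (D (b i))) (P (D (b i)))) s ->
  bsum0 (fun n i => ip (P_ n (D (b i)) - P (D (b i))) (P_ n (D (b i)) - P (D (b i)))) ->
  exists2 k : R, 0 < k <= 1 & \forall n \near \oo,
    forall f, P_ n f = f -> k * ip f f <= ip (G f) (G f).
Proof.
move=> Pn PP hs h0; have [k /andP[k0 k1] hk] := hs_bounded_below PP hs.
(* From [|a + b|^2 <= (1 + k) |a|^2 + (1 + 1/k) |b|^2]: the first term contributes
   [(1 + k) (1 - k) = 1 - k^2], and this [e] makes the second [k^2 / 2]. *)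
pose e : R := k ^+ 2 / (2 * (1 + k^-1)).
have ki : 0 < k^-1 by rewrite invr_gt0.
have e0 : 0 < e by rewrite divr_gt0 ?exprn_gt0// mulr_gt0//; lra.
exists (k ^+ 2 / 2).
  rewrite divr_gt0 ?exprn_gt0//=.
  by have : k ^+ 2 <= 1 by [rewrite exprn_ile1// ltW]; lra.
near=> n => f Pf.
have hn : bsum_le (fun i => ip (P_ n (D (b i)) - P (D (b i))) (P_ n (D (b i)) - P (D (b i)))) e.
  by near: n; exact: h0.
have Dl := symop_lin Ds.
have adj x y : ip (D (P_ n x - P x)) y = ip x (P_ n (D y) - P (D y)).
  by rewrite (linB Dl) ipBl ipBr !Ds (Pn n).1 PP.1.
have h1 := hs_bnd bP f adj hn.
have hDf : D f = D (P f) + D (P_ n f - P f) by rewrite (linB Dl) Pf addrC subrK.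
have h2 : ip (D (P f)) (D (P f)) <= (1 - k) * ip f f.
  have hPf : ip (P f) (P f) <= ip f f by rewrite -nrm_ip; exact: bnd1 (proj_bnd PP).
  have := hk (P f) (PP.2 f); have := GD (P f).
  have : (1 - k) * ip (P f) (P f) <= (1 - k) * ip f f by rewrite ler_wpM2l// subr_ge0.
  lra.
move: h1 h2 hDf; move: (D (P_ n f - P f)) (D (P f)) => y x h1 h2 hDf.
have h3 : ip (D f) (D f) <= (1 + k) * ip x x + (1 + k^-1) * ip y y.
  rewrite hDf; have := ip_ge0 (k *: x - y).
  rewrite !(ipBl, ipBr, ipZl, ipZr, ipDl, ipDr) (ipC y x) => h.
  have : 0 <= k^-1 * (k * (k * ip x x) - k * ip x y - (k * ip x y - ip y y)).
    by apply: mulr_ge0; [exact: ltW|lra].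
  have -> : k^-1 * (k * (k * ip x x) - k * ip x y - (k * ip x y - ip y y)) =
    k * ip x x + k^-1 * ip y y - 2 * ip x y by field; lra.
  lra.
have h4 : (1 + k) * ip x x <= (1 + k) * ((1 - k) * ip f f) by rewrite ler_wpM2l//; lra.
have h5 : (1 + k^-1) * ip y y <= (1 + k^-1) * (e * ip f f) by rewrite ler_wpM2l//; lra.
have he : (1 + k^-1) * e = k ^+ 2 / 2 by rewrite /e; field; lra.
rewrite mulrA he in h5.
have := GD f; have := ip_ge0 f; lra.
Unshelve. all: by end_near. Qed.

End lower_bound.

(** * The projection onto the image of a range under [G] *)

Section image_projection.
Context {R : realType} {H : hilbert R}.
Implicit Types (x y z f h u : H) (P Q : H -> H) (M : H -> Prop).
Variable G : H -> H.
Hypotheses (Gs : symop G) (G1 : bnd G 1).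

Definition gimage P x := exists2 h, P h = h & x = G h.

Lemma gimageB P x y : symop P -> gimage P x -> gimage P y -> gimage P (x - y).
Proof.
move=> Ps [h Ph ->] [k Pk ->]; exists (h - k).
  by rewrite (linB (symop_lin Ps)) Ph Pk.
by rewrite (linB (symop_lin Gs)).
Qed.

(** The normal equations: the projection is [G S] with [S = (P G^2 P)^-1 P G], the inverse being
    taken on the range of [P]. *)
Lemma gimage_proj P k : is_proj P -> 0 < k <= 1 ->
  (forall f, P f = f -> k * ip f f <= ip (G f) (G f)) ->
  exists Q, proj_onto Q (gimage P).
Proof.
move=> PP /andP[k0 k1] hk; have [Ps PPP] := PP.
have Pl := symop_lin Ps; have Gl := symop_lin Gs.
(* Adding [1 - P] makes the operator coercive on all of [H]; with [k <= 1] the constant remains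
   [k]. *)
pose T x := P (G (G (P x))) + (x - P x).
have Ts : symop T.
  by move=> x y; rewrite /T !(ipDl, ipDr, ipNl, ipNr) -!Ps -!Gs -!Ps.
have Tk x : k * ip x x <= ip (T x) x.
  have hPx : ip (T x) x = ip (G (P x)) (G (P x)) + (ip x x - ip (P x) (P x)).
    by rewrite /T ipDl ipBl Ps Gs (proj_ip x PP).
  rewrite hPx; have := hk (P x) (PPP x).
  have : k * (ip x x - ip (P x) (P x)) <= 1 * (ip x x - ip (P x) (P x)).
    rewrite ler_wpM2r// subr_ge0 -nrm_ip.
    exact: bnd1 (proj_bnd PP).
  lra.
have T3 : bnd T 3.
  move=> x; apply: le_trans (nrmD _ _) _.
  have a1 := bnd1 x (proj_bnd PP); have a2 := bnd1 (P x) G1.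
  have a3 := bnd1 (G (P x)) G1; have a4 := bnd1 (G (G (P x))) (proj_bnd PP).
  have := nrmB x (P x); lra.
have /choice[S hS] := fun f => lax_milgram (symop_lin Ts) T3 k0 Tk (P (G f)).
(* Applying [P] to the equation removes the summand [1 - P]; comparison with the equation itself
   leaves [S f - P (S f) = 0]. *)
have PS f : P (S f) = S f.
  have := congr1 P (hS f); rewrite /T (linD Pl) (linB Pl) !PPP subrr addr0 => h.
  have := hS f; rewrite /T h -[RHS]addr0 => /addrI /eqP.
  by rewrite subr_eq0 eq_sym => /eqP.
exists (fun f => G (S f)); apply: proj_onto_intro.
- by move=> x y; exact: gimageB.
- by move=> f; exists (S f).
- move=> f _ [h Ph ->]; rewrite -Gs -Ph -Ps (linB Gl) (linB Pl).
  have := hS f; rewrite /T PS subrr addr0 => ->.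
  by rewrite subrr ip0l.
Qed.

(* [|Q z|^2 = <z, G h> = <P (G z), h>] when [Q z = G h]. *)
Lemma gimage_proj_le P Q k z : is_proj P -> proj_onto Q (gimage P) -> 0 < k ->
  (forall f, P f = f -> k * ip f f <= ip (G f) (G f)) ->
  k * ip (Q z) (Q z) <= ip (P (G z)) (P (G z)).
Proof.
move=> PP QM k0 hk; have [Qs QQ _] := QM.
have [h Ph Qh] := QQ z.
have e1 : ip (Q z) (Q z) = ip (P (G z)) h.
  by rewrite -(proj_ip _ (proj_onto_is QM)) Qh ipC -Gs PP.1 Ph.
have h1 := hk h Ph; rewrite -Qh in h1.
have := ip_CS2 (P (G z)) h; rewrite -e1 => h2.
have [q0|q0] := eqVneq (ip (Q z) (Q z)) 0; first by rewrite q0 mulr0 ip_ge0.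
have qp : 0 < ip (Q z) (Q z) by rewrite lt_neqAle eq_sym q0 ip_ge0.
rewrite -(ler_pM2r qp) -mulrA -expr2.
apply: le_trans (ler_wpM2l (ltW k0) h2) _.
by rewrite mulrCA ler_wpM2l ?ip_ge0.
Qed.

(** On the range of [Q], a vector [G h] is the limit of [G (P_n h)], which [Q_n] fixes. On a vector
    [z] orthogonal to that range, [P (G z) = 0], and [k |Q_n z|^2 <= |P_n G z|^2] tends to 0. *)
Lemma gimage_proj_cvg (P_ Q_ : nat -> H -> H) P Q k :
  (forall n, is_proj (P_ n)) -> is_proj P ->
  (forall x, cvgH (P_ ^~ x) (P x)) ->
  (forall n, proj_onto (Q_ n) (gimage (P_ n))) -> proj_onto Q (gimage P) ->
  0 < k ->
  (\forall n \near \oo, forall f, P_ n f = f -> k * ip f f <= ip (G f) (G f)) ->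
  forall x, cvgH (Q_ ^~ x) (Q x).
Proof.
move=> Pn PP Pcvg Qn QP k0 hk x.
have Gl := symop_lin Gs.
have Qnl n : lin (Q_ n) by have [/symop_lin] := Qn n.
have [Qs QQ QM] := QP; have Ql := symop_lin Qs.
have part1 : cvgH (fun n => Q_ n (Q x)) (Q x).
  have [h Ph ->] := QQ x.
  have c : cvgH (fun n => G (P_ n h)) (G h).
    by apply: bnd_cvg => //; rewrite -{2}Ph.
  case: c => c.
  have c2 : (fun n => 2 * nrm (G (P_ n h) - G h)) @ \oo --> (0 : R).
    by rewrite -(mulr0 2); exact: cvgM (cvg_cst _) c.
  apply: (cvgH_le c2) => n.
  have e : Q_ n (G (P_ n h)) = G (P_ n h).
    by have [_ _] := Qn n; apply; exists (P_ n h) => //; exact: (Pn n).2.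
  apply: le_trans (nrm_dist _ (Q_ n (G (P_ n h))) _) _.
  rewrite -(linB (Qnl n)) e.
  have := bnd1 (G h - G (P_ n h)) (proj_bnd (proj_onto_is (Qn n))).
  rewrite (nrmBC (G h)); lra.
have part2 : cvgH (fun n => Q_ n (x - Q x)) 0.
  set z := x - Q x.
  have PGz : P (G z) = 0.
    apply: ip_ext => y; rewrite ip0l PP.1 Gs.
    by apply: proj_onto_orth QP _; exists (P y) => //; exact: PP.2.
  have /cvgH_nrm c := Pcvg (G z); rewrite PGz nrm0 in c.
  have c2 : (fun n => k^-1 * nrm (P_ n (G z)) ^+ 2) @ \oo --> (0 : R).
    rewrite [X in _ --> X](_ : 0 = k^-1 * 0 ^+ 2); last by rewrite expr0n mulr0.
    have c5 := cvg_sqr c; exact: cvgM (cvg_cst _) c5.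
  have c3 : (fun n => nrm (Q_ n z) ^+ 2) @ \oo --> (0 : R).
    apply: (@squeeze_cvgr _ _ _ _ (cst 0) _ _ _ _ _ c2); last exact: cvg_cst.
    near=> n; rewrite sqr_ge0/= ler_pdivlMl// !sqr_nrm.
    by apply: gimage_proj_le => //; near: n.
  by apply: cvgH_sqr; under eq_fun do rewrite subr0.
have := cvgHD part1 part2; rewrite addr0.
rewrite (_ : (fun n => _) = Q_ ^~ x)//.
by apply/funext => n; rewrite -(linD (Qnl n)) addrC subrK.
Unshelve. all: by end_near. Qed.

End image_projection.

(** * Hilbert-Schmidt convergence behind a cutoff *)

Section hilbert_schmidt_cvg.
Context {R : realType} {H : hilbert R} {I : choiceType} (b : I -> H).
Hypothesis bP : orthonormal_total b.
Implicit Types (x y z f h u : H) (P Q C : H -> H).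

(** The factor [Q C] rather than [C Q C]: for a projection and a symmetric cutoff, [C Q C] is the
    adjoint of [Q C] times [Q C]. *)
Definition hs_conv C (Q_ : nat -> H -> H) Q :=
  bsum0 (fun n i => ip (Q_ n (C (b i)) - Q (C (b i))) (Q_ n (C (b i)) - Q (C (b i)))).

Definition hs_fin C Q := exists s, bsum_le (fun i => ip (Q (C (b i))) (Q (C (b i)))) s.

Lemma hs_conv_dom C (Q_ : nat -> H -> H) Q :
  (forall x, cvgH (Q_ ^~ x) (Q x)) -> hs_fin C Q ->
  utail (fun n i => ip (Q_ n (C (b i))) (Q_ n (C (b i)))) ->
  hs_conv C Q_ Q.
Proof.
move=> Qc [s hs] ht; apply: dominated_bsum0.
- by move=> n i; exact: ip_ge0.
- move=> i; have [c] := Qc (C (b i)); have := cvg_sqr c; rewrite expr0n/=.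
  by under eq_fun do rewrite sqr_nrm.
- apply: (@utail_le _ _ _ (fun n i => 2 * ip (Q_ n (C (b i))) (Q_ n (C (b i))) +
      2 * ip (Q (C (b i))) (Q (C (b i))))).
    by apply: nearW => n i; exact: nrmB2.
  apply: utailD; first exact: utailZ.
  apply: utailZ => //; apply: (utail_cst _ hs) => i; exact: ip_ge0.
Qed.

Lemma hs_conv_utail C (Q_ : nat -> H -> H) Q : hs_fin C Q -> hs_conv C Q_ Q ->
  utail (fun n i => ip (Q_ n (C (b i))) (Q_ n (C (b i)))).
Proof.
move=> [s hs] hc.
apply: (@utail_le _ _ _ (fun n i =>
   2 * ip (Q_ n (C (b i)) - Q (C (b i))) (Q_ n (C (b i)) - Q (C (b i))) +
   2 * ip (Q (C (b i))) (Q (C (b i))))).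
  apply: nearW => n i.
  have := nrmD2 (Q_ n (C (b i)) - Q (C (b i))) (Q (C (b i))).
  by rewrite subrK.
apply: utailD; first exact/utailZ/bsum0_utail.
apply: utailZ => //; apply: (utail_cst _ hs) => i; exact: ip_ge0.
Qed.

Section commuting.
Variables (G C : H -> H).
Hypotheses (Gs : symop G) (G1 : bnd G 1) (Cs : symop C).
Hypothesis GC : forall x, G (C x) = C (G x).

(** Commutation turns [X G C] into [X C G], and the contraction [G] on the right does not increase
    the sum. *)
Lemma hs_mulGC X s : symop X ->
  bsum_le (fun i => ip (X (C (b i))) (X (C (b i)))) s ->
  bsum_le (fun i => ip (X (G (C (b i)))) (X (G (C (b i))))) s.
Proof.
move=> Xs hs.
have XC x y : ip (X (C x)) y = ip x (C (X y)) by rewrite Xs Cs.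
have h := hs_mulr bP XC Gs G1 hs.
by apply: bsum_le_le h => i; rewrite GC.
Qed.

Lemma gimage_hs_fin P Q k : is_proj P -> proj_onto Q (gimage G P) -> 0 < k ->
  (forall f, P f = f -> k * ip f f <= ip (G f) (G f)) ->
  hs_fin C P -> hs_fin C Q.
Proof.
move=> PP QM k0 hk [s hs]; exists (k^-1 * s).
have ki : 0 <= k^-1 by rewrite invr_ge0 ltW.
have h := bsum_leZ ki (hs_mulGC PP.1 hs).
apply: bsum_le_le h => i; rewrite ler_pdivlMl//.
exact: gimage_proj_le QM k0 hk.
Qed.

Lemma gimage_hs_conv (P_ Q_ : nat -> H -> H) P Q k :
  (forall n, is_proj (P_ n)) -> is_proj P ->
  (forall n, proj_onto (Q_ n) (gimage G (P_ n))) ->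
  (forall x, cvgH (Q_ ^~ x) (Q x)) ->
  0 < k ->
  (\forall n \near \oo, forall f, P_ n f = f -> k * ip f f <= ip (G f) (G f)) ->
  hs_fin C P -> hs_fin C Q -> hs_conv C P_ P -> hs_conv C Q_ Q.
Proof.
move=> Pn PP Qn Qc k0 hk [s hs] Qfin hP.
apply: hs_conv_dom => //.
apply: (@utail_le _ _ _ (fun n i =>
    k^-1 * ip (P_ n (G (C (b i)))) (P_ n (G (C (b i)))))).
  near=> n => i; rewrite ler_pdivlMl//.
  by apply: (gimage_proj_le Gs (C (b i)) (Pn n) (Qn n) k0); near: n.
apply: utailZ; first by rewrite invr_ge0 ltW.
apply: (@hs_conv_utail (fun x => G (C x)) P_ P).
  by exists s; apply: hs_mulGC => //; exact: PP.1.
move=> e e0; near=> n.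
have hn : bsum_le (fun i => ip (P_ n (C (b i)) - P (C (b i)))
   (P_ n (C (b i)) - P (C (b i)))) e by near: n; exact: hP.
apply: (hs_mulGC (X := fun x => P_ n x - P x)) hn.
by move=> x y; rewrite ipBl ipBr (Pn n).1 PP.1.
Unshelve. all: by end_near. Qed.

End commuting.
End hilbert_schmidt_cvg.

(** * Adjoining finitely many vectors to a subspace *)

Section add_vector.
Context {R : realType} {H : hilbert R}.
Implicit Types (x y z f h u e : H) (P Q : H -> H) (M : H -> Prop).

Definition addvec M u x := exists t : R, M (x - t *: u).

Lemma proj_onto_fix Q M x : proj_onto Q M -> M x <-> Q x = x.
Proof. by move=> [_ h1 h2]; split=> [/h2//|<-]. Qed.

(** The Gram-Schmidt direction. As the inverse of 0 is 0, it vanishes when [Q] fixes [u], so the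
    formula for the enlarged projection needs no case distinction. *)
Definition dir Q u := (nrm (u - Q u))^-1 *: (u - Q u).

Lemma dir_sqr Q u : ip (dir Q u) (dir Q u) <= 1.
Proof.
rewrite /dir ipZl ipZr -sqr_nrm; have [->|n0] := eqVneq (nrm (u - Q u)) 0.
  by rewrite invr0 mul0r.
by rewrite (_ : _ * (_ * _) = 1)//; field.
Qed.

Lemma addvec_proj Q M u : proj_onto Q M ->
  proj_onto (fun x => Q x + ip x (dir Q u) *: dir Q u) (addvec M u).
Proof.
move=> QM; have [Qs QQ QK] := QM; have Ql := symop_lin Qs.
have Mfix x := proj_onto_fix x QM.
have QP := proj_onto_is QM.
split.
- move=> x y; move: (dir Q u) => e; rewrite ipDl ipDr Qs ipZl ipZr (ipC _ y); ring.
- move=> x; exists (ip x (dir Q u) * (nrm (u - Q u))^-1); apply/Mfix.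
  rewrite /dir; move: (nrm _) (ip _ _) => r c.
  rewrite !(linD Ql, linN Ql, linZ Ql, QP.2) subrr !scaler0 addr0.
  apply: ip_ext => z; rewrite !(ipDl, ipNl, ipZl); ring.
- move=> x [t /Mfix Qx].
  pose y := x - t *: u.
  have xE : x = y + t *: u by rewrite /y subrK.
  have Qy : Q y = y by [].
  have u'y : ip y (u - Q u) = 0.
    by rewrite ipC (proj_onto_orth u QM)//; apply/Mfix.
  have Quu : ip (Q u) (u - Q u) = 0.
    by rewrite ipC (proj_onto_orth u QM)//; exact: QQ.
  have uu : ip u (u - Q u) = ip (u - Q u) (u - Q u).
    by rewrite [RHS]ipBl Quu subr0.
  rewrite {}xE (linD Ql) (linZ Ql) Qy /dir ipZr ipDl ipZl u'y add0r uu -sqr_nrm.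
  rewrite -addrA; congr (_ + _); rewrite scalerA.
  have [n0|n0] := eqVneq (nrm (u - Q u)) 0.
    rewrite n0 invr0 mulr0 scale0r addr0; congr (_ *: _).
    by apply/eqP; rewrite eq_sym -subr_eq0; apply/eqP/nrm_eq0.
  have -> : (nrm (u - Q u))^-1 * (t * nrm (u - Q u) ^+ 2) * (nrm (u - Q u))^-1 = t.
    by field.
  by rewrite -scalerDr addrC subrK.
Qed.

Lemma cvgH_op (T_ : nat -> H -> H) (T : H -> H) (u_ : nat -> H) u :
  (forall n, lin (T_ n)) -> (forall n, bnd (T_ n) 1) ->
  (forall x, cvgH (T_ ^~ x) (T x)) -> cvgH u_ u ->
  cvgH (fun n => T_ n (u_ n)) (T u).
Proof.
move=> Tl T1 Tc [uc]; have [c] := Tc u.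
have h : (fun n => nrm (u_ n - u) + nrm (T_ n u - T u)) @ \oo --> (0 : R).
  rewrite [X in _ --> X](_ : 0 = 0 + 0); last by rewrite addr0.
  exact: cvgD uc c.
apply: (cvgH_le h) => n; apply: le_trans (nrm_dist _ (T_ n u) _) _.
by rewrite lerD2r -(linB (Tl n)); exact: bnd1.
Qed.

(** Normalisation is continuous away from 0, and the limit vector [u - Q u] is nonzero precisely
    because [u] is outside [M]. *)
Lemma dir_cvg (Q_ : nat -> H -> H) Q M (u_ : nat -> H) u :
  (forall n, is_proj (Q_ n)) -> proj_onto Q M ->
  (forall x, cvgH (Q_ ^~ x) (Q x)) -> cvgH u_ u -> ~ M u ->
  cvgH (fun n => dir (Q_ n) (u_ n)) (dir Q u).
Proof.
move=> Qn QM Qc uc Mu.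
have c : cvgH (fun n => u_ n - Q_ n (u_ n)) (u - Q u).
  apply: cvgHB => //; apply: cvgH_op => // n; last exact: proj_bnd.
  exact: symop_lin (Qn n).1.
apply: cvgHZ => //; apply: cvgV; last exact: cvgH_nrm.
apply/eqP => /nrm_eq0 /eqP; rewrite subr_eq0 => /eqP h.
by apply: Mu; apply/(proj_onto_fix u QM).
Qed.

Context {I : choiceType} (b : I -> H).
Hypothesis bP : orthonormal_total b.

(** The invariant preserved by weighting and by each added vector; for the bounded cutoffs it is
    local trace class convergence, see [I1loc_cvgP]. *)
Definition strong_hs_cvg (CC : (H -> H) -> Prop) (Q_ : nat -> H -> H) Q :=
  (forall x, cvgH (Q_ ^~ x) (Q x)) /\
  forall C, CC C -> [/\ forall n, hs_fin b C (Q_ n), hs_fin b C Q & hs_conv b C Q_ Q].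

(** The coefficients [<C b_i, e> = <b_i, C e>] of the rank-one part are square summable by
    Bessel. *)
Lemma rank_one_hs_fin C Q e : symop C -> ip e e <= 1 -> hs_fin b C Q ->
  hs_fin b C (fun x => Q x + ip x e *: e).
Proof.
move=> Cs e1 [s hs]; exists (2 * s + 2 * ip (C e) (C e)).
have h := bsum_leD (bsum_leZ (ler0n R 2) hs) (bsum_leZ (ler0n R 2) (bessel bP (C e))).
apply: bsum_le_le h => i; apply: le_trans (nrmD2 _ _) _.
rewrite lerD2l ler_wpM2l// ipZl ipZr mulrA -expr2 Cs (ipC (b i)).
by rewrite ler_piMr ?sqr_ge0.
Qed.

(** Strong convergence is clear, so only the tails matter. Writing [C e_n = C e + C (e_n - e)],
    Bessel gives a fixed summable family and one whose total tends to 0. *)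
Lemma rank_one_hs_conv C (Q_ : nat -> H -> H) Q (e_ : nat -> H) e :
  symop C -> bnd C 1 -> (forall x, cvgH (Q_ ^~ x) (Q x)) ->
  (forall n, ip (e_ n) (e_ n) <= 1) -> ip e e <= 1 -> cvgH e_ e ->
  hs_fin b C Q -> hs_conv b C Q_ Q ->
  hs_conv b C (fun n x => Q_ n x + ip x (e_ n) *: e_ n) (fun x => Q x + ip x e *: e).
Proof.
move=> Cs C1 Qc en1 e1 ec fQ cQ; have Cl := symop_lin Cs.
apply: (hs_conv_dom (Q_ := fun n x => Q_ n x + ip x (e_ n) *: e_ n)).
- move=> x; apply: cvgHD => //; apply: cvgHZ => //.
  exact: cvgH_ip (cvgH_cst x) ec.
- exact: rank_one_hs_fin.
apply: (@utail_le _ _ _ (fun n i => 2 * ip (Q_ n (C (b i))) (Q_ n (C (b i))) +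
   2 * (2 * ip (C e) (b i) ^+ 2 + 2 * ip (C (e_ n - e)) (b i) ^+ 2))).
  apply: nearW => n i; apply: le_trans (nrmD2 _ _) _; rewrite lerD2l ler_wpM2l//.
  rewrite ipZl ipZr mulrA -expr2 Cs (ipC (b i)).
  apply: (@le_trans _ _ (ip (C (e_ n)) (b i) ^+ 2)).
    by rewrite ler_piMr ?sqr_ge0.
  have -> : ip (C (e_ n)) (b i) = ip (C e) (b i) + ip (C (e_ n - e)) (b i).
    by rewrite (linB Cl) ipBl addrC subrK.
  move: (ip _ _) (ip _ _) => p q; have := sqr_ge0 (p - q).
  rewrite sqrrB sqrrD; lra.
apply: utailD; first by apply: utailZ => //; exact: hs_conv_utail cQ.
apply: utailZ => //; apply: utailD.
  apply: utailZ => //; apply: (utail_cst _ (bessel bP (C e))) => i; exact: sqr_ge0.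
apply: utailZ => //; apply: bsum0_utail.
case: ec => ec; have ec2 := cvg_sqr ec; rewrite expr0n/= in ec2.
apply: bsum0_bnd ec2 => n; apply: bsum_leW (bessel bP _).
by rewrite sqr_nrm -nrm_ip; exact: bnd1.
Qed.

Lemma addvec_strong_hs_cvg CC (Q_ : nat -> H -> H) Q
    (M_ : nat -> H -> Prop) M (u_ : nat -> H) u :
  (forall C, CC C -> symop C /\ bnd C 1) ->
  (forall n, proj_onto (Q_ n) (M_ n)) -> proj_onto Q M -> cvgH u_ u -> ~ M u ->
  strong_hs_cvg CC Q_ Q ->
  strong_hs_cvg CC (fun n x => Q_ n x + ip x (dir (Q_ n) (u_ n)) *: dir (Q_ n) (u_ n))
          (fun x => Q x + ip x (dir Q u) *: dir Q u).
Proof.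
move=> CCP QM_ QM uc Mu [Qc CQ].
have ec := dir_cvg (fun n => proj_onto_is (QM_ n)) QM Qc uc Mu.
split=> [x|C CCC].
  apply: cvgHD => //; apply: cvgHZ => //; exact: cvgH_ip (cvgH_cst x) ec.
have [Cs C1] := CCP C CCC; have [f1 f2 f3] := CQ C CCC.
split=> [n||].
- by apply: rank_one_hs_fin => //; exact: dir_sqr.
- by apply: rank_one_hs_fin => //; exact: dir_sqr.
- by apply: rank_one_hs_conv => // [n|]; exact: dir_sqr.
Qed.

Section vector_sum.
Context {J : eqType}.
Implicit Types (s : seq J) (w : J -> H).

Definition vsum M s w x := exists t : J -> R, M (x - \sum_(j <- s) t j *: w j).

Lemma vsum_cons M j s w x : j \notin s ->
  vsum M (j :: s) w x <-> addvec (vsum M s w) (w j) x.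
Proof.
move=> js; split=> [[t]|[a [t h]]].
  by rewrite big_cons opprD addrA => h; exists (t j), t.
exists (fun i => if i == j then a else t i).
rewrite big_cons eqxx opprD addrA; move: h; congr (M (_ - _)).
apply: eq_big_seq => i si; case: eqP => // ij.
by rewrite -ij si in js.
Qed.

Lemma proj_onto_iff Q M M' : (forall x, M x <-> M' x) -> proj_onto Q M -> proj_onto Q M'.
Proof. by move=> MM [h1 h2 h3]; split=> // x; [apply/MM|move/MM/h3]. Qed.

Lemma vsum_strong_hs_cvg CC (Q_ : nat -> H -> H) Q (M_ : nat -> H -> Prop) M
    (w_ : nat -> J -> H) w s :
  (forall C, CC C -> symop C /\ bnd C 1) ->
  (forall n, proj_onto (Q_ n) (M_ n)) -> proj_onto Q M ->
  (forall j, cvgH (w_ ^~ j) (w j)) -> uniq s ->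
  (forall t : J -> R, M (\sum_(j <- s) t j *: w j) -> forall j, j \in s -> t j = 0) ->
  strong_hs_cvg CC Q_ Q ->
  exists (Q'_ : nat -> H -> H) (Q' : H -> H),
    [/\ forall n, proj_onto (Q'_ n) (vsum (M_ n) s (w_ n)),
    proj_onto Q' (vsum M s w) & strong_hs_cvg CC Q'_ Q'].
Proof.
move=> CCP QM_ QM wc + + gQ; elim: s => [_ _|j s IH /= /andP[js us] ind].
  have e N v x : N x <-> vsum N [::] v x.
    split=> [h|[t]]; last by rewrite big_nil subr0.
    by exists (fun=> 0); rewrite big_nil subr0.
  exists Q_, Q; split=> // [n|].
    exact: proj_onto_iff (e _ _) (QM_ n).
  exact: proj_onto_iff (e _ _) QM.
have [|Q'_ [Q' [h1 h2 h3]]] := IH us.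
  move=> t Mt i si.
  (* Independence of the tail: give the head the coefficient 0. *)
  have := ind (fun i => if i == j then 0 else t i).
  rewrite big_cons eqxx scale0r add0r.
  rewrite (eq_big_seq (fun i => t i *: w i)); last first.
    by move=> k sk; case: eqP => // kj; rewrite -kj sk in js.
  move=> /(_ Mt i); rewrite inE si orbT => /(_ isT).
  by case: eqP => // ij; rewrite -ij si in js.
have nM : ~ vsum M s w (w j).
  move=> [t Mt].
  (* If the head lay in the enlarged space, this relation would have coefficient 1 at [j]. *)
  have := ind (fun i => if i == j then 1 else - t i).
  rewrite big_cons eqxx scale1r.
  rewrite (eq_big_seq (fun i => - (t i *: w i))); last first.
    move=> k sk; case: eqP => [kj|_]; last by rewrite scaleNr.
    by rewrite -kj sk in js.
  rewrite sumrN => /(_ Mt j); rewrite mem_head eqxx => /(_ isT) /eqP.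
  by rewrite oner_eq0.
eexists; eexists; split; last exact: (addvec_strong_hs_cvg CCP h1 h2 (wc j) nM h3).
  move=> n; apply: proj_onto_iff (addvec_proj (w_ n j) (h1 n)).
  by move=> x; apply: iff_sym; exact: vsum_cons.
apply: proj_onto_iff (addvec_proj (w j) h2).
by move=> x; apply: iff_sym; exact: vsum_cons.
Qed.

End vector_sum.
End add_vector.

(** * The convergence theorem in Hilbert space *)

Section projections_convergence.
Context {R : realType} {H : hilbert R} {I : choiceType} (b : I -> H).
Hypothesis bP : orthonormal_total b.

(** Lower bounds are needed twice: for each single n, with its own constant, so that the projections
    exist and are locally Hilbert-Schmidt, and uniformly for large n, so that they converge. *)
Lemma projections_cvg (G D : H -> H) (CC : (H -> H) -> Prop)
    (P_ : nat -> H -> H) (P : H -> H) (J : eqType) (s : seq J)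
    (w_ : nat -> J -> H) (w : J -> H) :
  symop G -> symop D -> (forall x, ip (G x) (G x) + ip (D x) (D x) = ip x x) ->
  (forall x, G x = 0 -> x = 0) ->
  (forall C, CC C -> [/\ symop C, bnd C 1 & forall x, G (C x) = C (G x)]) ->
  (forall n, is_proj (P_ n)) -> is_proj P -> strong_hs_cvg b CC P_ P ->
  (forall n, hs_fin b D (P_ n)) -> hs_fin b D P -> hs_conv b D P_ P ->
  (forall j, cvgH (w_ ^~ j) (w j)) -> uniq s ->
  (forall t : J -> R, gimage G P (\sum_(j <- s) t j *: w j) ->
     forall j, j \in s -> t j = 0) ->
  exists (Q_ : nat -> H -> H) (Q : H -> H),
    [/\ forall n, proj_onto (Q_ n) (vsum (gimage G (P_ n)) s (w_ n)),
    proj_onto Q (vsum (gimage G P) s w) & strong_hs_cvg b CC Q_ Q].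
Proof.
move=> Gs Ds GD Ginj CCP Pn PP [Pc CP] Dn DP Dc wc us ind.
have G1 := G_bnd GD.
have lb P' : is_proj P' -> hs_fin b D P' ->
    exists2 k : R, 0 < k <= 1 & forall f, P' f = f -> k * ip f f <= ip (G f) (G f).
  by move=> PP' [s' hs']; exact: hs_bounded_below PP' hs'.
have /choice[Q_ QM_] n : exists Q, proj_onto Q (gimage G (P_ n)).
  by have [k k01 hk] := lb _ (Pn n) (Dn n); exact: gimage_proj (Pn n) k01 hk.
have [k /andP[k0 k1] hk] := lb _ PP DP.
have [Q QM] : exists Q, proj_onto Q (gimage G P).
  by apply: gimage_proj hk => //; rewrite k0.
have [s' hs'] := DP.
have [k' /andP[k'0 k'1] hk'] :=
  hs_bounded_below_near bP Gs Ds GD Ginj Pn PP hs' Dc.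
have Qc := gimage_proj_cvg Gs G1 Pn PP Pc QM_ QM k'0 hk'.
have gQ : strong_hs_cvg b CC Q_ Q.
  split=> // C CCC; have [Cs C1 GC] := CCP C CCC; have [f1 f2 f3] := CP C CCC.
  have fQ : hs_fin b C Q by exact: (gimage_hs_fin bP Gs G1 Cs GC PP QM k0 hk f2).
  split=> //; last exact: (gimage_hs_conv bP Gs G1 Cs GC Pn PP QM_ Qc k'0 hk').
  move=> n; have [kn /andP[kn0 kn1] hkn] := lb _ (Pn n) (Dn n).
  exact: (gimage_hs_fin bP Gs G1 Cs GC (Pn n) (QM_ n) kn0 hkn).
apply: (vsum_strong_hs_cvg bP _ QM_ QM wc us ind gQ).
by move=> C /CCP[].
Qed.

Definition is_abs (K A : H -> H) :=
  [/\ symop A, exists M, bnd A M, posop A & forall x, A (A x) = K (K x)].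

(** The positive operator [C P C] has the same quadratic form as its absolute value: each of the two
    is a positive root of the square of the other, so [abs_op_ge] applies in both directions. *)
Lemma abs_fin (C P A : H -> H) : symop C -> bnd C 1 -> is_proj P ->
  is_abs (fun x => C (P (C x))) A -> hs_fin b C P <->
  exists s, bsum_le (fun i => ip (A (b i)) (b i)) s.
Proof.
move=> Cs C1 PP [As [M AM] Ap AK]; have P1 := proj_bnd PP.
have Ks : symop (fun x => C (P (C x))) by move=> x y; rewrite Cs PP.1 Cs.
have Kp : posop (fun x => C (P (C x))).
  by move=> x; rewrite Cs proj_ip// ip_ge0.
have K1 : bnd (fun x => C (P (C x))) 1.
  move=> x; rewrite mul1r; apply: le_trans (bnd1 _ C1) _.
  by apply: le_trans (bnd1 _ P1) _; exact: bnd1.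
pose M1 := Num.max 1 M.
have K1' : bnd (fun x => C (P (C x))) M1 by apply: bndW K1; rewrite le_max lexx.
have A1' : bnd A M1 by apply: bndW AM; rewrite le_max lexx orbT.
have h1 := abs_op_ge Ks K1' As A1' Ap AK.
have h2 := abs_op_ge As A1' Ks K1' Kp (fun x => esym (AK x)).
have E x : ip (A x) x = ip (P (C x)) (P (C x)).
  by rewrite -proj_ip// -Cs; apply/eqP; rewrite eq_le h1 h2.
by split=> -[s hs]; exists s; apply: bsum_le_le hs => i; rewrite E.
Qed.

Lemma hs_conv_trace_abs (C : H -> H) (Q_ : nat -> H -> H) Q e :
  symop C -> (forall n, is_proj (Q_ n)) -> is_proj Q ->
  (forall n, hs_fin b C (Q_ n)) -> hs_fin b C Q -> hs_conv b C Q_ Q -> 0 < e ->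
  \forall n \near \oo, forall A, is_abs (fun x => C (Q_ n (C x) - Q (C x))) A ->
    bsum_le (fun i => ip (A (b i)) (b i)) e.
Proof.
move=> Cs Qn PQ fn [t ht] hc e0; have Cl := symop_lin Cs.
have t0 : 0 <= t by have := ht [::] isT; rewrite big_nil.
(* With [d <= 1] the total [s + t = 2 d + 3 t] is at most [4 t + 2], so the second half of the trace
   bound is at most [e / 2]. *)
pose eta : R := e / (4 * t + 2).
have eta0 : 0 < eta by rewrite divr_gt0//; lra.
(* Makes [d / eta <= e / 2]. *)
pose d := Num.min 1 (eta * e / 2).
have d0 : 0 < d by rewrite lt_min ltr01/= divr_gt0// mulr_gt0.
near=> n => A [As [M AM] Ap AK].
have hd : bsum_le (fun i => ip (Q_ n (C (b i)) - Q (C (b i)))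
    (Q_ n (C (b i)) - Q (C (b i)))) d by near: n; exact: hc.
have hs : bsum_le (fun i => ip (Q_ n (C (b i))) (Q_ n (C (b i)))) (2 * d + 2 * t).
  apply: bsum_le_le (bsum_leD (bsum_leZ (ler0n R 2) hd) (bsum_leZ (ler0n R 2) ht)) => i.
  have := nrmD2 (Q_ n (C (b i)) - Q (C (b i))) (Q (C (b i))).
  by rewrite subrK.
have XX x y : ip (Q_ n (C x)) y = ip x (C (Q_ n y)) by rewrite (Qn n).1 Cs.
have YY x y : ip (Q (C x)) y = ip x (C (Q y)) by rewrite PQ.1 Cs.
have KE x y : ip (C (Q_ n (C x) - Q (C x))) y =
    ip (Q_ n (C x)) (Q_ n (C y)) - ip (Q (C x)) (Q (C y)).
  by rewrite Cs ipBl -(Qn n).1 (Qn n).2 -PQ.1 PQ.2.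
apply: bsum_leW (trace_abs_diff bP XX YY KE As AM Ap AK hs ht hd eta0).
have d1 : d <= 1 by rewrite ge_min lexx.
have d2 : d / eta <= e / 2.
  by rewrite ler_pdivrMr// mulrC mulrA ge_min lexx orbT.
have : eta / 2 * (2 * d + 2 * t + t) <= eta / 2 * (4 * t + 2).
  by rewrite ler_wpM2l ?divr_ge0 ?(ltW eta0)//; lra.
have -> : eta / 2 * (4 * t + 2) = e / 2 by rewrite /eta; field; lra.
lra.
Unshelve. all: by end_near. Qed.

(* With [K_n = C (P_n - P) C], testing [K_n] gives weak, hence strong convergence,
   and [|P_n C e|^2 <= |P C e|^2 + <|K_n| e, e>] makes the sums uniformly small
   at infinity. *)
Lemma trace_abs_cvg_strong_hs_cvg (CC : (H -> H) -> Prop) (P_ : nat -> H -> H) P :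
  (forall C, CC C -> symop C /\ bnd C 1) ->
  (forall x y e, 0 < e -> exists2 C, CC C & nrm (x - C x) <= e /\ nrm (y - C y) <= e) ->
  (forall n, is_proj (P_ n)) -> is_proj P ->
  (forall C n, CC C -> hs_fin b C (P_ n)) -> (forall C, CC C -> hs_fin b C P) ->
  (forall C, CC C -> exists2 A_ : nat -> H -> H,
     forall n, is_abs (fun x => C (P_ n (C x) - P (C x))) (A_ n) &
     bsum0 (fun n i => ip (A_ n (b i)) (b i))) ->
  strong_hs_cvg b CC P_ P.
Proof.
move=> CCP dense Pn PP fn f hA.
have Pl := symop_lin PP.1; have Pnl n := symop_lin (Pn n).1.
pose K C n x := C (P_ n (C x) - P (C x)).
have Ks C n : CC C -> symop (K C n).
  by move=> /CCP[Cs _] x y; rewrite /K Cs ipBl (Pn n).1 PP.1 -ipBr Cs.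
have cK C x : CC C -> cvgH (fun n => K C n x) 0.
  move=> CCC; have [Cs C1] := CCP C CCC; have [A_ absA A0] := hA C CCC.
  apply/cvgHP => e e0.
  (* The bound [|K_n x|^2 <= 2 tr |K_n| |x|^2] combines [|K_n| <= 2], which controls the
     Hilbert-Schmidt norm by the trace, with the Hilbert-Schmidt bound on the operator norm. The 1
     covers [x = 0]. *)
  have d0 : 0 < e ^+ 2 / (2 * (ip x x + 1)).
    by rewrite divr_gt0 ?exprn_gt0// mulr_gt0//; have := ip_ge0 x; lra.
  have [N _ hN] := A0 _ d0; exists N => n Nn.
  apply: nrm_le; first exact: ltW.
  rewrite subr0; have [As [M AM] Ap AK] := absA n.
  have AKn y : ip (A_ n y) (A_ n y) = ip (K C n y) (K C n y).
    by rewrite As AK; symmetry; exact: (Ks C n CCC).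
  have A2 : bnd (A_ n) 2.
    move=> y; apply: nrm_le; first by rewrite mulr_ge0.
    rewrite AKn -sqr_nrm ler_sqr ?nnegrE ?mulr_ge0//.
    apply: le_trans (bnd1 _ C1) _; apply: le_trans (nrmB _ _) _.
    have := bnd1 (C y) (proj_bnd (Pn n)); have := bnd1 (C y) (proj_bnd PP).
    have := bnd1 y C1; lra.
  rewrite -AKn.
  have hs : bsum_le (fun i => ip (A_ n (b i)) (A_ n (b i)))
      (2 * (e ^+ 2 / (2 * (ip x x + 1)))).
    apply: bsum_le_le (bsum_leZ (ler0n R 2) (hN n Nn)) => i.
    exact: posop_sqr.
  apply: le_trans (hs_bnd bP x As hs) _.
  have -> : 2 * (e ^+ 2 / (2 * (ip x x + 1))) * ip x x =
      e ^+ 2 * (ip x x / (ip x x + 1)) by field; have := ip_ge0 x; lra.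
  have x1 : 0 < ip x x + 1 by have := ip_ge0 x; lra.
  by rewrite ler_piMr ?sqr_ge0// ler_pdivrMr// mul1r lerDl.
have weak x y : (fun n => ip (P_ n x) y) @ \oo --> ip (P x) y.
  apply/cvgrPdist_le => e e0.
  (* With both cutoff errors at most [e / (2 m)], the two error terms add up to at most
     [(m - 1) e / (2 m)]. *)
  pose m : R := 2 * (nrm x + nrm y) + 1.
  have m0 : 0 < m by rewrite /m; have := nrm_ge0 x; have := nrm_ge0 y; lra.
  have [C CCC [hx hy]] := dense x y _ (divr_gt0 (divr_gt0 e0 (ltr0Sn R 1)) m0).
  have [Cs C1] := CCP C CCC; have Cl := symop_lin Cs.
  have /cvgH_ip/(_ (cvgH_cst y)) c := cK C x CCC; rewrite ip0l in c.
  have /cvgr0Pnorm_le/(_ _ (divr_gt0 e0 (ltr0Sn R 1))) hn := c.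
  near=> n.
  have h1 : `|ip (K C n x) y| <= e / 2 by near: n.
  have h2 : `|ip (P_ n x - P x) (y - C y)| <= 2 * nrm x * (e / 2 / m).
    apply: le_trans (ip_CS _ _) _; apply: ler_pM => //.
    apply: le_trans (nrmB _ _) _.
    have := bnd1 x (proj_bnd (Pn n)); have := bnd1 x (proj_bnd PP); lra.
  have h3 : `|ip (P_ n (x - C x) - P (x - C x)) (C y)| <= 2 * (e / 2 / m) * nrm y.
    apply: le_trans (ip_CS _ _) _; apply: ler_pM => //; last exact: bnd1.
    apply: le_trans (nrmB _ _) _.
    have := bnd1 (x - C x) (proj_bnd (Pn n)); have := bnd1 (x - C x) (proj_bnd PP).
    lra.
  have -> : ip (P x) y - ip (P_ n x) y = - (ip (K C n x) y +
      ip (P_ n x - P x) (y - C y) + ip (P_ n (x - C x) - P (x - C x)) (C y)).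
    rewrite /K Cs (linB (Pnl n)) (linB Pl) !(ipBl, ipBr); ring.
  rewrite normrN; apply: le_trans (ler_normD _ _) _.
  apply: le_trans (lerD (ler_normD _ _) (lexx _)) _.
  apply: le_trans (lerD (lerD h1 h2) h3) _.
  have -> : e / 2 + 2 * nrm x * (e / 2 / m) + 2 * (e / 2 / m) * nrm y =
    e / 2 + e / 2 * ((m - 1) / m)
    by rewrite /m; field; have := nrm_ge0 x; have := nrm_ge0 y; lra.
  have : e / 2 * ((m - 1) / m) <= e / 2.
    apply: ler_piMr; first by rewrite divr_ge0// ltW.
    by rewrite ler_pdivrMr// mul1r gerBl.
  lra.
have strong := proj_weak_strong Pn PP weak.
split=> // C CCC; have [Cs C1] := CCP C CCC.
split=> //; [by move=> n; exact: fn|exact: f|].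
have [A_ absA A0] := hA C CCC.
apply: hs_conv_dom => //; first exact: f.
apply: (@utail_le _ _ _ (fun n i => ip (P (C (b i))) (P (C (b i))) +
   ip (A_ n (b i)) (b i))).
  apply: nearW => n i; have [As [M AM] Ap AK] := absA n.
  have K2 : bnd (K C n) 2.
    move=> y; apply: le_trans (bnd1 _ C1) _; apply: le_trans (nrmB _ _) _.
    have := bnd1 (C y) (proj_bnd (Pn n)); have := bnd1 (C y) (proj_bnd PP).
    have := bnd1 y C1; lra.
  pose M1 := Num.max 2 M.
  have K2' : bnd (K C n) M1 by apply: bndW K2; rewrite le_max lexx.
  have A2' : bnd (A_ n) M1 by apply: bndW AM; rewrite le_max lexx orbT.
  have := abs_op_ge (Ks C n CCC) K2' As A2' Ap AK (b i).
  rewrite {1}/K Cs ipBl -!proj_ip//; lra.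
apply: utailD.
  by have [s hs] := f C CCC; apply: (utail_cst _ hs) => i; exact: ip_ge0.
exact: bsum0_utail.
Unshelve. all: by end_near. Qed.

(** Strong convergence gives termwise limits, and convergence of the totals excludes loss of
    mass. *)
Lemma hs_conv_tight (D : H -> H) (P_ : nat -> H -> H) P (t : nat -> R) s :
  (forall x, cvgH (P_ ^~ x) (P x)) -> hs_fin b D P ->
  (forall n, bsum_le (fun i => ip (P_ n (D (b i))) (P_ n (D (b i)))) (t n)) ->
  t @ \oo --> s ->
  (forall e, 0 < e -> exists2 F, uniq F &
     s - e <= \sum_(i <- F) ip (P (D (b i))) (P (D (b i)))) ->
  hs_conv b D P_ P.
Proof.
move=> Pc fP ht ts htight; apply: hs_conv_dom => //.
apply: (utail_tight _ _ ht ts htight); last by move=> n i; exact: ip_ge0.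
by move=> i; exact: cvgH_ip.
Qed.

End projections_convergence.

(** * The Hilbert space of square-integrable functions *)

Section complex_parts.
Context {R : realType}.
Implicit Types (z w : R[i]) (a : R).
Lemma cReD z w : complex.Re (z + w) = complex.Re z + complex.Re w.
Proof. by case: z; case: w. Qed.
Lemma cImD z w : complex.Im (z + w) = complex.Im z + complex.Im w.
Proof. by case: z; case: w. Qed.
Lemma cReN z : complex.Re (- z) = - complex.Re z.
Proof. by case: z. Qed.
Lemma cImN z : complex.Im (- z) = - complex.Im z.
Proof. by case: z. Qed.
Lemma cReM z w : complex.Re (z * w) =
  complex.Re z * complex.Re w - complex.Im z * complex.Im w.
Proof. by case: z; case: w. Qed.
Lemma cImM z w : complex.Im (z * w) =
  complex.Re z * complex.Im w + complex.Im z * complex.Re w.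
Proof. by case: z; case: w. Qed.
Lemma cReJ z : complex.Re (conjc z) = complex.Re z. Proof. by case: z. Qed.
Lemma cImJ z : complex.Im (conjc z) = - complex.Im z. Proof. by case: z. Qed.
Lemma cRe0 : complex.Re (0 : R[i]) = 0. Proof. by []. Qed.
Lemma cIm0 : complex.Im (0 : R[i]) = 0. Proof. by []. Qed.
Lemma complex_ext z w :
  complex.Re z = complex.Re w -> complex.Im z = complex.Im w -> z = w.
Proof. by case: z => a b; case: w => c d /= -> ->. Qed.
End complex_parts.
Definition ReImE := (@cReD, @cImD, @cReN, @cImN, @cReM, @cImM, @cReJ, @cImJ, @cRe0, @cIm0).

Section L2_functions.
Context d (T : measurableType d) (R : realType).
Variable mu : {measure set T -> \bar R}.
Implicit Types (f g h : T -> R[i]) (u : T -> R) (c : R[i]).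

Local Notation L2 := (L2 mu).

(** The real part of [f] times the conjugate of [g]. *)
Definition dotf f g (x : T) : R :=
  complex.Re (f x) * complex.Re (g x) + complex.Im (f x) * complex.Im (g x).

Definition rip f g : R := \int[mu]_x dotf f g x.

Definition smulf c f : T -> R[i] := fun x => c * f x.

Lemma dotf_ge0 f x : 0 <= dotf f f x.
Proof. by rewrite /dotf addr_ge0// -expr2 sqr_ge0. Qed.

Lemma measurable_dotf f g : cmeasurable f -> cmeasurable g ->
  measurable_fun setT (dotf f g).
Proof.
by move=> [? ?] [? ?]; apply: measurable_funD; exact: measurable_funM.
Qed.

Lemma L2norm_dotf f :
  L2norm mu f = ((\int[mu]_x (dotf f f x)%:E) `^ 2^-1)%E.
Proof.
rewrite /L2norm unlock /=; congr (poweR _ _); apply: eq_integral => x _.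
rewrite -poweR_EFin/= powR_mulrn//; congr EFin.
rewrite real_normK ?num_real// /dotf.
case: (f x) => a b /=.
by rewrite sqr_sqrtr ?addr_ge0 ?sqr_ge0// !expr2.
Qed.

Lemma L2P f : L2 f <-> cmeasurable f /\ mu.-integrable setT (EFin \o dotf f f).
Proof.
rewrite /Defs.L2/= L2norm_dotf; split=> -[mf h]; split=> //.
  apply/integrableP; split; first exact/measurable_EFinP/measurable_dotf.
  rewrite ltNge leye_eq; apply/negP => /eqP h1; move: h.
  rewrite (_ : (\int[mu]_x (dotf f f x)%:E)%E = +oo%E).
    by rewrite poweRyr// invr_neq0.
  rewrite -h1; apply: eq_integral => x _ /=.
  by rewrite ger0_norm// dotf_ge0.
apply: poweR_lty; move/integrableP : h => [_].
apply: le_lt_trans; rewrite le_eqVlt; apply/orP; left; apply/eqP.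
by apply: eq_integral => x _ /=; rewrite ger0_norm// dotf_ge0.
Qed.

Lemma rip_ge0 f : 0 <= rip f f.
Proof. by apply: Rintegral_ge0 => x _; exact: dotf_ge0. Qed.

Lemma integral_dotf f : L2 f -> (\int[mu]_x (dotf f f x)%:E)%E = (rip f f)%:E.
Proof.
by move=> /L2P[mf h]; rewrite /rip /Rintegral fineK//; exact: integrable_fin_num h.
Qed.

Lemma L2normE f : L2 f -> L2norm mu f = (Num.sqrt (rip f f))%:E.
Proof.
move=> Lf; rewrite L2norm_dotf integral_dotf// poweR_EFin powR12_sqrt//.
exact: rip_ge0.
Qed.

Lemma cmeasurableD f g : cmeasurable f -> cmeasurable g -> cmeasurable (f + g).
Proof.
move=> [f1 f2] [g1 g2]; split.
  rewrite (_ : (fun x => _) = (fun x => complex.Re (f x)) \+ (fun x => complex.Re (g x))).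
    exact: measurable_funD.
  by apply/funext => x; rewrite /= cReD.
rewrite (_ : (fun x => _) = (fun x => complex.Im (f x)) \+ (fun x => complex.Im (g x))).
  exact: measurable_funD.
by apply/funext => x; rewrite /= cImD.
Qed.

Lemma cmeasurableM f g : cmeasurable f -> cmeasurable g ->
  cmeasurable (fun x => f x * g x).
Proof.
move=> [f1 f2] [g1 g2]; split.
  rewrite (_ : (fun x => _) = (fun x => complex.Re (f x) * complex.Re (g x)) \-
      (fun x => complex.Im (f x) * complex.Im (g x))).
    by apply: measurable_funB; exact: measurable_funM.
  by apply/funext => x; rewrite /= cReM.
rewrite (_ : (fun x => _) = (fun x => complex.Re (f x) * complex.Im (g x)) \+
    (fun x => complex.Im (f x) * complex.Re (g x))).
  by apply: measurable_funD; exact: measurable_funM.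
by apply/funext => x; rewrite /= cImM.
Qed.

Lemma cmeasurable_cst c : cmeasurable (fun _ : T => c).
Proof. by split; exact: measurable_cst. Qed.

Lemma cmeasurableZ c f : cmeasurable f -> cmeasurable (smulf c f).
Proof. by apply: cmeasurableM; exact: cmeasurable_cst. Qed.

Lemma cmeasurable_fmul u f : measurable_fun setT u -> cmeasurable f ->
  cmeasurable (fmul u f).
Proof.
move=> mu' mf; apply: (@cmeasurableM (fun x => real_complex R (u x))) mf.
by split; [exact: mu'|exact: measurable_cst].
Qed.

Lemma L2_le f g k : cmeasurable f -> L2 g ->
  (forall x, dotf f f x <= k * dotf g g x) -> L2 f.
Proof.
move=> mf /L2P[mg ig] fg; apply/L2P; split=> //.
apply: (le_integrable measurableT _ _ (integrableZl measurableT k ig)).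
  exact/measurable_EFinP/measurable_dotf.
move=> x _ /=; rewrite lee_fin ger0_norm ?dotf_ge0//.
exact: le_trans (fg x) (ler_norm _).
Qed.

Lemma L2D f g : L2 f -> L2 g -> L2 (f + g).
Proof.
move=> /L2P[mf if_] /L2P[mg ig]; apply/L2P; split; first exact: cmeasurableD.
apply: (le_integrable measurableT _ _
  (integrableD measurableT (integrableZl measurableT 2 if_) (integrableZl measurableT 2 ig))).
  by apply/measurable_EFinP; apply: measurable_dotf; exact: cmeasurableD.
move=> x _ /=; rewrite lee_fin ger0_norm ?dotf_ge0//.
apply: le_trans (ler_norm _); rewrite /dotf /= !cReD !cImD.
move: (complex.Re (f x)) (complex.Im (f x))
  (complex.Re (g x)) (complex.Im (g x)) => a b a' b'.
have := sqr_ge0 (a - a'); have := sqr_ge0 (b - b'); rewrite !sqrrB; lra.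
Qed.

Lemma L2Z c f : L2 f -> L2 (smulf c f).
Proof.
move=> Lf; have [mf _] := (L2P f).1 Lf.
apply: (@L2_le _ f (complex.Re c ^+ 2 + complex.Im c ^+ 2) _ Lf) => [|x].
  exact: cmeasurableZ.
by rewrite /dotf /smulf cReM cImM; lra.
Qed.

Lemma L2N f : L2 f -> L2 (- f).
Proof.
move=> /(L2Z (-1)); rewrite (_ : smulf _ _ = - f)//.
by apply/funext => x; rewrite /smulf mulN1r.
Qed.

Lemma L2B f g : L2 f -> L2 g -> L2 (f - g).
Proof. by move=> Lf /L2N; exact: L2D. Qed.

Lemma L2_0 : L2 (fun=> 0).
Proof.
apply/L2P; split; first exact: cmeasurable_cst.
rewrite (_ : _ \o _ = cst 0%E); first exact: integrable0.
by apply/funext => x /=; rewrite /dotf cRe0 cIm0 mulr0 addr0.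
Qed.

Lemma L2_fmul u f : measurable_fun setT u -> (forall x, `|u x| <= 1) -> L2 f ->
  L2 (fmul u f).
Proof.
move=> mu' u1 Lf; have [mf _] := (L2P f).1 Lf.
apply: (@L2_le _ f 1 _ Lf) => [|x]; first exact: cmeasurable_fmul.
rewrite /dotf /fmul cReM cImM /= mul1r !mul0r subr0 addr0.
have : u x ^+ 2 <= 1 by rewrite -real_normK ?num_real// exprn_ile1.
move: (complex.Re (f x)) (complex.Im (f x)) => a b h.
have : u x ^+ 2 * (a * a + b * b) <= 1 * (a * a + b * b).
  by rewrite ler_wpM2r// addr_ge0// -expr2 sqr_ge0.
by rewrite /=; lra.
Qed.

Lemma dotf_integrable f g : L2 f -> L2 g -> mu.-integrable setT (EFin \o dotf f g).
Proof.
move=> /L2P[mf if_] /L2P[mg ig].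
apply: (le_integrable measurableT _ _ (integrableD measurableT if_ ig)).
  exact/measurable_EFinP/measurable_dotf.
move=> x _ /=; rewrite lee_fin (ger0_norm (_ : 0 <= dotf f f x + dotf g g x)); last first.
  by rewrite addr_ge0// dotf_ge0.
rewrite /dotf.
move: (complex.Re (f x)) (complex.Im (f x))
  (complex.Re (g x)) (complex.Im (g x)) => a b a' b'.
rewrite ler_norml; have := sqr_ge0 (a - a'); have := sqr_ge0 (b - b').
have := sqr_ge0 (a + a'); have := sqr_ge0 (b + b').
by rewrite !sqrrB !sqrrD => *; apply/andP; split; lra.
Qed.

Lemma ripC f g : rip f g = rip g f.
Proof.
by apply: eq_Rintegral => x _; rewrite /dotf mulrC [X in _ + X]mulrC.
Qed.

Lemma rip_linear (a : R) f g h : L2 f -> L2 g -> L2 h ->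
  rip (smulf (real_complex R a) f + g) h = a * rip f h + rip g h.
Proof.
move=> Lf Lg Lh; have i1 := dotf_integrable Lf Lh; have i2 := dotf_integrable Lg Lh.
have i3 : mu.-integrable setT (EFin \o (fun x => a * dotf f h x)).
  exact: (integrableZl measurableT a i1).
rewrite /rip -RintegralZl// -RintegralD//.
apply: eq_Rintegral => x _; rewrite /dotf /smulf/= !ReImE /=; lra.
Qed.

Lemma rip_eq0 f : L2 f -> rip f f = 0 -> f = (fun=> 0) %[ae mu].
Proof.
move=> Lf f0; have [mf _] := (L2P f).1 Lf.
have h := integral_dotf Lf; rewrite f0 in h.
have /(ae_eq_integral_abs mu measurableT) [h1 _] :
    measurable_fun setT (EFin \o dotf f f) by exact/measurable_EFinP/measurable_dotf.
have {}h1 : ae_eq mu setT (EFin \o dotf f f) (cst 0%E).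
  apply: h1; rewrite (_ : 0%E = (0 : R)%:E)// -h; apply: eq_integral => x _ /=.
  by rewrite ger0_norm// dotf_ge0.
apply: filterS h1 => x h1x _; have [h2] := h1x I; move: h2.
rewrite /dotf -!expr2 => /eqP.
rewrite paddr_eq0 ?sqr_ge0// !sqrf_eq0 => /andP[/eqP r /eqP i].
exact: complex_ext.
Qed.

Lemma rip_ae f f' g g' : L2 f -> L2 f' -> L2 g -> L2 g' ->
  f = f' %[ae mu] -> g = g' %[ae mu] -> rip f g = rip f' g'.
Proof.
move=> Lf Lf' Lg Lg' ff gg; rewrite /rip /Rintegral; congr fine.
apply: ae_eq_integral => //.
- by have /integrableP[] := dotf_integrable Lf Lg.
- by have /integrableP[] := dotf_integrable Lf' Lg'.
- by apply: filterS2 ff gg => x fx gx _; rewrite /= /dotf fx// gx.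
Qed.

(** The imaginary part of a complex inner product is the real inner product with i times the second
    argument, so the real structure and multiplication by i recover everything. *)
Lemma inner_rip f g :
  inner mu f g = Complex (rip f g) (rip f (smulf 'i%C g)).
Proof.
rewrite /inner /rip; congr Complex; apply: eq_Rintegral => x _.
  by rewrite /dotf !ReImE; lra.
by rewrite /dotf /smulf !ReImE /=; lra.
Qed.

End L2_functions.

(** * Completeness of L_2 *)

Section riesz_fischer.
Context d (T : measurableType d) (R : realType).
Variable mu : {measure set T -> \bar R}.
Local Notation L2 := (L2 mu).
Local Notation rip := (rip mu).

Lemma geometric_increments_cvg (a : nat -> R) (c : R) : 0 <= c ->
  (forall k, `|a k.+1 - a k| <= c * 2^-1 ^+ k) -> cvgn a.
Proof.
move=> c0 h.
have s1 : cvgn (series (telescope a)).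
  apply: normed_cvg.
  apply: (@series_le_cvg R _ (fun k => c * 2^-1 ^+ k)) .
  - by move=> n; exact: normr_ge0.
  - by move=> n; apply: mulr_ge0 => //; rewrite exprn_ge0// invr_ge0.
  - by move=> n; exact: h.
  - apply: (@is_cvg_geometric_series R c 2^-1).
    by rewrite ger0_norm ?invr_ge0// invf_lt1// ltr1n.
have e : a = (fun n => a 0%N + series (telescope a) n).
  by apply/funext => n; exact: eq_sum_telescope.
by rewrite e; apply: is_cvgD => //; exact: is_cvg_cst.
Qed.

Lemma limn_einf_le (f : nat -> \bar R) (e : \bar R) :
  (forall n, (f n <= e)%E) -> (limn_einf f <= e)%E.
Proof.
move=> fe; rewrite limn_einf_lim; apply: lime_le; first exact: is_cvg_einfs.
apply: nearW => n; apply: le_trans (fe n).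
by apply: ereal_inf_lbound; exists n => /=.
Qed.

Lemma rip_fatou (w : nat -> T -> R[i]) (f l : T -> R[i]) (e : R) :
  L2 f -> (forall k, L2 (w k)) -> cmeasurable l ->
  (forall x, (fun k => complex.Re (w k x)) @ \oo --> complex.Re (l x)) ->
  (forall x, (fun k => complex.Im (w k x)) @ \oo --> complex.Im (l x)) ->
  (forall k, rip (f - w k) (f - w k) <= e) ->
  L2 (f - l) /\ rip (f - l) (f - l) <= e.
Proof.
move=> Lf Lw ml rec imc we.
have [mf _] := (L2P mu f).1 Lf.
have Lfw k : L2 (f - w k) by exact: L2B.
have mfl : cmeasurable (f - l).
  apply: cmeasurableD => //; rewrite (_ : - l = smulf (-1) l); first exact: cmeasurableZ.
  by apply/funext => x; rewrite /smulf mulN1r.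
have dc x : (fun k => (dotf (f - w k) (f - w k) x)%:E) @ \oo --> (dotf (f - l) (f - l) x)%:E.
  apply: cvg_EFin; first exact: nearW.
  rewrite /dotf /=.
  have rc : (fun k => complex.Re (f x - w k x)) @ \oo --> complex.Re (f x - l x).
    rewrite cReD cReN; under eq_fun do rewrite cReD cReN.
    by apply: cvgB => //; exact: cvg_cst.
  have ic : (fun k => complex.Im (f x - w k x)) @ \oo --> complex.Im (f x - l x).
    rewrite cImD cImN; under eq_fun do rewrite cImD cImN.
    by apply: cvgB => //; exact: cvg_cst.
  exact: cvgD (cvgM rc rc) (cvgM ic ic).
have h : (\int[mu]_x (dotf (f - l) (f - l) x)%:E <= e%:E)%E.
  have -> : (\int[mu]_x (dotf (f - l) (f - l) x)%:E =
    \int[mu]_x limn_einf (fun k => (dotf (f - w k) (f - w k) x)%:E))%E.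
    apply: eq_integral => x _; have [-> _] := cvg_limn_einf_sup (dc x).
    by [].
  apply: (@le_trans _ _ (limn_einf (fun k =>
      \int[mu]_x (dotf (f - w k) (f - w k) x)%:E))%E).
    apply: fatou => // [k|k x _].
      by apply/measurable_EFinP/measurable_dotf; have [] := (L2P mu _).1 (Lfw k).
    by rewrite lee_fin dotf_ge0.
  by apply: limn_einf_le => k; rewrite integral_dotf// lee_fin.
have Lfl : L2 (f - l).
  apply/L2P; split=> //; apply/integrableP; split.
    exact/measurable_EFinP/measurable_dotf.
  apply: le_lt_trans (ltry e); apply: le_trans h.
  rewrite le_eqVlt; apply/orP; left; apply/eqP.
  by apply: eq_integral => x _ /=; rewrite ger0_norm// dotf_ge0.
by split=> //; rewrite -lee_fin -integral_dotf.
Qed.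

(** A fast subsequence converges pointwise off a null set, and Fatou's lemma upgrades this to
    convergence in norm of the whole sequence. *)
Lemma L2_complete (u : nat -> T -> R[i]) : (forall n, L2 (u n)) ->
  (forall e : R, 0 < e -> exists N, forall m n, (N <= m)%N -> (N <= n)%N ->
     rip (u m - u n) (u m - u n) <= e) ->
  exists2 l, L2 l & forall e : R, 0 < e -> exists N, forall n, (N <= n)%N ->
     rip (u n - l) (u n - l) <= e.
Proof.
move=> Lu uC.
have /choice[N hN] : forall k : nat, exists N, forall m n, (N <= m)%N -> (N <= n)%N ->
    rip (u m - u n) (u m - u n) <= 8^-1 ^+ k.
  by move=> k; apply: uC; rewrite exprn_gt0// invr_gt0.
(* Nondecreasing in k and at least both [N k] and [k]. *)
pose nk k := (\sum_(j < k.+1) N j + k)%N.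
have nkN k : (N k <= nk k)%N by rewrite /nk big_ord_recr/= -addnA addnCA leq_addr.
have nkS k : (nk k <= nk k.+1)%N.
  by rewrite /nk [X in (_ <= X + _)%N]big_ord_recr/= leq_add// leq_addr.
have nkk k : (k <= nk k)%N by rewrite /nk leq_addl.
pose v k := u (nk k).
have Lv k : L2 (v k) by exact: Lu.
pose dk k := v k.+1 - v k.
have Ld k : L2 (dk k) by exact: L2B.
have dke k : rip (dk k) (dk k) <= 8^-1 ^+ k.
  by apply: hN => //; exact: leq_trans (nkN k) (nkS k).
(* The weights [4^k] against increments of squared norm [8^-k] leave a total integral of at most 2;
   where the sum is finite, [|dk k x|] decays like [2^-k]. *)
pose S K x : R := \sum_(k < K) 4 ^+ k * dotf (dk k) (dk k) x.
have mS K : measurable_fun setT (S K).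
  rewrite /S; apply: measurable_sum => k; apply: measurable_funM => //.
  by apply: measurable_dotf; have [] := (L2P mu _).1 (Ld k).
have S0 K x : 0 <= S K x.
  by apply: sumr_ge0 => k _; rewrite mulr_ge0 ?exprn_ge0// dotf_ge0.
have nS x : nondecreasing_seq (fun K => (S K x)%:E).
  apply/nondecreasing_seqP => K; rewrite lee_fin /S big_ord_recr/= lerDl.
  by rewrite mulr_ge0 ?exprn_ge0// dotf_ge0.
have IS K : (\int[mu]_x (S K x)%:E <= (2 : R)%:E)%E.
  have iS : (\int[mu]_x (S K x)%:E = (\sum_(k < K) 4 ^+ k * rip (dk k) (dk k))%:E)%E.
    elim: K => [|K IH].
      rewrite big_ord0; under eq_integral do rewrite /S big_ord0.
      by rewrite integral0.
    rewrite big_ord_recr/= EFinD -IH.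
    have -> : (\int[mu]_x (S K.+1 x)%:E = \int[mu]_x ((S K x)%:E +
        ((4 ^+ K)%:E * (dotf (dk K) (dk K) x)%:E)))%E.
      by apply: eq_integral => x _; rewrite /S big_ord_recr/=.
    have md : measurable_fun setT (fun x => (dotf (dk K) (dk K) x)%:E).
      by apply/measurable_EFinP/measurable_dotf; have [] := (L2P mu _).1 (Ld K).
    have a1 x : setT x -> (0 <= (S K x)%:E)%E by move=> _; rewrite lee_fin.
    have a2 : measurable_fun setT (fun x => (S K x)%:E) by exact/measurable_EFinP.
    have a3 x : setT x -> (0 <= (dotf (dk K) (dk K) x)%:E)%E.
      by move=> _; rewrite lee_fin dotf_ge0.
    have a4 : (0 <= (4 ^+ K : R)%:E)%E by rewrite lee_fin exprn_ge0.
    have a5 x : setT x -> (0 <= (4 ^+ K : R)%:E * (dotf (dk K) (dk K) x)%:E)%E.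
      by move=> ?; rewrite mule_ge0// a3.
    have a6 : measurable_fun setT
        (fun x => (4 ^+ K : R)%:E * (dotf (dk K) (dk K) x)%:E)%E.
      exact: emeasurable_funM.
    by rewrite (ge0_integralD mu measurableT a1 a2 a5 a6)
      (ge0_integralZl mu measurableT md a3 a4) integral_dotf.
  have geo n : \sum_(k < n) (2^-1 : R) ^+ k = 2 - 2 * 2^-1 ^+ n.
    elim: n => [|n IH]; first by rewrite big_ord0 expr0; lra.
    by rewrite big_ord_recr/= IH exprS; field.
  rewrite iS lee_fin.
  apply: (@le_trans _ _ (\sum_(k < K) (2^-1 : R) ^+ k)).
    apply: ler_sum => k _; apply: le_trans (ler_wpM2l _ (dke k)) _.
      by rewrite exprn_ge0.
    by rewrite -exprMn le_eqVlt; apply/orP; left; apply/eqP; congr (_ ^+ _); field.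
  rewrite geo; have : 0 <= 2^-1 ^+ K :> R by rewrite exprn_ge0// invr_ge0.
  lra.
pose F x := limn (fun K => (S K x)%:E).
have mF : measurable_fun setT F.
  apply: (emeasurable_fun_cvg (fun K x => (S K x)%:E)) => [K|x _].
    exact/measurable_EFinP.
  exact: ereal_nondecreasing_is_cvgn.
have SF K x : ((S K x)%:E <= F x)%E.
  rewrite /F (cvg_lim _ (ereal_nondecreasing_cvgn (nS x)))//.
  by apply: ereal_sup_ubound; exists K.
have F0 x : (0 <= F x)%E.
  by apply: le_trans (SF 0%N x); rewrite lee_fin.
have IF : (\int[mu]_x F x <= (2 : R)%:E)%E.
  have c : (fun K => \int[mu]_x (S K x)%:E)%E @ \oo --> (\int[mu]_x F x)%E.
    apply: cvg_monotone_convergence => //.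
    - by move=> K; exact/measurable_EFinP.
    - by move=> K x _; rewrite lee_fin.
  have e := cvg_lim (@ereal_hausdorff R) c; rewrite -e.
  by apply: lime_le; [exact: cvgP c|exact: nearW].
have iF : mu.-integrable setT F.
  apply/integrableP; split=> //; apply: le_lt_trans (ltry 2).
  apply: le_trans IF; rewrite le_eqVlt; apply/orP; left; apply/eqP.
  by apply: eq_integral => x _; rewrite gee0_abs.
have aeF : {ae mu, forall x, (F x < +oo)%E}.
  have := integrable_ae measurableT iF; apply: filterS => x h.
  by have := h I; rewrite ge0_fin_numE.
pose A := [set x | (F x < +oo)%E].
have mA : measurable A.
  by rewrite -[A]setTI; exact: emeasurable_fun_infty_o.
(* Set to 0 on the null set where the sum diverges, so that the limit exists everywhere and is
   measurable. *)
pose w k := fmul (\1_A) (v k).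
have wv k : w k = v k %[ae mu].
  apply: filterS aeF => x Fx _; rewrite /w /fmul indicE mem_set//.
  by rewrite rmorph1 mul1r.
have m1 : measurable_fun setT (\1_A : T -> R) by exact: measurable_indic.
have Lw k : L2 (w k).
  by apply: L2_fmul => // x; rewrite indicE ger0_norm// lern1 leq_b1.
(* The bound [F <= (1 + F)^2] makes the right side a perfect square, so that no square root of [F]
   is needed. *)
have incr x k : A x -> dotf (dk k) (dk k) x <= (1 + fine (F x)) ^+ 2 * 2^-1 ^+ k ^+ 2.
  rewrite /A/= => Ax; have Ff : F x \is a fin_num by rewrite ge0_fin_numE.
  have f0 : 0 <= fine (F x) by rewrite -lee_fin fineK.
  have h1 : 4 ^+ k * dotf (dk k) (dk k) x <= fine (F x).
    rewrite -lee_fin fineK//; apply: le_trans (SF k.+1 x); rewrite lee_fin.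
    rewrite /S big_ord_recr/= lerDr sumr_ge0// => j _.
    by rewrite mulr_ge0 ?exprn_ge0// dotf_ge0.
  have -> : 2^-1 ^+ k ^+ 2 = (4 ^+ k)^-1 :> R.
    by rewrite -exprM mulnC exprM -exprVn; congr (_ ^+ _); field.
  rewrite ler_pdivlMr ?exprn_gt0// mulrC; apply: le_trans h1 _.
  rewrite sqrrD; have := sqr_ge0 (fine (F x)); lra.
have absle (a b c : R) : 0 <= c -> a * a + b * b <= c ^+ 2 -> `|a| <= c /\ `|b| <= c.
  move=> c0 h; rewrite -!(ler_sqr (normr_ge0 _) c0) !real_normK ?num_real//.
  by have := sqr_ge0 a; have := sqr_ge0 b; split; lra.
have cvgRI x : cvgn (fun k => complex.Re (w k x)) /\ cvgn (fun k => complex.Im (w k x)).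
  have [Ax|Ax] := pselect (A x); last first.
    have w0 k : w k x = 0 by rewrite /w /fmul indicE memNset// rmorph0 mul0r.
    by split; under eq_fun do rewrite w0; exact: is_cvg_cst.
  have wx k : w k x = v k x by rewrite /w /fmul indicE mem_set// rmorph1 mul1r.
  have Ff : F x \is a fin_num by rewrite ge0_fin_numE.
  have f0 : 0 <= fine (F x) by rewrite -lee_fin fineK.
  pose c : R := 1 + fine (F x).
  have c0 : 0 <= c by rewrite /c addr_ge0.
  have h k : `|complex.Re (dk k x)| <= c * 2^-1 ^+ k /\
      `|complex.Im (dk k x)| <= c * 2^-1 ^+ k.
    apply: absle; first by rewrite mulr_ge0// exprn_ge0// invr_ge0.
    by rewrite exprMn; exact: incr.
  split; apply: (geometric_increments_cvg c0) => k; rewrite !wx.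
    by have [+ _] := h k; rewrite /dk/= cReD cReN.
  by have [_ +] := h k; rewrite /dk/= cImD cImN.
pose l x := Complex (limn (fun k => complex.Re (w k x))) (limn (fun k => complex.Im (w k x))).
have ml : cmeasurable l.
  have mw k : cmeasurable (w k) by have [] := (L2P mu _).1 (Lw k).
  split.
    apply: (measurable_fun_cvg (h := fun k x => complex.Re (w k x))) => [k|x _].
      by have [] := mw k.
    exact: (cvgRI x).1.
  apply: (measurable_fun_cvg (h := fun k x => complex.Im (w k x))) => [k|x _].
    by have [] := mw k.
  exact: (cvgRI x).2.
have main n e : (forall k, (n <= k)%N -> rip (u n - u k) (u n - u k) <= e) ->
    L2 (u n - l) /\ rip (u n - l) (u n - l) <= e.
  (* The shift by [n] guarantees that all subsequence indices are at least [n]. *)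
  move=> he; apply: (@rip_fatou (fun k => w (k + n)%N)) => // [x|x|k].
  - by rewrite (cvg_shiftn n (fun k => complex.Re (w k x))); exact: (cvgRI x).1.
  - by rewrite (cvg_shiftn n (fun k => complex.Im (w k x))); exact: (cvgRI x).2.
  - have nv : (u n - w (k + n)%N) = (u n - v (k + n)%N) %[ae mu].
      apply: filterS (wv (k + n)%N) => x h _.
      by rewrite (_ : (u n - w (k + n)%N) x = u n x - w (k + n)%N x)// (h I).
    rewrite (rip_ae _ _ _ _ nv nv); try exact: L2B.
    by apply: he; apply: leq_trans (nkk _); rewrite leq_addl.
have [N0 hN0] := uC 1 ltr01.
have Ll : L2 l.
  have [h _] := main N0 1 (fun k Nk => hN0 _ _ (leqnn _) Nk).
  by rewrite -(subKr (u N0) l); exact: L2B.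
exists l => // e e0; have [M hM] := uC e e0; exists M => n Mn.
by apply: (main n e _).2 => k nk'; apply: hM => //; exact: leq_trans nk'.
Qed.

End riesz_fischer.

(** * The quotient by equality almost everywhere *)

Section L2_quotient.
Context d (T : measurableType d) (R : realType).
Variable mu : {measure set T -> \bar R}.
Implicit Types (f g h : T -> R[i]).
Local Notation L2 := (L2 mu).

Lemma aeq_refl f : f = f %[ae mu].
Proof. exact: ae_eq_refl. Qed.
Lemma aeq_sym f g : f = g %[ae mu] -> g = f %[ae mu].
Proof. exact: ae_eq_sym. Qed.
Lemma aeq_trans f g h : f = g %[ae mu] -> g = h %[ae mu] -> f = h %[ae mu].
Proof. exact: ae_eq_trans. Qed.

(* The elements of the Hilbert space are canonical representatives of the
   classes of square-integrable functions, so that equality is Leibniz. *)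
Definition canon f : T -> R[i] :=
  xget (fun=> 0) [set h | L2 h /\ h = f %[ae mu]].

Lemma canonP f : L2 f -> L2 (canon f) /\ canon f = f %[ae mu].
Proof.
move=> Lf; apply: (@xgetPex _ (fun=> 0) [set h | L2 h /\ h = f %[ae mu]]).
by exists f; split=> //; exact: aeq_refl.
Qed.

Lemma canon_eq f g : f = g %[ae mu] -> canon f = canon g.
Proof.
move=> fg; rewrite /canon; congr xget; apply/seteqP; split=> h /= [Lh hf]; split=> //.
  exact: aeq_trans hf fg.
exact: aeq_trans hf (aeq_sym fg).
Qed.

Record L2q := MkL2q { rep :> T -> R[i] ; rep_L2 : L2 rep ; rep_canon : canon rep = rep }.

Lemma rep_inj : injective rep.
Proof.
move=> [f Lf cf] [g Lg cg] /= fg; subst g.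
by rewrite (Prop_irrelevance Lf Lg) (Prop_irrelevance cf cg).
Qed.

HB.instance Definition _ := gen_eqMixin L2q.
HB.instance Definition _ := gen_choiceMixin L2q.

(** Makes [cls] total; functions outside [L2] are sent to the class of 0. *)
Definition L2part f := if pselect (L2 f) then f else fun=> 0.

Lemma L2_part f : L2 (L2part f).
Proof. by rewrite /L2part; case: pselect => //= b; exact: L2_0. Qed.

Lemma canon_canon f : canon (canon (L2part f)) = canon (L2part f).
Proof. by apply: canon_eq; exact: (canonP (L2_part f)).2. Qed.

Definition cls f : L2q := MkL2q (canonP (L2_part f)).1 (canon_canon f).

Lemma L2partE f : L2 f -> L2part f = f.
Proof. by rewrite /L2part; case: pselect. Qed.

Lemma rep_cls f : L2 f -> rep (cls f) = f %[ae mu].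
Proof. by move=> Lf; have [_] := canonP Lf; rewrite /= L2partE. Qed.

Lemma cls_rep (x : L2q) : cls x = x.
Proof. by apply: rep_inj; rewrite /= L2partE ?rep_canon//; exact: rep_L2. Qed.

Lemma cls_eq f g : L2 f -> L2 g -> f = g %[ae mu] -> cls f = cls g.
Proof. by move=> Lf Lg fg; apply: rep_inj; rewrite /= !L2partE//; exact: canon_eq. Qed.

Lemma cls_eqP f g : L2 f -> L2 g -> cls f = cls g -> f = g %[ae mu].
Proof.
move=> Lf Lg fg; apply: aeq_trans (aeq_sym (rep_cls Lf)) _.
by rewrite fg; exact: rep_cls.
Qed.

Definition addq (x y : L2q) : L2q := cls (rep x + rep y).
Definition oppq (x : L2q) : L2q := cls (- rep x).
Definition scaleq (a : R) (x : L2q) : L2q := cls (smulf (real_complex R a) (rep x)).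

Lemma cls_add f g : L2 f -> L2 g -> cls (f + g) = addq (cls f) (cls g).
Proof.
move=> Lf Lg; apply: cls_eq; [exact: L2D|by apply: L2D; exact: rep_L2|].
apply: filterS2 (rep_cls Lf) (rep_cls Lg) => x fx gx _.
by rewrite !fctE fx// gx.
Qed.

Lemma cls_opp f : L2 f -> cls (- f) = oppq (cls f).
Proof.
move=> Lf; apply: cls_eq; [exact: L2N|by apply: L2N; exact: rep_L2|].
by apply: filterS (rep_cls Lf) => x fx _; rewrite !fctE fx.
Qed.

Lemma cls_scale a f : L2 f -> cls (smulf (real_complex R a) f) = scaleq a (cls f).
Proof.
move=> Lf; apply: cls_eq; [exact: L2Z|by apply: L2Z; exact: rep_L2|].
by apply: filterS (rep_cls Lf) => x fx _; rewrite /smulf fx.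
Qed.

Lemma clsP (x : L2q) : exists2 f, L2 f & x = cls f.
Proof. by exists (rep x); [exact: rep_L2|rewrite cls_rep]. Qed.

Lemma addqA : associative addq.
Proof.
move=> x y z; have [f Lf ->] := clsP x; have [g Lg ->] := clsP y.
have [h Lh ->] := clsP z.
by rewrite -!cls_add ?addrA//; exact: L2D.
Qed.
Lemma addqC : commutative addq.
Proof. by move=> x y; rewrite /addq addrC. Qed.
Lemma add0q : left_id (cls (fun=> 0)) addq.
Proof.
move=> x; have [f Lf ->] := clsP x; rewrite -cls_add//; last exact: L2_0.
by congr cls; apply/funext => t; rewrite !fctE add0r.
Qed.
Lemma addNq : left_inverse (cls (fun=> 0)) oppq addq.
Proof.
move=> x; have [f Lf ->] := clsP x; rewrite -cls_opp// -cls_add//; last exact: L2N.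
by congr cls; apply/funext => t; rewrite !fctE addNr.
Qed.

HB.instance Definition _ := GRing.isZmodule.Build L2q addqA addqC add0q addNq.

Lemma scaleqA a b x : scaleq a (scaleq b x) = scaleq (a * b) x.
Proof.
have [f Lf ->] := clsP x; rewrite -!cls_scale//; last exact: L2Z.
by congr cls; apply/funext => t; rewrite /smulf rmorphM mulrA.
Qed.
Lemma scale1q : left_id 1 scaleq.
Proof.
move=> x; have [f Lf ->] := clsP x; rewrite -cls_scale//.
by congr cls; apply/funext => t; rewrite /smulf rmorph1 mul1r.
Qed.
Lemma scaleqDr : right_distributive scaleq +%R.
Proof.
move=> a x y; have [f Lf ->] := clsP x; have [g Lg ->] := clsP y.
rewrite -[cls f + cls g]cls_add// -!cls_scale//; last exact: L2D.
rewrite -[RHS]cls_add; try exact: L2Z.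
by congr cls; apply/funext => t; rewrite /smulf !fctE mulrDr.
Qed.
Lemma scaleqDl x : {morph scaleq^~ x : a b / a + b}.
Proof.
move=> a b; have [f Lf ->] := clsP x; rewrite -!cls_scale//.
rewrite -[RHS]cls_add; try exact: L2Z.
by congr cls; apply/funext => t; rewrite /smulf !fctE rmorphD mulrDl.
Qed.

HB.instance Definition _ :=
  GRing.Zmodule_isLmodule.Build R L2q scaleqA scale1q scaleqDr scaleqDl.

Lemma clsD f g : L2 f -> L2 g -> cls (f + g) = cls f + cls g.
Proof. exact: cls_add. Qed.
Lemma clsN f : L2 f -> cls (- f) = - cls f.
Proof. exact: cls_opp. Qed.
Lemma clsB f g : L2 f -> L2 g -> cls (f - g) = cls f - cls g.
Proof. by move=> Lf Lg; rewrite clsD ?clsN//; exact: L2N. Qed.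
Lemma clsZ a f : L2 f -> cls (smulf (real_complex R a) f) = a *: cls f.
Proof. exact: cls_scale. Qed.
Lemma cls0 : cls (fun=> 0) = 0. Proof. by []. Qed.

Definition ipq (x y : L2q) : R := rip mu (rep x) (rep y).

Lemma ipq_cls f g : L2 f -> L2 g -> ipq (cls f) (cls g) = rip mu f g.
Proof.
move=> Lf Lg; apply: rip_ae => //; try exact: rep_L2; exact: rep_cls.
Qed.

Lemma ipqC x y : ipq x y = ipq y x.
Proof. exact: ripC. Qed.

Lemma ipq_linear a x y z : ipq (a *: x + y) z = a * ipq x z + ipq y z.
Proof.
have [f Lf ->] := clsP x; have [g Lg ->] := clsP y; have [h Lh ->] := clsP z.
rewrite -clsZ// -clsD//; last exact: L2Z.
by rewrite !ipq_cls ?rip_linear//; apply: L2D => //; exact: L2Z.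
Qed.

Lemma ipq_ge0 x : 0 <= ipq x x. Proof. exact: rip_ge0. Qed.

Lemma ipq_eq0 x : ipq x x = 0 -> x = 0.
Proof.
move=> /(rip_eq0 (rep_L2 x)) h; rewrite -[LHS]cls_rep -cls0.
by apply: cls_eq => //; [exact: rep_L2|exact: L2_0].
Qed.

Lemma ipq_complete (u : nat -> L2q) :
  (forall e, 0 < e -> exists N, forall m n, (N <= m)%N -> (N <= n)%N ->
     ipq (u m - u n) (u m - u n) <= e) ->
  exists l, forall e, 0 < e -> exists N, forall n, (N <= n)%N ->
     ipq (u n - l) (u n - l) <= e.
Proof.
move=> uC.
have uB (x y : L2q) : ipq (x - y) (x - y) = rip mu (rep x - rep y) (rep x - rep y).
  rewrite -{1 2}(cls_rep x) -{1 2}(cls_rep y) -clsB; try exact: rep_L2.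
  by rewrite ipq_cls//; apply: L2B; exact: rep_L2.
have [|e e0|l Ll hl] := @L2_complete _ _ _ mu (fun n => rep (u n)).
- by move=> n; exact: rep_L2.
- have [N hN] := uC e e0; exists N => m n Nm Nn.
  by rewrite -uB; exact: hN.
exists (cls l) => e e0; have [N hN] := hl e e0; exists N => n Nn.
rewrite -(cls_rep (u n)) -clsB//; last exact: rep_L2.
by rewrite ipq_cls ?hN//; apply: L2B => //; exact: rep_L2.
Qed.

Definition L2hilbert : hilbert R :=
  @Hilbert R L2q ipq ipqC ipq_linear ipq_ge0 ipq_eq0 ipq_complete.

End L2_quotient.

#[local] Opaque cls addq oppq scaleq ipq.

Section complex_structure.
Context {R : realType} {H : hilbert R} (A J : H -> H).
Hypotheses (Al : lin A) (Jl : lin J) (Jskew : forall x y, ip (J x) y = - ip x (J y)).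
Hypotheses (JJ : forall x, J (J x) = - x) (AJ : forall x, A (J x) = J (A x)).

(** With [J] as multiplication by i, the hypothesis says that the complex form [<A x, x>] is real;
    polarisation at [x + J y] turns this into symmetry. *)
Lemma real_form_sym : (forall x, ip (A x) (J x) = 0) -> symop A.
Proof.
move=> h x y.
have hxy : ip (A x) (J (J y)) + ip (A (J y)) (J x) = 0.
  have := h (x + J y).
  by rewrite (linD Al) (linD Jl) !(ipDl, ipDr) h (h (J y)); lra.
move: hxy; rewrite JJ AJ Jskew JJ !ipNr (ipC x); lra.
Qed.

Lemma sym_real_form x : symop A -> ip (A x) (J x) = 0.
Proof. by move=> As; have := As x (J x); rewrite AJ -[RHS]opprK -Jskew (ipC (J x)); lra. Qed.

End complex_structure.

Lemma Complex_Re {R : realType} (a b c d : R) :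
  Complex a b = Complex c d -> a = c.
Proof. by case. Qed.

(** * Operators on functions and operators on classes *)

Section L2_operators.
Context d (T : measurableType d) (R : realType).
Variable mu : {measure set T -> \bar R}.
Implicit Types (f g h : T -> R[i]) (u : T -> R).
Implicit Types (K A P : (T -> R[i]) -> (T -> R[i])).
Local Notation L2 := (L2 mu).
Local Notation H := (L2hilbert mu).
Local Notation cls := (cls mu : (T -> R[i]) -> H).

Lemma ip_cls f g : L2 f -> L2 g -> ip (cls f) (cls g) = rip mu f g.
Proof. exact: ipq_cls. Qed.

Lemma L2norm_cls f : L2 f -> L2norm mu f = (nrm (cls f))%:E.
Proof. by move=> Lf; rewrite L2normE// /nrm ip_cls. Qed.

Definition Jq (x : H) : H := cls (smulf 'i%C (rep x)).

Lemma Jq_cls f : L2 f -> Jq (cls f) = cls (smulf 'i%C f).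
Proof.
move=> Lf; apply: cls_eq; [apply: L2Z; exact: rep_L2|exact: L2Z|].
by apply: filterS (rep_cls Lf) => x h _; rewrite /smulf h.
Qed.

Lemma Jq_lin : lin Jq.
Proof.
move=> a x y; have [f Lf ->] := clsP x; have [g Lg ->] := clsP y.
rewrite -[a *: _]clsZ// -clsD//; last exact: L2Z.
rewrite !Jq_cls//; last by apply: L2D => //; exact: L2Z.
rewrite -[in RHS]clsZ; last exact: L2Z.
rewrite -clsD; [|by do 2 apply: L2Z|exact: L2Z].
congr cls; apply/funext => t; rewrite /smulf !fctE mulrDr; congr (_ + _).
exact: mulrCA.
Qed.

Lemma JqJq x : Jq (Jq x) = - x.
Proof.
have [f Lf ->] := clsP x; rewrite !Jq_cls//; last exact: L2Z.
rewrite -clsN//; congr cls; apply/funext => t; rewrite /smulf !fctE mulrA.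
by rewrite -expr2 sqr_i mulN1r.
Qed.

Lemma ip_Jq (x y : H) : ip (Jq x) y = - ip x (Jq y).
Proof.
have [f Lf ->] := clsP x; have [g Lg ->] := clsP y.
rewrite !Jq_cls// !ip_cls//; try exact: L2Z.
have ifg := dotf_integrable Lf (L2Z 'i%C Lg).
rewrite -mulN1r /rip -RintegralZl//.
by apply: eq_Rintegral => t _; rewrite /dotf /smulf !ReImE /=; lra.
Qed.

Lemma ip_JqJq (x y : H) : ip (Jq x) (Jq y) = ip x y.
Proof. by rewrite ip_Jq JqJq ipNr opprK. Qed.

Lemma ip_xJx (x : H) : ip x (Jq x) = 0.
Proof. by have := ip_Jq x x; rewrite (ipC (Jq x) x); lra. Qed.

Lemma Jq_bnd : bnd Jq 1.
Proof. by move=> x; rewrite mul1r nrm_ip ip_JqJq. Qed.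

Lemma cls_smulf (c : R[i]) f : L2 f ->
  cls (smulf c f) = complex.Re c *: cls f + complex.Im c *: Jq (cls f).
Proof.
move=> Lf; rewrite Jq_cls// -clsZ// -clsZ; last exact: L2Z.
rewrite -clsD; try by repeat apply: L2Z.
congr cls; apply/funext => t; rewrite /smulf !fctE mulrA -mulrDl; congr (_ * _).
by apply: complex_ext; rewrite !ReImE /=; lra.
Qed.

Lemma inner_cls f g : L2 f -> L2 g ->
  inner mu f g = Complex (ip (cls f) (cls g)) (ip (cls f) (Jq (cls g))).
Proof.
by move=> Lf Lg; rewrite inner_rip Jq_cls// !ip_cls//; exact: L2Z.
Qed.

Definition mulq u (x : H) : H := cls (fmul u (rep x)).

Definition contraction_fun u := measurable_fun setT u /\ forall x, `|u x| <= 1.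

Lemma L2_cfmul u f : contraction_fun u -> L2 f -> L2 (fmul u f).
Proof. by move=> [mu1 u1]; exact: L2_fmul. Qed.

Lemma mulq_cls u f : contraction_fun u -> L2 f -> mulq u (cls f) = cls (fmul u f).
Proof.
move=> cu Lf; apply: cls_eq; [by apply: L2_cfmul => //; exact: rep_L2|exact: L2_cfmul|].
by apply: filterS (rep_cls Lf) => x h _; rewrite /fmul h.
Qed.

Lemma mulq_sym u : contraction_fun u -> symop (mulq u).
Proof.
move=> cu x y; have [f Lf ->] := clsP x; have [g Lg ->] := clsP y.
rewrite (mulq_cls cu Lf) (mulq_cls cu Lg).
rewrite (ip_cls (L2_cfmul cu Lf) Lg) (ip_cls Lf (L2_cfmul cu Lg)).
by apply: eq_Rintegral => t _; rewrite /dotf /fmul !ReImE /=; lra.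
Qed.

Lemma mulq_comm u v : contraction_fun u -> contraction_fun v ->
  forall x, mulq u (mulq v x) = mulq v (mulq u x).
Proof.
move=> cu cv x; have [f Lf ->] := clsP x; rewrite !mulq_cls//; try exact: L2_cfmul.
by congr cls; apply/funext => t; rewrite /fmul mulrCA.
Qed.

Lemma mulq_sqr u f : contraction_fun u -> L2 f ->
  ip (mulq u (cls f)) (mulq u (cls f)) = \int[mu]_x (u x ^+ 2 * dotf f f x).
Proof.
move=> cu Lf; rewrite mulq_cls// ip_cls; try exact: L2_cfmul.
by apply: eq_Rintegral => t _; rewrite /dotf /fmul !ReImE /=; lra.
Qed.

Lemma mulq_bnd u : contraction_fun u -> bnd (mulq u) 1.
Proof.
move=> cu x; have [f Lf ->] := clsP x; rewrite mul1r nrm_ip mulq_sqr// ip_cls//.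
have iL := dotf_integrable Lf Lf.
have iM := dotf_integrable (L2_cfmul cu Lf) (L2_cfmul cu Lf).
have E t : dotf (fmul u f) (fmul u f) t = u t ^+ 2 * dotf f f t.
  by rewrite /dotf /fmul !ReImE /=; lra.
apply: le_Rintegral => //.
  by apply: eq_integrable iM => // t _ /=; rewrite E.
move=> t _; rewrite ler_piMl ?dotf_ge0// -real_normK ?num_real//.
by rewrite exprn_ile1//; exact: cu.2.
Qed.

Lemma mulq_pythagoras u v x : contraction_fun u -> contraction_fun v ->
  (forall t, u t ^+ 2 + v t ^+ 2 = 1) ->
  ip (mulq u x) (mulq u x) + ip (mulq v x) (mulq v x) = ip x x.
Proof.
move=> cu cv uv; have [f Lf ->] := clsP x; rewrite !mulq_cls// !ip_cls//; try exact: L2_cfmul.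
rewrite /rip -RintegralD//; try by apply: dotf_integrable; exact: L2_cfmul.
apply: eq_Rintegral => t _; rewrite /dotf /fmul !ReImE /= -[RHS]mul1r -(uv t); lra.
Qed.

Section bounded.
Variable K : (T -> R[i]) -> (T -> R[i]).
Hypothesis KB : bounded_op mu K.

Definition opq (x : H) : H := cls (K (rep x)).

Lemma opL2 f : L2 f -> L2 (K f). Proof. by have [h _ _] := KB; exact: h. Qed.

Lemma op_ae f g : L2 f -> L2 g -> f = g %[ae mu] -> K f = K g %[ae mu].
Proof.
move=> Lf Lg fg; have [KL Kl [M KM]] := KB.
have Lfg : L2 (smulf (-1) g + f) by apply: L2D => //; exact: L2Z.
have h0 : cls (smulf (-1) g + f) = 0.
  rewrite -cls0; apply: cls_eq => //; first exact: L2_0.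
  by apply: filterS fg => x h _; rewrite /smulf !fctE h// mulN1r addNr.
have h1 : cls (K (smulf (-1) g + f)) = 0.
  apply/nrm_eq0/eqP; rewrite eq_le nrm_ge0 andbT.
  have := KM _ Lfg; rewrite !L2norm_cls//; last exact: KL.
  by rewrite h0 nrm0 mule0 lee_fin.
have h2 : K (smulf (-1) g + f) = (fun=> 0) %[ae mu].
  by apply: cls_eqP; rewrite ?cls0//; [exact: KL|exact: L2_0].
apply: filterS2 h2 (Kl (-1) g f Lg Lf) => x h k _.
have := k I; rewrite (_ : (fun x => _) = smulf (-1) g + f)// (h I) => e.
by apply/eqP; rewrite -subr_eq0 addrC -mulN1r -e.
Qed.

Lemma opq_cls f : L2 f -> opq (cls f) = cls (K f).
Proof.
move=> Lf; apply: cls_eq; [by apply: opL2; exact: rep_L2|exact: opL2|].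
by apply: op_ae => //; [exact: rep_L2|exact: rep_cls].
Qed.

Lemma opq_smulf (c : R[i]) f : L2 f -> opq (cls (smulf c f)) = cls (smulf c (K f)).
Proof.
move=> Lf; have [KL Kl _] := KB.
have L0 := L2_0 mu.
have h := Kl c f (fun=> 0) Lf L0.
(* Linearity with scalar -1 reads [K 0 = - K 0 + K 0]. *)
have h0 : K (fun=> 0) = (fun=> 0) %[ae mu].
  have := Kl (-1) _ _ L0 L0; apply: filterS => x k _; have := k I.
  rewrite (_ : (fun x => _) = (fun=> 0)); last by apply/funext => t; rewrite mulr0 addr0.
  by rewrite mulN1r addNr.
rewrite opq_cls; last exact: L2Z.
apply: cls_eq; [by apply: KL; exact: L2Z|by apply: L2Z; exact: KL|].
apply: filterS2 h h0 => x k k0 _; have := k I.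
rewrite (_ : (fun x => c * f x + 0) = smulf c f); last by apply/funext => t; rewrite addr0.
by rewrite (k0 I) addr0.
Qed.

Lemma opq_Jq x : opq (Jq x) = Jq (opq x).
Proof.
have [f Lf ->] := clsP x; rewrite Jq_cls// opq_smulf// opq_cls// Jq_cls//.
exact: opL2.
Qed.

Lemma opq_lin : lin opq.
Proof.
move=> a x y; have [f Lf ->] := clsP x; have [g Lg ->] := clsP y.
have [KL Kl _] := KB.
rewrite -clsZ// -clsD//; last exact: L2Z.
rewrite !opq_cls//; last by apply: L2D => //; exact: L2Z.
rewrite -clsZ; last exact: KL.
rewrite -clsD; [|by apply: L2Z; exact: KL|exact: KL].
apply: cls_eq; [by apply: KL; apply: L2D => //; exact: L2Z|
  by apply: L2D; [apply: L2Z|]; exact: KL|].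
exact: Kl.
Qed.

Lemma opq_bnd : exists M, bnd opq M.
Proof.
have [KL _ [M KM]] := KB; exists M => x; have [f Lf ->] := clsP x.
rewrite opq_cls//; have := KM f Lf; rewrite !L2norm_cls//; last exact: KL.
Qed.

End bounded.

Definition ofq (Q : H -> H) f : T -> R[i] := rep (Q (cls f)).

Lemma ofq_L2 Q f : L2 (ofq Q f). Proof. exact: rep_L2. Qed.

Lemma cls_ofq Q f : cls (ofq Q f) = Q (cls f).
Proof. by rewrite /ofq cls_rep. Qed.

(** Commutation with [Jq] is exactly what makes a real-linear operator complex-linear. *)
Lemma ofq_bounded Q M : lin Q -> bnd Q M -> (forall x, Q (Jq x) = Jq (Q x)) ->
  bounded_op mu (ofq Q).
Proof.
move=> Ql QM QJ; split.
- by move=> f _; exact: ofq_L2.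
- move=> a f g Lf Lg.
  have LK : L2 (smulf a (ofq Q f) + ofq Q g) by apply: L2D; [apply: L2Z|]; exact: ofq_L2.
  have Lfg : L2 (smulf a f + g) by apply: L2D => //; exact: L2Z.
  apply: cls_eqP => //; first exact: ofq_L2.
  rewrite (_ : (fun x => a * f x + g x) = smulf a f + g)//.
  rewrite (_ : (fun x => _) = smulf a (ofq Q f) + ofq Q g)//.
  rewrite clsD; [|by apply: L2Z; exact: ofq_L2|exact: ofq_L2].
  rewrite cls_smulf; last exact: ofq_L2.
  rewrite !cls_ofq clsD//; last exact: L2Z.
  by rewrite cls_smulf//; move: (cls f) (cls g) => x y; rewrite 2!(linD Ql) 2!(linZ Ql) QJ.
- exists M => f Lf; rewrite !L2norm_cls//; last exact: ofq_L2.
  by rewrite -EFinM lee_fin /ofq cls_rep.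
Qed.

Lemma opq_ofq Q x : opq (ofq Q) x = Q x.
Proof. by rewrite /opq /ofq !cls_rep. Qed.

Lemma orth_proj_opq P : orth_proj mu P -> is_proj (opq P).
Proof.
move=> [PB PP Psym]; split.
  move=> x y; have [f Lf ->] := clsP x; have [g Lg ->] := clsP y.
  have Pf := opL2 PB Lf; have Pg := opL2 PB Lg.
  have := Psym f g Lf Lg; rewrite (inner_cls Pf Lg) (inner_cls Lf Pg).
  by rewrite (opq_cls PB Lf) (opq_cls PB Lg); exact: Complex_Re.
move=> x; have [f Lf ->] := clsP x; have Pf := opL2 PB Lf.
rewrite (opq_cls PB Lf) (opq_cls PB Pf).
exact: cls_eq (opL2 PB Pf) Pf (PP f Lf).
Qed.

(** The order on [R[i]] makes positivity include a vanishing imaginary part, and a real complex form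
    is symmetric. *)
Lemma positive_opP A : bounded_op mu A ->
  positive_op mu A <-> symop (opq A) /\ posop (opq A).
Proof.
move=> AB; have Al := opq_lin AB.
have innerA f : L2 f -> inner mu (A f) f =
    Complex (ip (opq A (cls f)) (cls f)) (ip (opq A (cls f)) (Jq (cls f))).
  by move=> Lf; rewrite (inner_cls (opL2 AB Lf) Lf) (opq_cls AB Lf).
split=> [Ap|[As Ap] f Lf].
  have h x : 0 <= ip (opq A x) x /\ ip (opq A x) (Jq x) = 0.
    have [f Lf ->] := clsP x; have := Ap f Lf; rewrite innerA// lecE/=.
    by move=> /andP[/eqP -> ->].
  split=> [|x]; last exact: (h x).1.
  apply: (real_form_sym Al Jq_lin ip_Jq JqJq (opq_Jq AB)) => x.
  exact: (h x).2.
rewrite (innerA f Lf) lecE/= Ap andbT; apply/eqP.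
exact: (sym_real_form ip_Jq (opq_Jq AB)).
Qed.

Lemma is_absvalP K A : bounded_op mu K -> symop (opq K) -> is_absval mu K A ->
  bounded_op mu A /\ is_abs (opq K) (opq A).
Proof.
move=> KB Ks [AB Ap AK]; split=> //; have [As Ap'] := (positive_opP AB).1 Ap.
split=> //; first exact: opq_bnd.
move=> x; apply: ip_ext => y; have [f Lf ->] := clsP x; have [g Lg ->] := clsP y.
have Kf := opL2 KB Lf; have Kg := opL2 KB Lg; have Af := opL2 AB Lf.
have := AK f g Lf Lg; rewrite (inner_cls (opL2 AB Af) Lg) (inner_cls Kf Kg).
move=> /Complex_Re; rewrite Ks (opq_cls AB Lf) (opq_cls AB Af).
by rewrite (opq_cls KB Lf) (opq_cls KB Lg).
Qed.

(** Guarantees that the choice in [absval] does not return its default. The real root commutes with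
    [Jq] because [K] does, so it comes from a complex-linear operator. *)
Lemma absval_exists K : bounded_op mu K -> symop (opq K) ->
  is_absval mu K (absval mu K).
Proof.
move=> KB Ks; rewrite /absval; apply: xgetPex.
have [M KM] := opq_bnd KB.
have [A [As [M' AM] Ap AK AJ]] := abs_op_exists Ks KM.
have AJq x : A (Jq x) = Jq (A x).
  by apply: AJ; [exact: Jq_lin|exact: Jq_bnd|move=> y; exact: opq_Jq].
have AB : bounded_op mu (ofq A) := ofq_bounded (symop_lin As) AM AJq.
have Aq x : opq (ofq A) x = A x by exact: opq_ofq.
exists (ofq A); split=> //.
  apply/(positive_opP AB); split=> [x y|x]; rewrite !Aq; [exact: As|exact: Ap].
move=> f g Lf Lg; have LA := ofq_L2 A f.
have Kx x y : ip (A (A x)) y = ip (opq K x) (opq K y) by rewrite AK Ks.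
rewrite (inner_cls (ofq_L2 A _) Lg) (inner_cls (opL2 KB Lf) (opL2 KB Lg)).
by rewrite !cls_ofq -(opq_cls KB Lf) -(opq_cls KB Lg) -(opq_Jq KB) !Kx.
Qed.

Lemma absval_abs K : bounded_op mu K -> symop (opq K) ->
  bounded_op mu (absval mu K) /\ is_abs (opq K) (opq (absval mu K)).
Proof. by move=> KB Ks; apply: is_absvalP => //; exact: absval_exists. Qed.

Lemma sandwich_bounded u K : contraction_fun u -> bounded_op mu K ->
  bounded_op mu (sandwich u K).
Proof.
move=> cu KB; have [KL Kl [M KM]] := KB; split.
- by move=> f Lf; apply: L2_cfmul => //; apply: KL; exact: L2_cfmul.
- move=> a f g Lf Lg; have := Kl a _ _ (L2_cfmul cu Lf) (L2_cfmul cu Lg).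
  apply: filterS => x h _; rewrite /sandwich.
  rewrite {1}/fmul (_ : fmul u (fun x => a * f x + g x) =
    fun x => a * fmul u f x + fmul u g x).
    by rewrite (h I) /fmul mulrDr mulrCA.
  by apply/funext => t; rewrite /fmul mulrDr mulrCA.
- exists `|M| => f Lf.
  have L1 := L2_cfmul cu Lf; have L2' := KL _ L1.
  have Ls : L2 (sandwich u K f) := L2_cfmul cu L2'.
  have := KM _ L1; rewrite (L2norm_cls L2') (L2norm_cls L1) (L2norm_cls Lf).
  rewrite (L2norm_cls Ls).
  rewrite -!EFinM !lee_fin => h.
  have h1 := bnd1 (cls (K (fmul u f))) (mulq_bnd cu).
  rewrite (mulq_cls cu L2') in h1; apply: le_trans h1 _; apply: le_trans h _.
  apply: (@le_trans _ _ (`|M| * nrm (cls (fmul u f)))).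
    by rewrite ler_wpM2r// ler_norm.
  rewrite ler_wpM2l//.
  by have := bnd1 (cls f) (mulq_bnd cu); rewrite (mulq_cls cu Lf).
Qed.

Lemma opq_sandwich u K x : contraction_fun u -> bounded_op mu K ->
  opq (sandwich u K) x = mulq u (opq K (mulq u x)).
Proof.
move=> cu KB; have [f Lf ->] := clsP x.
have Lu := L2_cfmul cu Lf.
rewrite (opq_cls (sandwich_bounded cu KB) Lf) (mulq_cls cu Lf) (opq_cls KB Lu).
by rewrite (mulq_cls cu (opL2 KB Lu)).
Qed.

Lemma bounded_opB K A : bounded_op mu K -> bounded_op mu A ->
  bounded_op mu (fun f => K f - A f).
Proof.
move=> KB AB; have [KL Kl [M KM]] := KB; have [AL Al [N AN]] := AB; split.
- by move=> f Lf; apply: L2B; [exact: KL|exact: AL].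
- move=> a f g Lf Lg; apply: filterS2 (Kl a f g Lf Lg) (Al a f g Lf Lg) => x h k _.
  rewrite (_ : (K _ - A _) x = K (fun x => a * f x + g x) x - A (fun x => a * f x + g x) x)//.
  rewrite (h I) (k I) (_ : (K f - A f) x = K f x - A f x)//.
  rewrite (_ : (K g - A g) x = K g x - A g x)//; ring.
- exists (M + N) => f Lf; have := KM f Lf; have := AN f Lf.
  rewrite (L2norm_cls (KL f Lf)) (L2norm_cls (AL f Lf)) (L2norm_cls Lf).
  rewrite (L2norm_cls (L2B (KL f Lf) (AL f Lf))).
  rewrite -!EFinM !lee_fin (clsB (KL f Lf) (AL f Lf)).
  by move=> h1 h2; apply: le_trans (nrmB _ _) _; rewrite mulrDl lerD.
Qed.

Lemma opqB K A x : bounded_op mu K -> bounded_op mu A ->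
  opq (fun f => K f - A f) x = opq K x - opq A x.
Proof. move=> KB AB; have Lx := rep_L2 x.
by rewrite /opq (clsB (opL2 KB Lx) (opL2 AB Lx)).
Qed.

End L2_operators.

(** * Trace class *)

Section esum_seq.
Context {R : realType} {X : choiceType}.
Variables (B : set X) (a : X -> R).

Lemma esum_seq_le (F : seq B) : uniq F ->
  ((\sum_(e <- F) a (val e))%:E <= \esum_(x in B) (a x)%:E)%E.
Proof.
move=> uF; have uVF : uniq [seq val e | e <- F] by rewrite map_inj_uniq//; exact: val_inj.
apply: esum_ge; exists [set` [seq val e | e <- F]].
  split; first exact: finite_seq.
  by move=> x /= /mapP[e _ ->]; exact: set_valP.
by rewrite -fsbig_seq// big_map -sumEFin.
Qed.

Lemma esum_le_seq (s : R) :
  (forall F : seq B, uniq F -> \sum_(e <- F) a (val e) <= s) ->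
  (\esum_(x in B) (a x)%:E <= s%:E)%E.
Proof.
move=> h; apply: ge_ereal_sup => _ [Y [finY YB] <-].
rewrite fsbig_finite// sumEFin lee_fin.
have YB' x : x \in enum_fset (fset_set Y) -> B x.
  move=> hx; have : x \in fset_set Y by [].
  by rewrite in_fset_set// inE => /YB.
have [F FE] : exists F : seq B, [seq val e | e <- F] = fset_set Y :> seq X.
  elim: (enum_fset (fset_set Y)) YB' => [_|x r IH hr]; first by exists [::].
  have [|F FE] := IH; first by move=> y yr; apply: hr; rewrite in_cons yr orbT.
  have xB : x \in B by rewrite inE; apply: hr; rewrite mem_head.
  by exists (exist _ x xB :: F); rewrite /= FE.
rewrite -FE big_map; apply: h.
by rewrite -(map_inj_uniq val_inj) FE fset_uniq.
Qed.

Lemma esum_seq_tight (s e : R) : (\esum_(x in B) (a x)%:E)%E = s%:E -> 0 < e ->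
  exists2 F : seq B, uniq F & s - e <= \sum_(e <- F) a (val e).
Proof.
move=> hs e0; apply: contrapT => /forall2NP h.
have : (\esum_(x in B) (a x)%:E <= (s - e)%:E)%E.
  apply: esum_le_seq => F uF; have [|/negP] := h F; first by rewrite uF.
  by rewrite -ltNge => /ltW.
by rewrite hs lee_fin; lra.
Qed.

End esum_seq.

Section doubled_sums.
Context {R : realType} {I : choiceType}.
Implicit Types (t : I -> R).

(* A complex orthonormal basis [e] yields the real one [e, i e], which doubles
   traces. *)
Lemma sum_pair_bool t (F : seq I) :
  \sum_(p <- [seq (e, c) | e <- F, c <- [:: false; true]]) t p.1 =
  2 * \sum_(e <- F) t e.
Proof.
rewrite big_allpairs/= big_distrr/=; apply: eq_bigr => e _.
by rewrite !big_cons big_nil addr0; lra.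
Qed.

(** A finite set of pairs may contain only one of two partners; nonnegativity allows completing
    it. *)
Lemma bsum_double t s : (forall e, 0 <= t e) -> bsum_le t s ->
  bsum_le (fun p : I * bool => t p.1) (2 * s).
Proof.
move=> t0 h F uF; pose G := undup [seq p.1 | p <- F].
have uG : uniq G by exact: undup_uniq.
apply: (@le_trans _ _ (2 * \sum_(e <- G) t e)); last by rewrite ler_wpM2l// h.
rewrite -sum_pair_bool; apply: sum_subset => //.
  by rewrite allpairs_uniq// => -[? ?] [? ?].
move=> [e c] eF; apply/allpairsP; exists (e, c); split=> //=.
  by rewrite mem_undup; apply/mapP; exists (e, c).
by case: c {eF}.
Qed.

Lemma bsum_undouble t s : bsum_le (fun p : I * bool => t p.1) s ->
  bsum_le t (s / 2).
Proof.
move=> h F uF; rewrite ler_pdivlMr// mulrC -sum_pair_bool; apply: h.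
by rewrite allpairs_uniq// => -[? ?] [? ?].
Qed.

End doubled_sums.

(** * Orthonormal bases and traces *)

Section basis_and_trace.
Context d (T : measurableType d) (R : realType).
Variable mu : {measure set T -> \bar R}.
Implicit Types (f g h : T -> R[i]).
Implicit Types (K A P : (T -> R[i]) -> (T -> R[i])).
Local Notation L2 := (L2 mu).
Local Notation H := (L2hilbert mu).
Local Notation cls := (cls mu : (T -> R[i]) -> H).

Lemma inner_eq0 f g : L2 f -> L2 g -> inner mu f g = 0 ->
  ip (cls f) (cls g) = 0 /\ ip (cls f) (Jq (cls g)) = 0.
Proof.
move=> Lf Lg; rewrite inner_cls// => h.
by split; [exact: (congr1 (@complex.Re R) h)|exact: (congr1 (@complex.Im R) h)].
Qed.

Lemma inner_scale (a : R) f g : L2 f -> L2 g ->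
  inner mu (smulf (real_complex R a) f) g = real_complex R a * inner mu f g.
Proof.
move=> Lf Lg; have La := L2Z (real_complex R a) Lf.
rewrite (inner_cls La Lg) (inner_cls Lf Lg).
rewrite (clsZ a Lf : cls _ = a *: cls f).
rewrite ipZl.
rewrite ipZl.
move: (ip _ _) (ip _ _) => p q.
by apply: complex_ext; rewrite ?cReM ?cImM /=; ring.
Qed.

Lemma inner_conj f g : L2 f -> L2 g -> inner mu g f = conjc (inner mu f g).
Proof.
move=> Lf Lg; rewrite (inner_cls Lf Lg) (inner_cls Lg Lf).
by apply: complex_ext; [exact: ipC|rewrite /= ipC; exact: ip_Jq].
Qed.

(** A nonzero vector orthogonal to a maximal orthonormal family could be normalised and adjoined.
    Hence the choice inside [trace] is a genuine basis. *)
Lemma orthonormal_basis_exists : exists B, orthonormal_basis mu B.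
Proof.
pose P (B : set (T -> R[i])) := [/\ B `<=` L2, forall e, B e -> inner mu e e = 1 &
  forall e f, B e -> B f -> e <> f -> inner mu e f = 0].
have [|A [[AL A1 A0] Amax]] := @Zorn_bigcup _ P.
  move=> F FP Ftot; split.
  - by move=> e [X /FP[h _ _] Xe]; exact: h.
  - by move=> e [X /FP[_ h _] Xe]; exact: h.
  - move=> e f [X FX Xe] [Y FY Yf]; have [XY|YX] := Ftot X Y FX FY.
      by have [_ _ h] := FP Y FY; apply: h => //; exact: XY.
    by have [_ _ h] := FP X FX; apply: h => //; exact: YX.
exists A; split=> // h Lh hA; apply: contrapT => hn0.
have n0 : nrm (cls h) != 0.
  apply/eqP => /nrm_eq0; rewrite -cls0 => /(cls_eqP Lh (L2_0 mu)).
  exact: hn0.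
pose a := (nrm (cls h))^-1; pose h' := smulf (real_complex R a) h.
have Lh' : L2 h' by exact: L2Z.
have a0 : real_complex R a != 0 by rewrite fmorph_eq0 invr_eq0.
have hA' e : A e -> inner mu h' e = 0.
  by move=> Ae; rewrite (inner_scale _ Lh (AL e Ae)) hA// mulr0.
have h'1 : inner mu h' h' = 1.
  rewrite (inner_cls Lh' Lh') ip_xJx.
  have -> : ip (cls h') (cls h') = 1; last by [].
  rewrite (clsZ a Lh : cls _ = a *: cls h) ipZl ipZr -sqr_nrm /a; field.
  exact: n0.
have nA : ~ A h'.
  by move=> /hA'; rewrite h'1 => /eqP; rewrite oner_eq0.
apply: (Amax (A `|` [set h'])).
  split; first by move=> x; left.
  by move=> /(_ h' (or_intror erefl)).
split.
- by move=> e [/AL//|->].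
- by move=> e [/A1//|->].
- move=> e f [Ae|->] [Af|->] ef //; [exact: A0| |exact: hA'].
  by rewrite (inner_conj Lh' (AL e Ae)) hA'//; apply: complex_ext; rewrite /= ?oppr0.
Qed.

Definition onb : set (T -> R[i]) := xget set0 (orthonormal_basis mu).

Lemma onbP : orthonormal_basis mu onb.
Proof. by apply: xgetPex; exact: orthonormal_basis_exists. Qed.

Definition onbq (p : onb * bool) : H :=
  if p.2 then Jq (cls (val p.1)) else cls (val p.1).

Lemma onb_L2 (e : onb) : L2 (val e).
Proof. by have [h _ _ _] := onbP; apply: h; exact: set_valP. Qed.

(** The real and imaginary parts of [<e, f> = 0] give orthogonality of [e] to [f] and to [i f], and
    skewness of [Jq] that of [e] to [i e]. Conversely, real orthogonality to [e] and [i e] is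
    complex orthogonality to [e]. *)
Lemma onbq_total : orthonormal_total onbq.
Proof.
have [BL B1 B0 Bt] := onbP; split.
  have b1 (e : onb) : ip (cls (val e)) (cls (val e)) = 1.
    have := B1 (val e) (set_valP e); rewrite (inner_cls (onb_L2 e) (onb_L2 e)).
    exact: Complex_Re.
  have b0 (e f : onb) : e != f -> ip (cls (val e)) (cls (val f)) = 0 /\
      ip (cls (val e)) (Jq (cls (val f))) = 0.
    move=> ef; apply: (inner_eq0 (onb_L2 e) (onb_L2 f)).
    apply: B0; [exact: set_valP|exact: set_valP|].
    by move=> /val_inj ef'; rewrite ef' eqxx in ef.
  move=> [e c] [f c']; rewrite /onbq /= xpair_eqE.
  have [<-|ef] := eqVneq e f.
    move: (b1 e); move: (cls (val e)) => x x1.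
    case: c; case: c' => /=.
    - by rewrite ip_JqJq x1.
    - by rewrite ip_Jq ip_xJx oppr0.
    - by rewrite ip_xJx.
    - by rewrite x1.
  move: (b0 _ _ ef); move: (cls (val e)) (cls (val f)) => x y [h1 h2].
  case: c; case: c' => /=.
  - by rewrite ip_JqJq h1.
  - by rewrite ip_Jq h2 oppr0.
  - by rewrite h2.
  - by rewrite h1.
move=> x hx; have [h Lh xh] := clsP x.
rewrite xh -cls0; apply: cls_eq => //; first exact: L2_0.
apply: Bt => // e Be; have Le := BL e Be.
have eB : e \in onb by rewrite inE.
have := hx (exist _ e eB, false); have := hx (exist _ e eB, true).
rewrite /onbq /= xh => h1 h2.
by rewrite (inner_cls Lh Le) h1 h2.
Qed.

Section trace.
Variable A : (T -> R[i]) -> (T -> R[i]).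
Hypotheses (AB : bounded_op mu A) (Ap : @posop _ H (opq A)).

Let tau (e : T -> R[i]) : R := complex.Re (inner mu (A e) e).

Lemma trace_diag (e : onb) : tau (val e) = ip (opq A (cls (val e))) (cls (val e)).
Proof.
have Le := onb_L2 e.
by rewrite /tau (inner_cls (opL2 AB Le) Le) /= (opq_cls AB Le).
Qed.

Lemma trace_diag_onbq (p : onb * bool) :
  ip (opq A (onbq p)) (onbq p) = tau (val p.1).
Proof.
rewrite trace_diag /onbq; case: p => e [] //=.
by rewrite (opq_Jq AB) ip_JqJq.
Qed.

Lemma tau_ge0 e : onb e -> 0 <= tau e.
Proof.
move=> Be; have eB : e \in onb by rewrite inE.
by rewrite (trace_diag (exist _ e eB)); exact: Ap.
Qed.

Lemma trace_bsum s : (trace mu A <= s%:E)%E ->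
  bsum_le (fun p => ip (opq A (onbq p)) (onbq p)) (2 * s).
Proof.
move=> h; have h1 : bsum_le (fun e : onb => tau (val e)) s.
  move=> F uF; rewrite -lee_fin; apply: le_trans h.
  exact: (@esum_seq_le _ _ onb tau F uF).
apply: bsum_le_le (bsum_double _ h1) => [p|e]; first by rewrite trace_diag_onbq.
by apply: tau_ge0; exact: set_valP.
Qed.

Lemma bsum_trace s : bsum_le (fun p => ip (opq A (onbq p)) (onbq p)) s ->
  (trace mu A <= (s / 2)%:E)%E.
Proof.
move=> h; apply: (@esum_le_seq _ _ onb tau).
apply: (bsum_undouble (t := fun e : onb => tau (val e))) => F uF.
apply: le_trans (h F uF); rewrite le_eqVlt; apply/orP; left; apply/eqP.
by apply: eq_bigr => p _; rewrite trace_diag_onbq.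
Qed.

Lemma trace_ge0 : (0 <= trace mu A)%E.
Proof. by apply: esum_ge0 => e Be; rewrite lee_fin; exact: tau_ge0. Qed.

Lemma trace_tight s e : trace mu A = s%:E -> 0 < e ->
  exists2 F, uniq F & 2 * s - e <= \sum_(p <- F) ip (opq A (onbq p)) (onbq p).
Proof.
move=> hs e0; have [F uF hF] := @esum_seq_tight _ _ onb tau s _ hs (divr_gt0 e0 (ltr0Sn R 1)).
exists [seq (x, c) | x <- F, c <- [:: false; true]].
  by rewrite allpairs_uniq// => -[? ?] [? ?].
under eq_bigr => p _ do rewrite trace_diag_onbq.
by rewrite (sum_pair_bool (fun x : onb => tau (val x))); lra.
Qed.

End trace.
End basis_and_trace.

(** * Trace class compressions of projections *)

Section trace_class_projections.
Context d (T : measurableType d) (R : realType).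
Variable mu : {measure set T -> \bar R}.
Implicit Types (f g h : T -> R[i]) (u : T -> R).
Implicit Types (K A P : (T -> R[i]) -> (T -> R[i])).
Local Notation L2 := (L2 mu).
Local Notation H := (L2hilbert mu).
Local Notation cls := (cls mu : (T -> R[i]) -> H).
Local Notation b := (onbq (mu := mu) : _ -> H).

Let bP : orthonormal_total b := onbq_total mu.

Lemma ereal_cvg0P (a : nat -> \bar R) : (forall n, (0 <= a n)%E) ->
  a @ \oo --> 0%E <->
  forall e : R, 0 < e -> \forall n \near \oo, (a n <= e%:E)%E.
Proof.
move=> a0; split=> [/fine_cvgP[fa ca] e e0|h].
  near=> n; have fn : a n \is a fin_num by near: n.
  rewrite -(fineK fn) lee_fin; apply: le_trans (ler_norm _) _; near: n.
  by move/cvgr0Pnorm_le : ca; apply.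
apply/fine_cvgP; split.
  near=> n; rewrite ge0_fin_numE//; apply: le_lt_trans (ltry 1); near: n.
  exact: h.
apply/cvgr0Pnorm_le => e e0; near=> n.
have an : (a n <= e%:E)%E by near: n; exact: h.
rewrite /= ger0_norm ?fine_ge0//.
rewrite -lee_fin fineK// ge0_fin_numE//; exact: le_lt_trans (ltry e).
Unshelve. all: by end_near. Qed.

Lemma opq_sandwichE u P : contraction_fun u -> bounded_op mu P ->
  opq (sandwich u P) = (fun x : H => mulq u (opq P (mulq u x))).
Proof. by move=> cu PB; apply/funext => x; exact: opq_sandwich. Qed.

Lemma opq_sandwichB u P Q : contraction_fun u -> bounded_op mu P -> bounded_op mu Q ->
  opq (sandwich u (fun f => P f - Q f)) =
  (fun x : H => mulq u (opq P (mulq u x) - opq Q (mulq u x))).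
Proof.
move=> cu PB QB; apply/funext => x.
by rewrite (opq_sandwich x cu (bounded_opB PB QB)) (opqB _ PB QB).
Qed.

Section one_projection.
Variables (u : T -> R) (P : (T -> R[i]) -> (T -> R[i])).
Hypotheses (cu : contraction_fun u) (PP : orth_proj mu P).
Let PB : bounded_op mu P := let: And3 h _ _ := PP in h.
Let Pq : @is_proj _ H (opq P) := orth_proj_opq PP.

Lemma sandwich_diag (x : H) : ip (opq (sandwich u P) x) x =
  ip (opq P (mulq u x)) (opq P (mulq u x)).
Proof.
by rewrite (opq_sandwichE cu PB) (mulq_sym cu) (proj_ip _ Pq).
Qed.

Lemma sandwich_sym : symop (opq (sandwich u P) : H -> H).
Proof.
rewrite (opq_sandwichE cu PB) => x y.
by rewrite (mulq_sym cu) Pq.1 (mulq_sym cu).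
Qed.

Lemma sandwich_pos : posop (opq (sandwich u P) : H -> H).
Proof. by move=> x; rewrite sandwich_diag ip_ge0. Qed.

Lemma trace_class_hs_fin : trace_class mu (sandwich u P) <->
  hs_fin b (mulq u) (opq P).
Proof.
have sB := sandwich_bounded cu PB.
have [AB Aabs] := absval_abs sB sandwich_sym.
have Aabs' : is_abs (fun x : H => mulq u (opq P (mulq u x)))
    (opq (absval mu (sandwich u P))).
  by rewrite -(opq_sandwichE cu PB).
have hf := abs_fin b (mulq_sym cu) (mulq_bnd cu) Pq Aabs'.
have [_ _ Ap _] := Aabs.
split=> [[_ tf]|/hf[s hs]].
  apply/hf; exists (2 * fine (trace_norm mu (sandwich u P))).
  apply: (trace_bsum AB Ap); rewrite fineK// ge0_fin_numE//.
  exact: (trace_ge0 AB Ap).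
split=> //; apply: le_lt_trans (ltry (s / 2)).
exact: (bsum_trace AB hs).
Qed.

Lemma trace_sandwich_fin : hs_fin b (mulq u) (opq P) ->
  (trace mu (sandwich u P) < +oo)%E.
Proof.
move=> [s hs]; apply: le_lt_trans (ltry (s / 2)).
apply: (bsum_trace (sandwich_bounded cu PB)).
by apply: bsum_le_le hs => p; rewrite sandwich_diag.
Qed.

End one_projection.

Lemma trace_norm_bsum0 u (P_ : nat -> (T -> R[i]) -> (T -> R[i])) P :
  contraction_fun u -> (forall n, orth_proj mu (P_ n)) -> orth_proj mu P ->
  trace_norm mu (sandwich u (fun f => P_ n f - P f)) @[n --> \oo] --> 0%E ->
  exists2 A_ : nat -> H -> H,
    forall n, is_abs (fun x => mulq u (opq (P_ n) (mulq u x) - opq P (mulq u x))) (A_ n) &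
    bsum0 (fun n i => ip (A_ n (b i)) (b i)).
Proof.
move=> cu Pn PP; have [PB _ _] := PP; have Pq := orth_proj_opq PP.
have PnB n : bounded_op mu (P_ n) by have [] := Pn n.
have sB n := sandwich_bounded cu (bounded_opB (PnB n) PB).
have ss n : symop (opq (sandwich u (fun f => P_ n f - P f)) : H -> H).
  rewrite (opq_sandwichB cu (PnB n) PB) => x y.
  rewrite (mulq_sym cu) ipBl (orth_proj_opq (Pn n)).1 Pq.1 -ipBr.
  by rewrite (mulq_sym cu).
have aA n := absval_abs (sB n) (ss n).
have Ap n : @posop _ H (opq (absval mu (sandwich u (fun f => P_ n f - P f)))).
  by have [_ []] := aA n.
move=> /ereal_cvg0P h.
exists (fun n => opq (absval mu (sandwich u (fun f => P_ n f - P f)))).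
  by move=> n; rewrite -(opq_sandwichB cu (PnB n) PB); have [] := aA n.
(* The real basis doubles the trace, so the trace norm must fall below [e / 2]. *)
move=> e e0; near=> n; rewrite (_ : e = 2 * (e / 2)); last by field.
apply: (trace_bsum (aA n).1 (Ap n)); near: n; apply: h; last by rewrite divr_gt0.
by move=> n; exact: (trace_ge0 (aA n).1 (Ap n)).
Unshelve. all: by end_near. Qed.

Lemma trace_norm_cvg0 u (P_ : nat -> (T -> R[i]) -> (T -> R[i])) P :
  contraction_fun u -> (forall n, orth_proj mu (P_ n)) -> orth_proj mu P ->
  (forall n, hs_fin b (mulq u) (opq (P_ n))) -> hs_fin b (mulq u) (opq P) ->
  hs_conv b (mulq u) (fun n => opq (P_ n)) (opq P) ->
  trace_norm mu (sandwich u (fun f => P_ n f - P f)) @[n --> \oo] --> 0%E.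
Proof.
move=> cu Pn PP fn f hc; have [PB _ _] := PP; have Pq := orth_proj_opq PP.
have PnB n : bounded_op mu (P_ n) by have [] := Pn n.
have sB n := sandwich_bounded cu (bounded_opB (PnB n) PB).
have ss n : symop (opq (sandwich u (fun f => P_ n f - P f)) : H -> H).
  rewrite (opq_sandwichB cu (PnB n) PB) => x y.
  rewrite (mulq_sym cu) ipBl (orth_proj_opq (Pn n)).1 Pq.1 -ipBr.
  by rewrite (mulq_sym cu).
have aA n := absval_abs (sB n) (ss n).
have Ap n : @posop _ H (opq (absval mu (sandwich u (fun f => P_ n f - P f)))).
  by have [_ []] := aA n.
apply/ereal_cvg0P; first by move=> n; exact: (trace_ge0 (aA n).1 (Ap n)).
move=> e e0.
have := hs_conv_trace_abs bP (mulq_sym cu) (fun n => orth_proj_opq (Pn n)) Pq fn f hc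
  (mulr_gt0 (ltr0Sn R 1) e0).
apply: filterS => n hn.
rewrite (_ : e = 2 * e / 2); last by field.
apply: (bsum_trace (aA n).1); apply: hn.
by rewrite -(opq_sandwichB cu (PnB n) PB); have [] := aA n.
Qed.

(** The diagonal of the compression consists of the squares [|P_n u b_i|^2], so the traces are, up
    to the factor 2, the totals in the tightness argument. *)
Lemma trace_cvg_hs_conv u (P_ : nat -> (T -> R[i]) -> (T -> R[i])) P :
  contraction_fun u -> (forall n, orth_proj mu (P_ n)) -> orth_proj mu P ->
  (forall x : H, cvgH (fun n => opq (P_ n) x) (opq P x)) ->
  (forall n, hs_fin b (mulq u) (opq (P_ n))) -> hs_fin b (mulq u) (opq P) ->
  trace mu (sandwich u (P_ n)) @[n --> \oo] --> trace mu (sandwich u P) ->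
  hs_conv b (mulq u) (fun n => opq (P_ n)) (opq P).
Proof.
move=> cu Pn PP Pc fn f hc; have [PB _ _] := PP.
have PnB n : bounded_op mu (P_ n) by have [] := Pn n.
have tfin P' : orth_proj mu P' -> hs_fin b (mulq u) (opq P') ->
    trace mu (sandwich u P') \is a fin_num.
  move=> PP' fP'; have [P'B _ _] := PP'.
  rewrite ge0_fin_numE; first exact: trace_sandwich_fin.
  exact: (trace_ge0 (sandwich_bounded cu P'B) (sandwich_pos cu PP')).
pose t n := 2 * fine (trace mu (sandwich u (P_ n))).
apply: (hs_conv_tight (t := t) (s := 2 * fine (trace mu (sandwich u P)))) => //.
- move=> n; have := trace_bsum (sandwich_bounded cu (PnB n)) (sandwich_pos cu (Pn n))
    (s := fine (trace mu (sandwich u (P_ n)))).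
  rewrite fineK; last exact: tfin.
  by move=> /(_ (lexx _)); apply: bsum_le_le => p; rewrite sandwich_diag.
- apply: cvgM; first exact: cvg_cst.
  by apply: fine_cvg; rewrite fineK//; exact: tfin.
- move=> e e0.
  have [|F uF hF] := trace_tight (sandwich_bounded cu PB)
    (s := fine (trace mu (sandwich u P))) _ e0.
    by rewrite fineK//; exact: tfin.
  exists F => //; apply: le_trans hF _; rewrite le_eqVlt; apply/orP; left; apply/eqP.
  by apply: eq_bigr => p _; rewrite sandwich_diag.
Qed.

End trace_class_projections.

(** * Weighted sums of subspaces *)

Section projection_transfer.
Context d (T : measurableType d) (R : realType).
Variable mu : {measure set T -> \bar R}.
Implicit Types (f g h : T -> R[i]) (u : T -> R) (W : set (T -> R[i])).
Local Notation L2 := (L2 mu).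
Local Notation H := (L2hilbert mu).
Local Notation cls := (cls mu : (T -> R[i]) -> H).

(** The vector [Jq (x - Q x)] is orthogonal to [M], since [Jq] is skew and preserves [M]. Thus the
    projection onto a complex subspace is complex-linear. *)
Lemma proj_onto_comm (Q : H -> H) (M : H -> Prop) : proj_onto Q M ->
  (forall x, M x -> M (Jq x)) -> forall x, Q (Jq x) = Jq (Q x).
Proof.
move=> QM MJ x; have [Qs QQ QK] := QM; have Ql := symop_lin Qs.
have o k : M k -> ip (Jq x - Jq (Q x)) k = 0.
  move=> Mk; rewrite -(linB (@Jq_lin _ _ _ mu)) ip_Jq.
  by rewrite (proj_onto_orth x QM (MJ k Mk)) oppr0.
have MQ : M (Q (Jq x - Jq (Q x))) by exact: QQ.
have : Q (Jq x - Jq (Q x)) = 0.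
  by apply: ip_eq0; rewrite -(proj_ip _ (proj_onto_is QM)) ipC; exact: o.
rewrite (linB Ql) (QK (Jq (Q x))); last exact: MJ.
by move/eqP; rewrite subr_eq0 => /eqP.
Qed.

Variables (W : set (T -> R[i])) (M : H -> Prop) (Q : H -> H).
Hypothesis WM : forall f, W f <-> L2 f /\ M (cls f).
Hypothesis MJ : forall x, M x -> M (Jq x).
Hypothesis QM : proj_onto Q M.

Lemma orth_proj_onto_ofq : orth_proj_onto mu (ofq Q) W.
Proof.
have [Qs QQ QK] := QM; have QP := proj_onto_is QM.
have QJ := proj_onto_comm QM MJ.
split.
  split.
  - exact: ofq_bounded (symop_lin Qs) (proj_bnd QP) QJ.
  - move=> f Lf; have e : ofq Q (ofq Q f) = ofq Q f by rewrite {1}/ofq cls_ofq QP.2.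
    by apply: aeW => x _; rewrite e.
  - move=> f g Lf Lg.
    rewrite (inner_cls (ofq_L2 Q f) Lg) (inner_cls Lf (ofq_L2 Q g)) !cls_ofq.
    by rewrite !Qs QJ.
apply/seteqP; split=> f.
  move=> [Lf [h Lh fh]]; apply/WM; split=> //.
  rewrite (cls_eq Lf (ofq_L2 Q h) fh : cls f = cls (ofq Q h)) cls_ofq.
  exact: QQ.
move=> /WM[Lf Mf]; split=> //; exists f => //.
apply: (cls_eqP Lf (ofq_L2 Q f)).
by rewrite -[RHS]/(cls _) cls_ofq QK.
Qed.

Lemma L2_closed_of_proj : L2_closed mu W.
Proof.
split=> [f /WM[]//|f Lf hf]; apply/WM; split=> //.
apply: (proj_onto_closed QM) => e e0.
have [w /WM[Lw Mw] hw] := hf e e0; exists (cls w) => //.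
move: hw; rewrite (L2norm_cls (L2B Lf Lw)) lte_fin => /ltW.
by rewrite (clsB Lf Lw : cls (f - w) = cls f - cls w).
Qed.

End projection_transfer.

Section finite_combinations.
Context d (T : measurableType d) (R : realType).
Variable mu : {measure set T -> \bar R}.
Local Notation L2 := (L2 mu).
Local Notation H := (L2hilbert mu).
Local Notation cls := (cls mu : (T -> R[i]) -> H).

Lemma cls_sum (I : Type) (r : seq I) (f : I -> T -> R[i]) :
  (forall i, L2 (f i)) ->
  L2 (fun x => \sum_(i <- r) f i x) /\
  cls (fun x => \sum_(i <- r) f i x) = \sum_(i <- r) cls (f i).
Proof.
move=> Lf; elim: r => [|i r [L IH]].
  rewrite big_nil (_ : (fun x => _) = fun=> 0); last first.
    by apply/funext => x; rewrite big_nil.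
  by split; [exact: L2_0|exact: cls0].
rewrite big_cons (_ : (fun x => _) = f i + (fun x => \sum_(i <- r) f i x)); last first.
  by apply/funext => x; rewrite big_cons.
split; first exact: L2D.
by rewrite (clsD (Lf i) L : cls _ = cls _ + cls _) IH.
Qed.

Lemma L2_ae f g : cmeasurable f -> L2 g -> f = g %[ae mu] -> L2 f.
Proof.
move=> mf /L2P[mg ig] fg; apply/L2P; split=> //.
have /integrableP[_ h] := ig; apply/integrableP; split.
  exact/measurable_EFinP/measurable_dotf.
apply: le_lt_trans h; rewrite le_eqVlt; apply/orP; left; apply/eqP.
apply: ae_eq_integral => //.
- by apply: measurableT_comp => //; exact/measurable_EFinP/measurable_dotf.
- by apply: measurableT_comp => //; exact/measurable_EFinP/measurable_dotf.
- by apply: filterS fg => x h _; rewrite /= /dotf (h I).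
Qed.

Variables (m : nat) (u : T -> R) (v : 'I_m -> T -> R[i]).
Hypothesis Luv : forall i, L2 (fmul u (v i)).

Definition comb (c : 'I_m -> R[i]) : T -> R[i] := fun x => \sum_(i < m) c i * v i x.

(** Over the reals the span of m vectors is generated by 2m: each weighted vector and its multiple
    by i, flagged by the boolean. *)
Definition real_vec (j : 'I_m * bool) : H :=
  if j.2 then Jq (cls (fmul u (v j.1))) else cls (fmul u (v j.1)).

Definition cplx_coef (t : 'I_m * bool -> R) (i : 'I_m) : R[i] :=
  Complex (t (i, false)) (t (i, true)).

Definition real_coef (c : 'I_m -> R[i]) (j : 'I_m * bool) : R :=
  if j.2 then complex.Im (c j.1) else complex.Re (c j.1).

Lemma cplx_coefK c : cplx_coef (real_coef c) = c.
Proof. by apply/funext => i; rewrite /cplx_coef /real_coef /=; case: (c i). Qed.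

Lemma fmul_comb c : fmul u (comb c) = (fun x => \sum_(i < m) smulf (c i) (fmul u (v i)) x).
Proof.
apply/funext => x; rewrite /fmul /comb big_distrr/=; apply: eq_bigr => i _.
by rewrite /smulf mulrCA.
Qed.

Lemma L2_fmul_comb c : L2 (fmul u (comb c)).
Proof. by rewrite fmul_comb; apply: (cls_sum _ _).1 => i; exact: L2Z. Qed.

Lemma sum_real_vec t :
  \sum_(j <- index_enum _) t j *: real_vec j = cls (fmul u (comb (cplx_coef t))).
Proof.
rewrite fmul_comb (cls_sum _ (fun i => L2Z (cplx_coef t i) (Luv i))).2.
rewrite (eq_bigr (fun i : 'I_m => t (i, false) *: cls (fmul u (v i)) +
    t (i, true) *: Jq (cls (fmul u (v i))))); last first.
  by move=> i _; rewrite cls_smulf.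
rewrite (eq_bigr (fun p : 'I_m * bool => (fun i c => t (i, c) *: real_vec (i, c)) p.1 p.2));
  last by case.
rewrite -(pair_bigA _ (fun i c => t (i, c) *: real_vec (i, c)))/=.
apply: eq_bigr => i _.
by rewrite big_bool /real_vec/= addrC.
Qed.

Lemma comb_ae V c : is_basis mu V v -> V (comb c) <-> cmeasurable (comb c).
Proof.
move=> [_ VE _]; rewrite VE; split=> [[]//|mc]; split=> //.
by exists c; exact: aeq_refl.
Qed.

End finite_combinations.

Section weighted_sum_space.
Context d (T : measurableType d) (R : realType).
Variable mu : {measure set T -> \bar R}.
Local Notation L2 := (L2 mu).
Local Notation H := (L2hilbert mu).
Local Notation cls := (cls mu : (T -> R[i]) -> H).

Variables (u : T -> R) (P : (T -> R[i]) -> (T -> R[i])) (L V : set (T -> R[i])).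
Variables (m : nat) (v : 'I_m -> T -> R[i]).
Hypotheses (cu : contraction_fun u) (u0 : forall x, u x != 0).
Hypotheses (PL : orth_proj_onto mu P L) (Vv : is_basis mu V v).
Hypothesis uV : forall f, V f -> L2 (fmul u f).

Let PB : bounded_op mu P. Proof. by have [[]] := PL. Qed.
Let PP : orth_proj mu P. Proof. by have [] := PL. Qed.
Let Luv i : L2 (fmul u (v i)).
Proof. by apply: uV; have [h _ _] := Vv; exact: h. Qed.

Lemma range_L f : L f <-> L2 f /\ opq P (cls f) = cls f.
Proof.
have [_ <-] := PL; have Pq := orth_proj_opq PP; split.
  move=> [Lf [h Lh fh]]; split=> //.
  have -> : cls f = opq P (cls h).
    by rewrite (opq_cls PB Lh); exact: (cls_eq Lf (opL2 PB Lh) fh).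
  exact: Pq.2.
move=> [Lf Pf]; split=> //; exists f => //.
apply: (cls_eqP Lf (opL2 PB Lf)).
by rewrite -Pf (opq_cls PB Lf).
Qed.

Lemma cmeasurable_comb c : (forall i, cmeasurable (v i)) -> cmeasurable (comb v c).
Proof.
move=> mv; rewrite /comb; elim: (index_enum _) => [|i r IH].
  rewrite (_ : (fun x => _) = fun=> 0); first exact: cmeasurable_cst.
  by apply/funext => x; rewrite big_nil.
rewrite (_ : (fun x => _) = smulf (c i) (v i) + (fun x => \sum_(i <- r) c i * v i x)).
  by apply: cmeasurableD => //; exact: cmeasurableZ.
by apply/funext => x; rewrite big_cons.
Qed.

Lemma V_comb c : V (comb v c).
Proof.
have [Vvi VE _] := Vv; apply/(comb_ae _ Vv); apply: cmeasurable_comb => i.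
by have := Vvi i; rewrite VE => -[].
Qed.

Definition weighted_space : H -> Prop :=
  vsum (gimage (mulq u) (opq P)) (index_enum ('I_m * bool)%type) (real_vec mu u v).

Lemma weighted_spaceP x : weighted_space x <-> exists h c,
  [/\ L h & x = cls (fmul u h) + cls (fmul u (comb v c))].
Proof.
split=> [[t [h Ph]]|[h [c [/range_L[Lh Ph] ->]]]].
  rewrite (sum_real_vec Luv) => hx; exists (rep h), (cplx_coef t); split.
    by apply/range_L; split; [exact: rep_L2|rewrite cls_rep].
  have -> : cls (fmul u (rep h)) = mulq u h by [].
  by rewrite -hx subrK.
exists (real_coef c); rewrite (sum_real_vec Luv) cplx_coefK addrK.
by exists (cls h) => //; rewrite (mulq_cls cu Lh).
Qed.

Lemma weighted_space_J x : weighted_space x -> weighted_space (Jq x).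
Proof.
move=> /weighted_spaceP[h [c [Lh ->]]]; apply/weighted_spaceP.
have [Lh2 Ph] := (range_L h).1 Lh.
exists (smulf 'i%C h), (fun i => 'i%C * c i); split.
  apply/range_L; split; first exact: L2Z.
  by rewrite -(Jq_cls Lh2) (opq_Jq PB) Ph.
have Luh := L2_cfmul cu Lh2; have Luc := L2_fmul_comb Luv c.
rewrite (linD (@Jq_lin _ _ _ mu)) (Jq_cls Luh) (Jq_cls Luc).
have -> : smulf 'i%C (fmul u h) = fmul u (smulf 'i%C h).
  by apply/funext => y; rewrite /fmul /smulf mulrCA.
have -> : smulf 'i%C (fmul u (comb v c)) = fmul u (comb v (fun i => 'i%C * c i)).
  apply/funext => y; rewrite /fmul /smulf mulrCA; congr (_ * _).
  by rewrite /comb big_distrr/=; apply: eq_bigr => i _; rewrite mulrA.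
by [].
Qed.

Lemma fmul_aeq_inj f g : fmul u f = fmul u g %[ae mu] -> f = g %[ae mu].
Proof.
apply: filterS => x h hx; have := h hx; rewrite /fmul => /mulfI; apply.
by rewrite fmorph_eq0.
Qed.

Lemma weighted_set_space f : fmul_set mu u (set_sum mu L V) f <->
  L2 f /\ weighted_space (cls f).
Proof.
have [Vvi VE _] := Vv; split.
  move=> [mf [w [mw [l [y [Ll Vy wly]]]] fw]].
  have [Ll2 Pl] := (range_L l).1 Ll.
  have : V y by []; rewrite VE => -[my [c yc]].
  have Luh := L2_cfmul cu Ll2; have Luc := L2_fmul_comb Luv c.
  have e : f = fmul u l + fmul u (comb v c) %[ae mu].
    apply: filterS3 fw wly yc => x h1 h2 h3 hx.
    rewrite (h1 hx) {1}/fmul (h2 hx) (_ : (l + y) x = l x + y x)// (h3 hx).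
    by rewrite mulrDr.
  have Lf : L2 f by apply: (L2_ae mf _ e); exact: L2D.
  split=> //; apply/weighted_spaceP; exists l, c; split=> //.
  rewrite -(clsD Luh Luc : cls (_ + _) = cls _ + cls _).
  by apply: (cls_eq Lf (L2D Luh Luc) e).
move=> [Lf /weighted_spaceP[l [c [Ll fE]]]].
have [Ll2 Pl] := (range_L l).1 Ll.
have Luh := L2_cfmul cu Ll2; have Luc := L2_fmul_comb Luv c.
have [mf _] := (L2P mu f).1 Lf; have [ml _] := (L2P mu l).1 Ll2.
have Vc := V_comb c.
have mc : cmeasurable (comb v c) by move: Vc; rewrite VE => -[].
split=> //; exists (l + comb v c).
  split; first exact: cmeasurableD.
  by exists l, (comb v c); split=> //; exact: aeq_refl.
have -> : fmul u (l + comb v c) = fmul u l + fmul u (comb v c).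
  by apply/funext => x; rewrite /fmul mulrDr.
by apply: (cls_eqP Lf (L2D Luh Luc)); rewrite fE; symmetry; exact: clsD.
Qed.

(** A real relation modulo [u L] is a complex combination in [V] whose weighted version equals that
    of some [h] in [L]. Dividing by the nonvanishing weight, the combination itself lies in [L],
    hence vanishes, and so do its complex coefficients. *)
Lemma weighted_indep :
  (forall phi, V phi -> (exists2 psi, L psi & phi = psi %[ae mu]) ->
     phi = (fun=> 0) %[ae mu]) ->
  forall t, gimage (mulq u) (opq P)
      (\sum_(j <- index_enum _) t j *: real_vec mu u v j) ->
    forall j, j \in index_enum ('I_m * bool)%type -> t j = 0.
Proof.
move=> A3 t; rewrite (sum_real_vec Luv) => -[h Ph hE] j _.
set c := cplx_coef t in hE *.
have Lr := rep_L2 h.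
have Lh : L (rep h).
  by apply/range_L; split=> //; rewrite cls_rep.
have e : comb v c = rep h %[ae mu].
  apply: fmul_aeq_inj; apply: (cls_eqP (L2_fmul_comb Luv c) (L2_cfmul cu Lr)).
  exact: hE.
have [_ _ ind] := Vv.
have cv0 : comb v c = (fun=> 0) %[ae mu].
  by apply: A3; [exact: V_comb|exists (rep h)].
have c0 := ind c cv0.
case: j => i [].
  exact: (congr1 (@complex.Im R) (c0 i)).
exact: (congr1 (@complex.Re R) (c0 i)).
Qed.

End weighted_sum_space.

(** * Local convergence *)

Section cutoff.
Context d (T : measurableType d) (R : realType).
Variable mu : {measure set T -> \bar R}.
Local Notation L2 := (L2 mu).
Local Notation H := (L2hilbert mu).
Local Notation cls := (cls mu : (T -> R[i]) -> H).

Lemma contraction_indic (B : set T) : measurable B -> contraction_fun (\1_B : T -> R).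
Proof.
move=> mB; split; first exact: measurable_indic.
by move=> x; rewrite indicE ger0_norm// lern1 leq_b1.
Qed.

Lemma contraction_sqrt (w : T -> R) : measurable_fun setT w ->
  (forall x, 0 <= w x <= 1) -> contraction_fun (fun x => Num.sqrt (w x)).
Proof.
move=> mw w01; split.
  apply: (measurableT_comp (f := @Num.sqrt R)) => //.
  by apply: continuous_measurable_fun; exact: sqrt_continuous.
move=> x; have /andP[w0 w1] := w01 x.
by rewrite ger0_norm ?sqrtr_ge0// -sqrtr1 ler_sqrt.
Qed.

(** Dominated convergence: the integrand is eventually 0 at each point and at most [4 |f|^2], as
    [|u - 1| <= 2]. *)
Lemma mulq_cvg1 (u : nat -> T -> R) (x : H) : (forall k, contraction_fun (u k)) ->
  (forall t, \forall k \near \oo, u k t = 1) -> cvgH (fun k => mulq (u k) x) x.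
Proof.
move=> cu u1; have [f Lf ->] := clsP x.
apply: cvgH_sqr.
have Luf k : L2 (fmul (u k) f - f) by apply: L2B => //; exact: L2_cfmul.
have -> : (fun k => nrm (mulq (u k) (cls f) - cls f) ^+ 2) =
    (fun k => rip mu (fmul (u k) f - f) (fmul (u k) f - f)).
  apply/funext => k; rewrite (mulq_cls (cu k) Lf) sqr_nrm.
  rewrite -(clsB (L2_cfmul (cu k) Lf) Lf : cls _ = cls _ - cls _).
  exact: ip_cls.
have md k : measurable_fun setT
    (fun t => (dotf (fmul (u k) f - f) (fmul (u k) f - f) t)%:E).
  by have [mf _] := (L2P mu _).1 (Luf k); exact/measurable_EFinP/measurable_dotf.
have c0 : {ae mu, forall t, setT t ->
    (fun k => (dotf (fmul (u k) f - f) (fmul (u k) f - f) t)%:E) @ \oo --> 0%E}.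
  apply: aeW => t _; apply: cvg_near_cst; have := u1 t; apply: filterS => k uk.
  rewrite /dotf (_ : (fmul (u k) f - f) t = fmul (u k) f t - f t)//.
  by rewrite /fmul uk rmorph1 mul1r subrr cRe0 cIm0 mulr0 addr0.
have [_ ig] := (L2P mu f).1 Lf.
have ig4 := integrableZl measurableT 4 ig.
have dom : {ae mu, forall t (n : nat), setT t ->
    (`|(dotf (fmul (u n) f - f) (fmul (u n) f - f) t)%:E| <=
     4%:E * (EFin \o dotf f f) t)%E}.
  apply: aeW => t k _; rewrite /= lee_fin ger0_norm ?dotf_ge0//.
  rewrite /dotf (_ : (fmul (u k) f - f) t = fmul (u k) f t - f t)//.
  rewrite /fmul !cReD !cImD !cReN !cImN cReM cImM /= !mul0r subr0 addr0.
  have := (cu k).2 t; rewrite ler_norml => /andP[h1 h2].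
  move: (complex.Re (f t)) (complex.Im (f t)) => p q.
  have -> : (u k t * p - p) * (u k t * p - p) + (u k t * q - q) * (u k t * q - q) =
    (u k t - 1) ^+ 2 * (p ^+ 2 + q ^+ 2) by ring.
  rewrite -!expr2; apply: ler_wpM2r; first by rewrite addr_ge0// sqr_ge0.
  rewrite -subr_ge0.
  have -> : 4 - (u k t - 1) ^+ 2 = (u k t + 1) * (3 - u k t) by ring.
  by apply: mulr_ge0; lra.
have [_ _] := dominated_convergence measurableT md (measurable_cst 0%E) c0 ig4 dom.
rewrite integral0 => h.
by rewrite /rip; exact: fine_cvg h.
Qed.

End cutoff.

(** * Bounded cutoffs and local trace class convergence *)

Section bounded_sets.
Context (R : realType) (E : completeMetricType R).

(** Taking the interior makes the set open, hence Borel, directly. *)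
Definition cutoff_set (k : nat) : set (Borel E) := interior (ball (point : E) k%:R).

Lemma cutoff_measurable k : measurable (cutoff_set k).
Proof. by apply: sub_sigma_algebra; exact: open_interior. Qed.

Lemma cutoff_bounded k : metric_bounded (cutoff_set k : set E).
Proof. by exists point, k%:R; exact: interior_subset. Qed.

Lemma cutoff_cover (t : E) : \forall k \near \oo, cutoff_set k t.
Proof.
have [r tr] : exists r : R, ball (point : E) r t.
  by exists (mdist point t + 1); rewrite ballEmdist/= ltrDl.
(* The extra 1 leaves room for the unit ball around [t], which puts [t] in the interior. *)
have h : \forall k \near \oo, r + 1 <= k%:R.
  exact: nbhs_infty_ger.
apply: filterS h => k rk; apply/nbhs_ballP; exists 1 => //= y ty.
exact: le_ball rk _ (ball_triangle tr ty).
Qed.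

End bounded_sets.

Section local_operators.
Context (R : realType) (E : completeMetricType R).
Variable mu : {measure set (Borel E) -> \bar R}.
Local Notation H := (L2hilbert mu).

Definition bounded_cutoff (C : H -> H) := exists2 B : set (Borel E),
  measurable B /\ metric_bounded B & C = mulq (\1_B : Borel E -> R).

Lemma bounded_cutoff_contraction C : bounded_cutoff C -> symop C /\ bnd C 1.
Proof.
move=> [B [mB _] ->]; split; [apply: mulq_sym|apply: mulq_bnd];
exact: contraction_indic.
Qed.

Lemma bounded_cutoff_dense (x y : H) e : 0 < e ->
  exists2 C, bounded_cutoff C & nrm (x - C x) <= e /\ nrm (y - C y) <= e.
Proof.
move=> e0.
pose u k : Borel E -> R := \1_(@cutoff_set R E k).
have cu k : contraction_fun (u k) by apply: contraction_indic; exact: cutoff_measurable.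
have u1 t : \forall k \near \oo, u k t = 1.
  apply: filterS (cutoff_cover t) => k kt.
  by rewrite /u indicE mem_set.
have [N hN] := (cvgHP _ _).1 (mulq_cvg1 x cu u1) e e0.
have [N' hN'] := (cvgHP _ _).1 (mulq_cvg1 y cu u1) e e0.
exists (mulq (u (maxn N N'))).
  exists (cutoff_set (maxn N N')) => //.
  by split; [exact: cutoff_measurable|exact: cutoff_bounded].
by split; rewrite -nrmN opprB; [apply: hN|apply: hN']; rewrite ?leq_maxl ?leq_maxr.
Qed.

Lemma I1loc_hs_fin P C : orth_proj mu P -> I1loc mu P -> bounded_cutoff C ->
  hs_fin (onbq (mu := mu) : _ -> H) C (opq P).
Proof.
move=> PP [_ hP] [B [mB bB] ->].
exact: (trace_class_hs_fin (contraction_indic R mB) PP).1 (hP B mB bB).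
Qed.

Lemma hs_fin_I1loc P : orth_proj mu P ->
  (forall C, bounded_cutoff C -> hs_fin (onbq (mu := mu) : _ -> H) C (opq P)) ->
  I1loc mu P.
Proof.
move=> PP hP; split; first by case: PP.
move=> B mB bB; apply: (trace_class_hs_fin (contraction_indic R mB) PP).2.
by apply: hP; exists B.
Qed.

(** The bridge to the abstract part, crossed once in each direction: for the given projections and
    for those onto the weighted sums. *)
Lemma I1loc_cvgP P_ P : (forall n, orth_proj mu (P_ n)) -> orth_proj mu P ->
  I1loc_cvg mu P_ P <->
  strong_hs_cvg (onbq (mu := mu) : _ -> H) bounded_cutoff (fun n => opq (P_ n)) (opq P).
Proof.
move=> PP_ PP; split.
  move=> [l_ l h]; apply: trace_abs_cvg_strong_hs_cvg => //.
  - exact: onbq_total.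
  - exact: bounded_cutoff_contraction.
  - exact: bounded_cutoff_dense.
  - by move=> n; exact: orth_proj_opq.
  - exact: orth_proj_opq.
  - by move=> C n; exact: (I1loc_hs_fin (PP_ n) (l_ n)).
  - by move=> C; exact: (I1loc_hs_fin PP l).
  - move=> C [B [mB bB] ->].
    exact: (trace_norm_bsum0 (contraction_indic R mB) PP_ PP (h B mB bB)).
move=> [_ h]; split.
- by move=> n; apply: (hs_fin_I1loc (PP_ n)) => C /h[].
- by apply: (hs_fin_I1loc PP) => C /h[].
- move=> B mB bB; have [|h1 h2 h3] := h (mulq \1_B); first by exists B.
  exact: (trace_norm_cvg0 (contraction_indic R mB) PP_ PP h1 h2 h3).
Qed.

End local_operators.

Section real_vectors.
Context d (T : measurableType d) (R : realType).
Variable mu : {measure set T -> \bar R}.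
Local Notation L2 := (L2 mu).
Local Notation H := (L2hilbert mu).
Local Notation cls := (cls mu : (T -> R[i]) -> H).

Lemma L2_cvg_cls f_ f : (forall n, L2 (f_ n)) -> L2 f ->
  L2_cvg mu f_ f -> cvgH (fun n => cls (f_ n)) (cls f).
Proof.
move=> Lf_ Lf h; split.
have -> : (fun n => nrm (cls (f_ n) - cls f)) = (fun n => fine (L2norm mu (f_ n - f))).
  apply/funext => n; rewrite (L2norm_cls (L2B (Lf_ n) Lf)).
  by rewrite (clsB (Lf_ n) Lf : cls _ = cls _ - cls _).
exact: fine_cvg h.
Qed.

Lemma real_vec_cvg m (u : T -> R) (v_ : nat -> 'I_m -> T -> R[i]) v :
  (forall n i, L2 (fmul u (v_ n i))) -> (forall i, L2 (fmul u (v i))) ->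
  (forall i, L2_cvg mu (fun n => fmul u (v_ n i)) (fmul u (v i))) ->
  forall j, cvgH (fun n => real_vec mu u (v_ n) j) (real_vec mu u v j).
Proof.
move=> Lv_ Lv h [i []]; rewrite /real_vec /=; last exact: L2_cvg_cls.
apply: bnd_cvg; [exact: Jq_lin|exact: Jq_bnd|exact: L2_cvg_cls].
Qed.

Lemma fmul_aeq (u : T -> R) f g :
  f = g %[ae mu] -> fmul u f = fmul u g %[ae mu].
Proof. by apply: filterS => x e xT; rewrite /fmul e. Qed.

Lemma mulq_inj (u : T -> R) (x : H) : contraction_fun u -> (forall t, u t != 0) ->
  mulq u x = 0 -> x = 0.
Proof.
move=> cu u0; have [f Lf ->] := clsP x.
rewrite (mulq_cls cu Lf) => h.
have L0 : L2 (fun=> 0) by exact: L2_0.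
rewrite -(cls0 mu); apply: (cls_eq Lf L0).
apply: (fmul_aeq_inj u0).
have e : fmul u (fun=> 0) = (fun=> 0) :> (T -> R[i]).
  by apply/funext => t; rewrite /fmul mulr0.
rewrite e; apply: (@cls_eqP _ _ _ mu) => //; exact: L2_cfmul.
Qed.

End real_vectors.

Theorem proposition2p6
  (R : realType) (E : completeMetricType R)
  (E_locally_compact : locally_compact [set: E])
  (E_separable : separable E)
  (E_proper : forall B : set E, metric_bounded B -> compact (closure B))
  (mu : {sigma_finite_measure set (Borel E) -> \bar R})
  (E0 : set (Borel E)) (mE0 : measurable E0)
  (L_ V_ : nat -> set (E -> R[i])) (L V : set (E -> R[i]))
  (Pi_ : nat -> (E -> R[i]) -> (E -> R[i])) (Pi : (E -> R[i]) -> (E -> R[i]))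
  (L_range_n : forall n, orth_proj_onto mu (Pi_ n) (L_ n))
  (Pi_loc_n : forall n, I1loc mu (Pi_ n))
  (L_range : orth_proj_onto mu Pi L)
  (Pi_loc : I1loc mu Pi)
  (V_loc_n : forall n, V_ n `<=` L2loc mu)
  (V_findim_n : forall n, finite_dim mu (V_ n))
  (V_loc : V `<=` L2loc mu)
  (V_findim : finite_dim mu V)
  (A_n : forall n, assumption_A mu (L_ n) (Pi_ n) (V_ n) E0)
  (A : assumption_A mu L Pi V E0)
  (Pi_cvg : I1loc_cvg mu Pi_ Pi)
  (m : nat) (v_ : nat -> 'I_m -> E -> R[i]) (v : 'I_m -> E -> R[i])
  (v_basis_n : forall n, is_basis mu (V_ n) (v_ n))
  (v_basis : is_basis mu V v)
  (v_cvg : forall i, L2loc_cvg mu (fun n => v_ n i) (v i))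
  (g : E -> R)
  (g_measurable : measurable_fun [set: Borel E] g)
  (g_range : forall x, 0 < g x <= 1)
  (g_trace_class_n : forall n,
     trace_class mu (sandwich (fun x => Num.sqrt (1 - g x)) (Pi_ n)))
  (g_trace_class :
     trace_class mu (sandwich (fun x => Num.sqrt (1 - g x)) Pi))
  (g_trace_cvg :
     trace mu (sandwich (fun x => Num.sqrt (1 - g x)) (Pi_ n)) @[n --> \oo]
       --> trace mu (sandwich (fun x => Num.sqrt (1 - g x)) Pi))
  (gV_n : forall n f, V_ n f -> L2 mu (fmul (fun x => Num.sqrt (g x)) f))
  (gV : forall f, V f -> L2 mu (fmul (fun x => Num.sqrt (g x)) f))
  (gv_cvg : forall i,
     L2_cvg mu (fun n => fmul (fun x => Num.sqrt (g x)) (v_ n i))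
               (fmul (fun x => Num.sqrt (g x)) (v i))) :
  let gH_ n :=
    fmul_set mu (fun x => Num.sqrt (g x)) (set_sum mu (L_ n) (V_ n)) in
  let gH := fmul_set mu (fun x => Num.sqrt (g x)) (set_sum mu L V) in
  ((forall n, L2_closed mu (gH_ n)) /\ L2_closed mu gH) /\
  exists (Pig_ : nat -> (E -> R[i]) -> (E -> R[i]))
         (Pig : (E -> R[i]) -> (E -> R[i])),
    [/\ forall n, orth_proj_onto mu (Pig_ n) (gH_ n),
        orth_proj_onto mu Pig gH &
        I1loc_cvg mu Pig_ Pig].
Proof.
pose su : Borel E -> R := fun x => Num.sqrt (g x).
pose sd : Borel E -> R := fun x => Num.sqrt (1 - g x).
rewrite -/su -/sd in gV_n gV gv_cvg g_trace_class_n g_trace_class g_trace_cvg *.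
move=> gH_ gH.
have csu : contraction_fun su.
  by apply: contraction_sqrt => // x; have /andP[/ltW -> ->] := g_range x.
have csd : contraction_fun sd.
  apply: contraction_sqrt; first exact: measurable_funB.
  by move=> x; have /andP[h1 h2] := g_range x; apply/andP; split; lra.
have su0 x : su x != 0.
  by rewrite gt_eqF// sqrtr_gt0; have /andP[] := g_range x.
have sud x : su x ^+ 2 + sd x ^+ 2 = 1.
  have /andP[h1 h2] := g_range x.
  rewrite !sqr_sqrtr; [by rewrite addrC subrK|lra|lra].
have PP_ n : orth_proj mu (Pi_ n) by have [] := L_range_n n.
have PP : orth_proj mu Pi by have [] := L_range.
have Lv_ n i : L2 mu (fmul su (v_ n i)) by apply: gV_n; have [] := v_basis_n n.
have Lv i : L2 mu (fmul su (v i)) by apply: gV; have [] := v_basis.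
have gP := (I1loc_cvgP PP_ PP).1 Pi_cvg.
have fD_ n := (trace_class_hs_fin csd (PP_ n)).1 (g_trace_class_n n).
have fD := (trace_class_hs_fin csd PP).1 g_trace_class.
have cD := trace_cvg_hs_conv csd PP_ PP gP.1 fD_ fD g_trace_cvg.
(* An equality on all of [E] restricts to [E0], where (A3) applies; this gives that [V] meets [L]
   only in 0. *)
have ind : forall phi, V phi -> (exists2 psi, L psi & phi = psi %[ae mu]) ->
    phi = (fun=> 0) %[ae mu].
  move=> phi Vphi [psi Lpsi e]; apply: (A3 A Vphi); exists psi => //.
  exact: fmul_aeq.
(* Weights and cutoffs are both multiplication operators, hence commute. *)
have Gcomm C : bounded_cutoff (mu := mu) C ->
    [/\ symop C, bnd C 1 & forall x, mulq su (C x) = C (mulq su x)].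
  move=> CC; have [h1 h2] := bounded_cutoff_contraction CC; split=> //.
  by case: CC => B [mB _] ->; exact: mulq_comm csu (contraction_indic R mB).
have [Q_ [Q [QM_ QM gQ]]] := projections_cvg (onbq_total mu) (mulq_sym csu) (mulq_sym csd)
  (fun x => mulq_pythagoras x csu csd sud) (fun x => mulq_inj csu su0) Gcomm
  (fun n => orth_proj_opq (PP_ n)) (orth_proj_opq PP) gP fD_ fD cD
  (real_vec_cvg Lv_ Lv gv_cvg) (index_enum_uniq _)
  (weighted_indep csu su0 L_range v_basis gV ind).
have WM_ n := weighted_set_space csu (L_range_n n) (v_basis_n n) (gV_n n).
have WM := weighted_set_space csu L_range v_basis gV.
have MJ_ n := weighted_space_J csu (L_range_n n) (v_basis_n n) (gV_n n).
have MJ := weighted_space_J csu L_range v_basis gV.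
split.
  split=> [n|]; first exact: L2_closed_of_proj (WM_ n) (QM_ n).
  exact: L2_closed_of_proj WM QM.
have oQ_ n := orth_proj_onto_ofq (WM_ n) (MJ_ n) (QM_ n).
have oQ := orth_proj_onto_ofq WM MJ QM.
exists (fun n => ofq (Q_ n)), (ofq Q); split; [exact: oQ_|exact: oQ|].
apply: (I1loc_cvgP (fun n => (oQ_ n).1) oQ.1).2.
rewrite (_ : opq (ofq Q) = Q); last by apply/funext => x; exact: opq_ofq.
rewrite (_ : (fun n => opq (ofq (Q_ n))) = Q_)//.
by apply/funext => n; apply/funext => x; exact: opq_ofq.
Qed.
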